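(* Let $\Omega$ be a bounded, smooth and strictly convex domain in $\mathbb{C}^2$. Suppose that $u\in\mathrm{PSH}(\Omega)\cap C^\infty(\Omega)\cap C^{1,1}(\bar{\Omega})$ is the unique (up to multiplication by a positive constant) solution of the Dirichlet problem $$\begin{cases} \det(u_{i\bar{j}})=\lambda(\Omega)(-u)^2 & \mathrm{in}\ \Omega,\\ u<0 & \mathrm{in}\ \Omega,\\ u=0 & \mathrm{on}\ \partial\Omega. \end{cases}$$ Then the function $v=-\log(-u/4)$ is strictly convex in $\Omega$.
   Context: Identify $\mathbb{C}^2$ with $\mathbb{R}^4$; convexity of $v$ is real convexity on $\mathbb{R}^4$. $\mathrm{PSH}(\Omega)$ denotes the plurisubharmonic functions on $\Omega$, and $u_{i\bar j}=\frac{\partial^2u}{\partial z_i\partial\bar z_j}$, $1\le i,j\le 2$, is the complex Hessian. $\lambda(\Omega)>0$ is the first Dirichlet eigenvalue of the complex Monge-Ampère operator on $\Omega$: by known results, there is a unique constant $\lambda(\Omega)>0$ for which the displayed problem has a solution $u\in\mathrm{PSH}(\Omega)\cap C^\infty(\Omega)\cap C^{1,1}(\bar\Omega)$, and this solution (the eigenfunction) is unique up to multiplication by a positive constant. *)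

(* Defs.v *)
From HB Require Import structures.
From mathcomp Require Import all_boot all_order all_algebra.
From mathcomp Require Import all_classical all_reals all_analysis.
From mathcomp Require Import complex.

Set Implicit Arguments.
Unset Strict Implicit.
Unset Printing Implicit Defensive.

Import Order.TTheory GRing.Theory Num.Theory.
Import numFieldNormedType.Exports.

Local Open Scope classical_set_scope.
Local Open Scope complex_scope.
Local Open Scope ring_scope.

(* C^2 identified with R^4, in the real coordinates (x_1, x_2, y_1, y_2)
   where z_j = x_j + i y_j: the coordinate x_j has index lshift 2 j and
   y_j has index rshift 2 j. *)
Notation C2 R := 'rV[R]_(2 + 2).

Definition C2scale (R : realType) (c : R[i]) (w : C2 R) : C2 R :=
  row_mx (complex.Re c *: lsubmx w - complex.Im c *: rsubmx w)
         (complex.Re c *: rsubmx w + complex.Im c *: lsubmx w).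

Definition expi (R : realType) (t : R) : R[i] := cos t +i* sin t.

Definition partial (R : realType) (k : 'I_(2 + 2)) (f : C2 R -> R) : C2 R -> R :=
  fun z => 'D_(delta_mx 0 k) f z.

Definition cpartial (R : realType) (k : 'I_(2 + 2)) (f : C2 R -> R[i]) :
    C2 R -> R[i] :=
  fun z => partial k (fun w => complex.Re (f w)) z
             +i* partial k (fun w => complex.Im (f w)) z.

(* Wirtinger derivatives d/dz_j and d/d(conjugate of z_j) *)
Definition wirtinger (R : realType) (j : 'I_2) (f : C2 R -> R[i]) : C2 R -> R[i] :=
  fun z => (cpartial (lshift 2 j) f z - 'i%C * cpartial (rshift 2 j) f z) / 2.

Definition wirtinger_bar (R : realType) (j : 'I_2) (f : C2 R -> R[i]) :
    C2 R -> R[i] :=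
  fun z => (cpartial (lshift 2 j) f z + 'i%C * cpartial (rshift 2 j) f z) / 2.

Definition complex_hessian (R : realType) (u : C2 R -> R) (z : C2 R) : 'M[R[i]]_2 :=
  \matrix_(i < 2, j < 2) wirtinger i (wirtinger_bar j (fun w => (u w)%:C)) z.

(* C^oo on an open set: every iterated partial derivative is differentiable
   (hence continuous) there. *)
Definition smooth_on (R : realType) (A : set (C2 R)) (f : C2 R -> R) : Prop :=
  forall (s : seq 'I_(2 + 2)) (z : C2 R), A z ->
    differentiable (foldr (fun k g => partial k g) f s) z.

(* C^{1,1} up to the boundary. A Lipschitz partial derivative on A is uniformly
   continuous, so it extends (uniquely, with the same Lipschitz constant) to the
   closure of A. *)
Definition C11_closure (R : realType) (A : set (C2 R)) (f : C2 R -> R) : Prop :=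
  [/\ {within closure A, continuous f},
      forall z, A z -> differentiable f z &
      forall k : 'I_(2 + 2), [lipschitz partial k f z | z in A]].

(* Plurisubharmonicity on an open set: upper semicontinuity, and the
   sub-mean-value inequality on every closed disc of every complex line. *)
Definition psh (R : realType) (A : set (C2 R)) (u : C2 R -> \bar R) : Prop :=
  [/\ forall z, A z -> (u z < +oo)%E,
      forall z (a : R), A z -> (u z < a%:E)%E ->
        \forall w \near z, (u w < a%:E)%E &
      forall z w : C2 R,
        (forall c : R[i], `|c| <= 1 -> A (z + C2scale c w)) ->
        ((2 * pi)%:E * u z <=
          \int[lebesgue_measure]_(t in `[0%R, (2 * pi)%R])
             u (z + C2scale (expi t) w)%R)%E].

Definition boundary (R : realType) (A : set (C2 R)) : set (C2 R) :=
  closure A `\` interior A.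

Definition domain (R : realType) (A : set (C2 R)) : Prop :=
  [/\ open A, A !=set0 & connected A].

Definition smooth_boundary (R : realType) (A : set (C2 R)) : Prop :=
  forall p, boundary A p ->
    exists (U : set (C2 R)) (rho : C2 R -> R),
      [/\ open U, U p, smooth_on U rho,
          (forall z, U z -> (A z <-> rho z < 0)) &
          exists k, partial k rho p != 0].

Definition strictly_convex_domain (R : realType) (A : set (C2 R)) : Prop :=
  forall (x y : C2 R) (t : R), closure A x -> closure A y -> x != y ->
    0 < t < 1 -> A (t *: x + (1 - t) *: y).

Definition strictly_convex_on (R : realType) (A : set (C2 R)) (f : C2 R -> R) : Prop :=
  forall (x y : C2 R) (t : R), A x -> A y -> x != y -> 0 < t < 1 ->
    f (t *: x + (1 - t) *: y) < t * f x + (1 - t) * f y.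

(* The Dirichlet problem  det (u_{i jbar}) = lam (-u)^2  in the class
   PSH(Omega), C^oo(Omega), C^{1,1}(closure of Omega). *)
Definition MA_eigenfunction (R : realType) (Omega : set (C2 R)) (lam : R)
    (u : C2 R -> R) : Prop :=
  [/\ psh Omega (EFin \o u), smooth_on Omega u & C11_closure Omega u] /\
  [/\ forall z, Omega z -> \det (complex_hessian u z) = (lam * (- u z) ^+ 2)%:C,
      forall z, Omega z -> u z < 0 &
      forall z, boundary Omega z -> u z = 0].

(* lam is the first Dirichlet eigenvalue lambda(Omega) of the complex
   Monge-Ampere operator, characterized as the positive constant for which the
   Dirichlet problem is solvable. That such a constant is unique is a theorem
   and is not built into the definition. *)
Definition MA_first_eigenvalue (R : realType) (Omega : set (C2 R)) (lam : R) : Prop :=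
  0 < lam /\ exists u, MA_eigenfunction Omega lam u.

(* Main.v *)
Require Import Defs.
From mathcomp Require Import all_boot all_order all_algebra.
From mathcomp Require Import all_classical all_reals all_analysis.
From mathcomp Require Import complex.
From mathcomp Require Import ring lra.

Set Implicit Arguments.
Unset Strict Implicit.
Unset Printing Implicit Defensive.

Import Order.TTheory GRing.Theory Num.Theory.
Import numFieldNormedType.Exports.

Local Open Scope classical_set_scope.
Local Open Scope ring_scope.

(** Let w = - ln (- u / 4). The real form D^2 w - Dw (x) Dw equals D^2 u / (- u), and
    the equation says that its Hermitian part, in the normalization of qR and hdet,
    has the constant determinant L = 16 lam. This Hermitian part is positive: it is
    nondegenerate, the domain is connected, and at an interior minimum of u it is
    positive. The function w tends to infinity at the boundary.

    Convexity comes from a two-point maximum principle. Consider the gap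
    w ((x + y) / 2) - (w x + w y) / 2. At a maximum the gradients of w at the three
    points agree, and the Hessian at the midpoint is at most the mean of the Hessians
    at x and y after arbitrary displacements a and b of these points. Displacements
    that differ by a vector of the complex kernel of the common gradient leave the
    gradient terms alone; optimizing over them yields a harmonic type mean of the
    Hermitian forms at x and y, whose determinant is at most L
    [harmonic_mean_det, touch_midpoint]. So the gap satisfies the strong maximum
    principle [strong_maximum_principle, no_touching_midpoint]. A positive
    maximum would propagate to pairs whose midpoint is the minimum of w, which is
    absurd [gap_le0].

    That the maximum is attained uses the boundary. Since u is subharmonic and the
    boundary satisfies an interior ball condition, u does not vanish to second order
    at the boundary [hopf]; as u is C^{1,1}, its gradient is bounded below in a strip
    [gradient_strip]. Hence - u is comparable to the distance to the boundary, which
    together with the convexity of the domain bounds the gap [gap_bounded]; moreover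
    (1 - e) w is a strict subsolution in the strip [strict_strip], so that the
    midpoint of a pair maximizing the penalized gap lies in a fixed compact set
    [gap_attained].

    Strictness is a constant rank theorem. Now D^2 w >= 0, and where its least
    eigenvalue vanishes, the equation is differentiated twice in the null direction
    e. The second variation of D^2 w (e, e), with e displaced along with the point by
    vectors of the complex kernel of the gradient, cancels the third and fourth
    order terms [constant_rank_algebra, touch_hessian], and the strong maximum principle
    applies to the least eigenvalue [no_touching_hessian]. If D^2 w were degenerate
    somewhere it would be so everywhere, but it is positive where w minus the square
    of the norm is minimal [hess_gt0]. *)

(** * Directional derivatives of smooth functions *)

Section DirectionalDerivatives.
Context {R : realType} {V : normedModType R}.
Implicit Types (A : set V) (f g : V -> R) (E F x : V).

(** The directional derivative is sealed, so that unification never unfolds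
    the limits inside iterated derivatives. *)
Lemma dd_def : {d : V -> (V -> R) -> V -> R | forall E f z, d E f z = 'D_E f z}.
Proof. by exists (fun E f z => 'D_E f z). Qed.

Definition dd := sval dd_def.

Lemma ddE E f z : dd E f z = 'D_E f z.
Proof. exact: (svalP dd_def). Qed.

(** The differential is a chosen linear map, so the one of f has to be exhibited
    again as a differential of g. *)
Lemma near_eq_differentiable f g x :
  (\near x, f x = g x) -> differentiable f x -> differentiable g x.
Proof.
move=> fg df; have fgx : f x = g x := nbhs_singleton fg.
apply/diffP; apply: (@getPex _ (fun df : {linear V -> R} => continuous df /\
  forall y, g y = g (lim (nbhs x)) + df (y - lim (nbhs x))
                  +o_(y \near x) (y - lim (nbhs x)))).
exists ('d f x); split; first exact: diff_continuous.
apply/eqaddoEx => y; rewrite lim_id //.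
move: y; apply/funeqP; apply/eqaddoP => e e0.
have [_ /funeqP/eqaddoP/(_ e e0)] := (proj1 (diffP _ _) df); rewrite lim_id // => H.
by apply: filterS2 fg H => y fgy; rewrite /= !fctE fgy fgx.
Qed.

Lemma dd_congr A f g E x : open A -> (forall z, A z -> f z = g z) -> A x ->
  dd E f x = dd E g x.
Proof.
move=> oA fg Ax; rewrite !ddE; apply: near_eq_derive.
by apply: filterS (open_nbhs_nbhs (conj oA Ax)).
Qed.

Lemma differentiable_congr A f g x : open A -> (forall z, A z -> f z = g z) ->
  A x -> differentiable f x -> differentiable g x.
Proof.
move=> oA fg Ax; apply: near_eq_differentiable.
by apply: filterS (open_nbhs_nbhs (conj oA Ax)).
Qed.

Lemma ddD E F f x : differentiable f x -> dd (E + F) f x = dd E f x + dd F f x.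
Proof. by move=> df; rewrite !ddE !deriveE // linearD. Qed.

Lemma ddZ a E f x : differentiable f x -> dd (a *: E) f x = a * dd E f x.
Proof. by move=> df; rewrite !ddE !deriveE // linearZ. Qed.

Lemma ddN E f x : differentiable f x -> dd (- E) f x = - dd E f x.
Proof. by move=> df; rewrite !ddE !deriveE // linearN. Qed.

Lemma dd0 f x : dd 0 f x = 0.
Proof. by rewrite !ddE derive0. Qed.

Lemma is_derive_line f x E (t : R) : differentiable f (x + t *: E) ->
  is_derive t 1 (fun s : R => f (x + s *: E)) (dd E f (x + t *: E)).
Proof.
move=> df; have d1 : is_derive t 1 (fun s : R => x + s *: E) E.
  have -> : (fun s : R => x + s *: E) = cst x + (fun s : R => s *: E) by [].
  have d0 : is_derive t 1 (fun s : R => s *: E) E.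
    apply: DeriveDef; first by apply/derivable1_diffP.
    by rewrite deriveE // diff_val scale1r.
  by rewrite -[X in is_derive _ _ _ X]add0r; apply: is_deriveD.
have d1' : differentiable (fun s : R => x + s *: E) t.
  by apply/derivable1_diffP; apply: ex_derive.
apply: DeriveDef.
  by apply/derivable1_diffP; apply: (differentiable_comp d1').
rewrite deriveE; last exact: (differentiable_comp d1').
by rewrite (diff_comp d1' df) /= -(deriveE _ d1') (@derive_val _ _ _ _ _ _ _ d1) !ddE deriveE.
Qed.

(** Directional derivatives in place of partial ones make the closure properties
    below plain inductions on the order. *)
Fixpoint Sm A n f : Prop := (forall z, A z -> differentiable f z) /\
  if n is m.+1 then forall E, Sm A m (dd E f) else True.

Definition smooth A f := forall n, Sm A n f.

Lemma Sm_diff A n f x : Sm A n f -> A x -> differentiable f x.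
Proof. by case: n => [|n] [h _]; apply: h. Qed.

Lemma SmW A n f : Sm A n.+1 f -> Sm A n f.
Proof. by elim: n f => [|n IH] f [df h]; split=> // E; apply: IH; apply: h. Qed.

Lemma Sm_congr A n f g : open A -> (forall z, A z -> f z = g z) ->
  Sm A n f -> Sm A n g.
Proof.
move=> oA; elim: n f g => [|n IH] f g fg [df h].
  by split=> // z Az; exact: (differentiable_congr oA fg Az (df z Az)).
split=> [z Az|E]; first by exact: (differentiable_congr oA fg Az (df z Az)).
by apply: IH (h E) => z Az; apply: (dd_congr E oA fg).
Qed.

Lemma smooth_diff A f x : smooth A f -> A x -> differentiable f x.
Proof. by move=> sf; apply: Sm_diff (sf 0%N). Qed.

Lemma smooth_dd A f E : smooth A f -> smooth A (dd E f).
Proof. by move=> sf n; apply: (sf n.+1).2. Qed.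

Lemma smooth_congr A f g : open A -> (forall z, A z -> f z = g z) ->
  smooth A f -> smooth A g.
Proof. by move=> oA fg sf n; apply: Sm_congr (sf n). Qed.

Lemma smooth_sub A B f : A `<=` B -> smooth B f -> smooth A f.
Proof.
move=> AB sf n; elim: n f sf => [|n IH] f sf; (split; first by move=> z /AB; apply: smooth_diff) => // E.
by apply: IH; apply: smooth_dd.
Qed.

Lemma dd_add f g E x : differentiable f x -> differentiable g x ->
  dd E (fun z => f z + g z) x = dd E f x + dd E g x.
Proof. by move=> df dg; rewrite !ddE; apply: deriveD; apply: diff_derivable. Qed.

Lemma dd_mul f g E x : differentiable f x -> differentiable g x ->
  dd E (fun z => f z * g z) x = f x * dd E g x + g x * dd E f x.
Proof. by move=> df dg; rewrite !ddE; apply: deriveM; apply: diff_derivable. Qed.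

Lemma dd_scale (c : R) f E x : differentiable f x ->
  dd E (fun z => c * f z) x = c * dd E f x.
Proof. by move=> df; rewrite !ddE; apply: (@deriveZ _ _ _ f c); apply: diff_derivable. Qed.

Lemma dd_opp f E x : differentiable f x -> dd E (fun z => - f z) x = - dd E f x.
Proof. by move=> df; rewrite !ddE; apply: deriveN; apply: diff_derivable. Qed.

Lemma dd_cst (c : R) E x : dd E (fun=> c) x = 0.
Proof. by rewrite ddE; apply: derive_cst. Qed.

Lemma Sm_add A n f g : open A -> Sm A n f -> Sm A n g -> Sm A n (fun z => f z + g z).
Proof.
move=> oA; elim: n f g => [|n IH] f g sf sg.
  by split=> // z Az; apply: differentiableD (Sm_diff sf Az) (Sm_diff sg Az).
split=> [z Az|E]; first exact: differentiableD (Sm_diff sf Az) (Sm_diff sg Az).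
apply: (Sm_congr oA _ (IH _ _ (sf.2 E) (sg.2 E))) => z Az.
  by rewrite (dd_add _ (Sm_diff sf Az) (Sm_diff sg Az)).
Qed.

Lemma Sm_mul A n f g : open A -> Sm A n f -> Sm A n g -> Sm A n (fun z => f z * g z).
Proof.
move=> oA; elim: n f g => [|n IH] f g sf sg.
  by split=> // z Az; apply: differentiableM (Sm_diff sf Az) (Sm_diff sg Az).
split=> [z Az|E]; first exact: differentiableM (Sm_diff sf Az) (Sm_diff sg Az).
apply: (Sm_congr oA _ (Sm_add oA (IH _ _ (SmW sf) (sg.2 E)) (IH _ _ (SmW sg) (sf.2 E)))) => z Az.
  by rewrite (dd_mul _ (Sm_diff sf Az) (Sm_diff sg Az)).
Qed.

Lemma Sm_cst A n (c : R) : Sm A n (fun=> c).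
Proof.
elim: n c => [|n IH] c; (split; first by move=> z _; apply: differentiable_cst) => // E.
by have -> : dd E (fun=> c) = (fun=> 0) by apply/funext => z; rewrite dd_cst.
Qed.

Lemma smooth_cst A (c : R) : smooth A (fun=> c).
Proof. by move=> n; apply: Sm_cst. Qed.

Lemma smooth_add A f g : open A -> smooth A f -> smooth A g ->
  smooth A (fun z => f z + g z).
Proof. by move=> oA sf sg n; apply: Sm_add. Qed.

Lemma smooth_mul A f g : open A -> smooth A f -> smooth A g ->
  smooth A (fun z => f z * g z).
Proof. by move=> oA sf sg n; apply: Sm_mul. Qed.

Lemma smooth_scale A (c : R) f : open A -> smooth A f -> smooth A (fun z => c * f z).
Proof. by move=> oA sf; apply: smooth_mul => //; apply: smooth_cst. Qed.

Lemma smooth_opp A f : open A -> smooth A f -> smooth A (fun z => - f z).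
Proof.
by move=> oA sf; apply: (smooth_congr oA _ (smooth_scale (-1) oA sf)) => z _; rewrite mulN1r.
Qed.

Lemma is_diff_comp1 (h : R -> R) (h' : R) f x : differentiable f x ->
  is_derive (f x) 1 h h' ->
  differentiable (fun z => h (f z)) x /\
  forall E, dd E (fun z => h (f z)) x = h' * dd E f x.
Proof.
move=> df dh; have dh' : differentiable h (f x).
  by apply/derivable1_diffP; apply: ex_derive.
have dhf : differentiable (h \o f) x := differentiable_comp df dh'.
split=> // E; rewrite !ddE deriveE // (diff_comp df dh') /= deriveE //.
have -> : 'd f x E = 'd f x E *: (1 : R) by rewrite scaler1.
by rewrite linearZ /= -(deriveE _ dh') (@derive_val _ _ _ _ _ _ _ dh) mulrC scaler1.
Qed.

Lemma smooth_inv A f : open A -> smooth A f -> (forall z, A z -> f z != 0) ->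
  smooth A (fun z => (f z)^-1).
Proof.
move=> oA sf f0 n; have der z : A z -> is_derive (f z) 1 (@GRing.inv R) (- (f z) ^- 2).
  move=> Az; apply: is_derive_eq (@is_deriveV R id (f z) 1 1 (f0 z Az) (is_derive_id _ _)) _.
  by rewrite scaler1.
have D z Az := is_diff_comp1 (smooth_diff sf Az) (der z Az).
elim: n => [|n IH]; (split; first by move=> z /D[]) => // E.
apply: (@Sm_congr A n (fun z => -1 * ((f z)^-1 * (f z)^-1) * dd E f z)) => //.
  by move=> z Az; rewrite (D z Az).2 expr2 invfM mulN1r.
apply: Sm_mul => //; last by apply: smooth_dd sf n.
by apply: Sm_mul => //; [apply: Sm_cst|apply: Sm_mul].
Qed.

Lemma smooth_ln A f : open A -> smooth A f -> (forall z, A z -> 0 < f z) ->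
  smooth A (fun z => ln (f z)).
Proof.
move=> oA sf f0; have D z Az := is_diff_comp1 (smooth_diff sf Az) (is_derive1_ln (f0 z Az)).
case=> [|n]; (split; first by move=> z /D[]) => // E.
have : smooth A (fun z => (f z)^-1 * dd E f z).
  apply: smooth_mul => //; last exact: smooth_dd.
  by apply: smooth_inv => // z /f0/lt0r_neq0.
by move=> /(_ n); apply: Sm_congr => // z Az; rewrite (D z Az).2.
Qed.

Lemma dd_ln A f E z : open A -> smooth A f -> (forall z, A z -> 0 < f z) ->
  A z -> dd E (fun z => ln (f z)) z = (f z)^-1 * dd E f z.
Proof.
move=> oA sf f0 Az.
by rewrite (is_diff_comp1 (smooth_diff sf Az) (is_derive1_ln (f0 z Az))).2.
Qed.

End DirectionalDerivatives.

Section OneVariable.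
Context {R : realType}.
Implicit Types (f g : R -> R) (t a b c : R).

Lemma isd_id t : is_derive t 1 (fun s : R => s) 1.
Proof. exact: is_derive_id. Qed.

Lemma isd_cst c t : is_derive t 1 (fun _ : R => c) 0.
Proof. exact: is_derive_cst. Qed.

Lemma isd_add f g t a b : is_derive t 1 f a -> is_derive t 1 g b ->
  is_derive t 1 (fun s => f s + g s) (a + b).
Proof. by move=> hf hg; exact: is_deriveD. Qed.

Lemma isd_sub f g t a b : is_derive t 1 f a -> is_derive t 1 g b ->
  is_derive t 1 (fun s => f s - g s) (a - b).
Proof. by move=> hf hg; exact: is_deriveB. Qed.

Lemma isd_mul f g t a b : is_derive t 1 f a -> is_derive t 1 g b ->
  is_derive t 1 (fun s => f s * g s) (f t * b + g t * a).
Proof. by move=> hf hg; exact: is_deriveM. Qed.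

Lemma isd_scale c f t a : is_derive t 1 f a -> is_derive t 1 (fun s => c * f s) (c * a).
Proof. by move=> hf; exact: (@is_deriveZ _ _ _ f c). Qed.

Lemma isd_eq f t a b : is_derive t 1 f a -> a = b -> is_derive t 1 f b.
Proof. by move=> h <-. Qed.

Lemma isd_unique f t a b : is_derive t 1 f a -> is_derive t 1 f b -> a = b.
Proof. by move=> h1 h2; rewrite -(@derive_val _ _ _ _ _ _ _ h1) (@derive_val _ _ _ _ _ _ _ h2). Qed.

End OneVariable.

Section SecondDerivatives.
Context {R : realType} {V : normedModType R}.
Implicit Types (A : set V) (f g : V -> R) (E F x : V).

Lemma smooth_continuous A f x : smooth A f -> A x -> {for x, continuous f}.
Proof. by move=> sf Ax; apply: differentiable_continuous; apply: smooth_diff sf Ax. Qed.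

Lemma continuous_near_dist f x (e : R) : {for x, continuous f} -> 0 < e ->
  \forall y \near x, `|f x - f y| < e.
Proof. by move=> /cvgrPdist_lt h e0; apply: h. Qed.

Lemma MVT0 (g dg : R -> R) (d : R) : 0 < d ->
  (forall t, 0 <= t <= d -> is_derive t 1 g (dg t)) ->
  exists2 c, 0 < c < d & g d - g 0 = d * dg c.
Proof.
move=> d0 dgt; have [||c] := @MVT R g dg 0 d d0.
- by move=> t; rewrite in_itv /= => /andP[t0 td]; apply: dgt; rewrite !ltW.
- apply: derivable_within_continuous => t; rewrite in_itv /= => /dgt h.
  exact: ex_derive.
by rewrite in_itv /= subr0 mulrC => cd ->; exists c.
Qed.

Lemma MVT_line f x E (d : R) : 0 < d ->
  (forall t, 0 <= t <= d -> differentiable f (x + t *: E)) ->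
  exists2 c, 0 < c < d & f (x + d *: E) - f x = d * dd E f (x + c *: E).
Proof.
move=> d0 df.
have [c cd h] := @MVT0 (fun s => f (x + s *: E)) _ d d0
  (fun t td => is_derive_line (df t td)).
by exists c => //; rewrite -h scale0r addr0.
Qed.

(** Two applications of the mean value theorem turn the same second difference
    into either mixed derivative at a nearby point; both are continuous. *)
Lemma dd_comm A f E F x : open A -> smooth A f -> A x ->
  dd E (dd F f) x = dd F (dd E f) x.
Proof.
move=> oA sf Ax.
have double E' F' (d : R) : 0 < d ->
    (forall s t, 0 <= s <= d -> 0 <= t <= d -> A (x + s *: E' + t *: F')) ->
    exists s t, [/\ 0 < s < d, 0 < t < d &
    f (x + d *: E' + d *: F') - f (x + d *: E') - f (x + d *: F') + f x =
    d ^+ 2 * dd F' (dd E' f) (x + s *: E' + t *: F')].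
  move=> d0 inA.
  have inA0 s : 0 <= s <= d -> A (x + s *: E').
    by move=> sd; rewrite -[_ + _]addr0 -(scale0r F'); apply: inA; rewrite ?sd // ?lexx (ltW d0).
  have inAd s : 0 <= s <= d -> A (x + d *: F' + s *: E').
    by move=> sd; rewrite addrAC; apply: inA; rewrite ?sd // ?lexx (ltW d0).
  have [s sd hs] := @MVT0 (fun s => f (x + d *: F' + s *: E') - f (x + s *: E')) _ d d0
    (fun t td => is_deriveB (is_derive_line (smooth_diff sf (inAd t td)))
                            (is_derive_line (smooth_diff sf (inA0 t td)))).
  have sd' : 0 <= s <= d by case/andP: sd => *; rewrite !ltW.
  have [t td ht] := @MVT_line (dd E' f) (x + s *: E') F' d d0
    (fun t td => smooth_diff (smooth_dd E' sf) (inA _ _ sd' td)).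
  exists s, t; split=> //.
  rewrite expr2 -mulrA -ht (addrAC x (s *: E')) -hs scale0r !addr0.
  by rewrite (addrAC x (d *: F')) opprB addrA addrAC.
apply/eqP; rewrite -subr_eq0 -normr_le0; apply/ler_addgt0Pl => e e0; rewrite addr0.
have e2 : 0 < e / 2 by rewrite divr_gt0.
have c1 := smooth_continuous (smooth_dd E (smooth_dd F sf)) Ax.
have c2 := smooth_continuous (smooth_dd F (smooth_dd E sf)) Ax.
have : \forall y \near x, [/\ A y, `|dd E (dd F f) x - dd E (dd F f) y| < e / 2 &
    `|dd F (dd E f) x - dd F (dd E f) y| < e / 2].
  have n0 : nbhs x A by apply: open_nbhs_nbhs.
  have n1 := continuous_near_dist c1 e2.
  have n2 := continuous_near_dist c2 e2.
  by apply: filterS3 n0 n1 n2.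
move=> /nbhs_ballP[r /= r0 hr].
pose N := `|E| + `|F| + 1; have N0 : 0 < N by rewrite ltr_wpDl // addr_ge0.
pose d := r / 2 / N; have d0 : 0 < d by rewrite !divr_gt0.
have inb s t : 0 <= s <= d -> 0 <= t <= d -> ball x r (x + s *: E + t *: F).
  move=> /andP[s0 sd] /andP[t0 td]; rewrite -ball_normE /= -addrA opprD addNKr normrN.
  rewrite (le_lt_trans (ler_normD _ _)) // !normrZ !ger0_norm //.
  rewrite (@le_lt_trans _ _ (d * (`|E| + `|F|))) //.
    by rewrite mulrDr lerD // ler_wpM2r.
  rewrite (@le_lt_trans _ _ (d * N)) ?ler_wpM2l ?(ltW d0) ?lerDl ?ler01 //.
  by rewrite divfK ?lt0r_neq0 // ltr_pdivrMr // ltr_pMr // ltr1n.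
have [s [t [sd td e1]]] := double E F d d0
  (fun s t sd td => let: And3 a _ _ := hr _ (inb s t sd td) in a).
have inb' s' t' : 0 <= s' <= d -> 0 <= t' <= d -> ball x r (x + s' *: F + t' *: E).
  by move=> sd' td'; rewrite addrAC; apply: inb.
have [s' [t' [sd' td' e1']]] := double F E d d0
  (fun s t sd td => let: And3 a _ _ := hr _ (inb' s t sd td) in a).
have W (z : R) : 0 < z < d -> 0 <= z <= d by case/andP=> *; rewrite !ltW.
have [_ _ h2] := hr _ (inb s t (W _ sd) (W _ td)).
have [_ h1 _] := hr _ (inb' s' t' (W _ sd') (W _ td')).
have E12 : dd F (dd E f) (x + s *: E + t *: F) = dd E (dd F f) (x + s' *: F + t' *: E).
  have d2 : d ^+ 2 != 0 by rewrite expf_neq0 // lt0r_neq0.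
  apply: (mulfI d2); rewrite -[LHS]e1 -[RHS]e1' (addrAC x (d *: F)).
  by congr (_ + _); apply: addrAC.
move: h1 h2; rewrite E12 => h1 h2.
rewrite distrC in h2; apply: (le_trans (ler_distD _ _ _)) (ltW _).
by rewrite (splitr e); apply: ltrD h1 h2.
Qed.

(** Were the second derivative positive, the first one would be positive just
    after 0, and the mean value theorem would push g above its value at 0. *)
Lemma max_second_derivative (g g1 : R -> R) (g2 e : R) : 0 < e ->
  (forall t : R, `|t| < e -> is_derive t 1 g (g1 t)) -> is_derive (0 : R) 1 g1 g2 ->
  (forall t : R, `|t| < e -> g t <= g 0) -> g1 0 = 0 /\ g2 <= 0.
Proof.
move=> e0 dg dg1 gmax.
have z0 : `|0 : R| < e by rewrite normr0.
have g10 : g1 0 = 0.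
  have inI t : t \in `](- e), e[ = (`|t| < e) by rewrite in_itv /= ltr_norml.
  have h := @derive1_at_max R g (- e) e 0.
  have d0 : is_derive (0 : R) 1 g 0.
    apply: h; rewrite ?inI //; first by lra.
      by move=> t; rewrite inI => /dg ?; apply: ex_derive.
    by move=> t; rewrite inI => /gmax.
  by rewrite -(@derive_val _ _ _ _ _ _ _ (dg _ z0)) (@derive_val _ _ _ _ _ _ _ d0).
split=> //; rewrite leNgt; apply/negP => g20.
have : \forall h \near 0^', g2 / 2 < h^-1 *: (g1 (h *: 1 + 0) - g1 0).
  have cv : h^-1 *: (g1 (h *: 1 + 0) - g1 0) @[h --> 0^'] --> g2.
    have := @ex_derive _ _ _ _ _ _ _ dg1; rewrite /derivable => /cvgP/cvg_ex[l hl].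
    have <- // : l = g2.
    rewrite -(@derive_val _ _ _ _ _ _ _ dg1) /derive; symmetry; exact: cvg_lim hl.
  by apply: (cvgr_gt g2 cv); lra.
move=> /(@nbhs_ballP R)[r /= r0 hr].
pose m := Num.min r e; have m0 : 0 < m by rewrite lt_min r0 e0.
have [mr me] : m <= r /\ m <= e by rewrite /m !ge_min !lexx orbT.
pose d := m / 2; have d0 : 0 < d by rewrite divr_gt0.
have de : d < e by rewrite /d; lra.
have dr : d < r by rewrite /d; lra.
have dgd t : 0 <= t <= d -> is_derive t 1 g (g1 t).
  by move=> /andP[t0 td]; apply: dg; rewrite ger0_norm // (le_lt_trans td).
have [c /andP[c0 cd] hc] := MVT0 d0 dgd.
have : g2 / 2 < c^-1 *: (g1 (c *: 1 + 0) - g1 0).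
  apply: hr; last by rewrite gt_eqF.
  by rewrite -ball_normE /= sub0r normrN gtr0_norm // (lt_trans cd).
rewrite g10 subr0 addr0 scaler1 => h.
have gc : 0 < g1 c.
  have ci : 0 < c^-1 by rewrite invr_gt0.
  by rewrite -(pmulr_rgt0 _ ci); apply: lt_trans h; lra.
have := mulr_gt0 d0 gc; rewrite -hc subr_gt0 ltNge gmax // gtr0_norm //.
Qed.

End SecondDerivatives.

(** * The complex structure and the Euclidean product *)

Section Coordinates.
Context {R : realType}.
Notation V := (C2 R).
Implicit Types (A : set V) (f g : V -> R) (E F x y z : V).

(** Multiplication by i in the real coordinates (x_1, x_2, y_1, y_2). *)
Definition J (w : V) : V := row_mx (- rsubmx w) (lsubmx w).

Definition re1 : V := delta_mx 0 (lshift 2 0).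
Definition re2 : V := delta_mx 0 (lshift 2 1).

Definition dot (x y : V) : R := \sum_(k < 2 + 2) x 0 k * y 0 k.

Lemma JJ w : J (J w) = - w.
Proof. by rewrite /J row_mxKl row_mxKr -opp_row_mx hsubmxK. Qed.

Lemma JD x y : J (x + y) = J x + J y.
Proof. by apply/rowP => k; rewrite !mxE; case: (fintype.split k) => j; rewrite !mxE ?opprD. Qed.

Lemma JZ (a : R) x : J (a *: x) = a *: J x.
Proof. by apply/rowP => k; rewrite !mxE; case: (fintype.split k) => j; rewrite !mxE ?mulrN. Qed.

Lemma JN x : J (- x) = - J x.
Proof. by rewrite -scaleN1r JZ scaleN1r. Qed.

Lemma dot_split x y : dot x y =
  x 0 (lshift 2 0) * y 0 (lshift 2 0) + x 0 (lshift 2 1) * y 0 (lshift 2 1) +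
  (x 0 (rshift 2 0) * y 0 (rshift 2 0) + x 0 (rshift 2 1) * y 0 (rshift 2 1)).
Proof.
rewrite /dot big_split_ord /= !big_ord_recl !big_ord0 !addr0.
by do ![congr (_ + _)|congr (_ * _)|congr (x _ _)|congr (y _ _)|apply/val_inj].
Qed.

Lemma dotC x y : dot x y = dot y x.
Proof. by apply: eq_bigr => k _; rewrite mulrC. Qed.

Lemma dotDl x y z : dot (x + y) z = dot x z + dot y z.
Proof. by rewrite -big_split; apply: eq_bigr => k _; rewrite mxE mulrDl. Qed.

Lemma dotZl (a : R) x z : dot (a *: x) z = a * dot x z.
Proof. by rewrite [RHS]big_distrr; apply: eq_bigr => k _; rewrite mxE /= mulrA. Qed.

Lemma dotDr x y z : dot z (x + y) = dot z x + dot z y.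
Proof. by rewrite dotC dotDl !(dotC z). Qed.

Lemma dotZr (a : R) x z : dot z (a *: x) = a * dot z x.
Proof. by rewrite dotC dotZl (dotC z). Qed.

Lemma dotJJ x y : dot (J x) (J y) = dot x y.
Proof.
rewrite !dot_split /J !row_mxEl !row_mxEr !mxE mulrNN mulrNN [RHS]addrC.
by [].
Qed.

Lemma dot_ge0 x : 0 <= dot x x.
Proof. by apply: sumr_ge0 => k _; rewrite -expr2 sqr_ge0. Qed.

Lemma dot_gt0 x : x != 0 -> 0 < dot x x.
Proof.
move=> x0; rewrite lt_def dot_ge0 andbT; apply: contra x0.
rewrite psumr_eq0 => [/allP h|k _]; last by rewrite -expr2 sqr_ge0.
apply/eqP/rowP => k; rewrite mxE; have := h k (mem_index_enum k).
by rewrite -expr2 sqrf_eq0 => /eqP.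
Qed.

Lemma coord_le_norm x k : `|x 0 k| <= `|x|.
Proof.
rewrite [leRHS]/Num.Def.normr /= mx_normrE.
by apply: (le_bigmax _ (fun ij : 'I_1 * 'I_(2 + 2) => `|x ij.1 ij.2|) (0, k)).
Qed.

Lemma norm_le_coord x (r : R) : 0 <= r -> (forall k, `|x 0 k| <= r) -> `|x| <= r.
Proof.
move=> r0 h; rewrite [leLHS]/Num.Def.normr /= mx_normrE.
by apply: bigmax_le => // -[i k] _ /=; rewrite (ord1 i).
Qed.

Lemma dot_le_norm x y : `|dot x y| <= 4 * (`|x| * `|y|).
Proof.
rewrite (le_trans (ler_norm_sum _ _ _)) //.
rewrite (@le_trans _ _ (\sum_(k < 2 + 2) `|x| * `|y|)) //.
  by apply: ler_sum => k _; rewrite normrM ler_pM ?coord_le_norm.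
by rewrite sumr_const card_ord -[leLHS]mulr_natl lexx.
Qed.

Lemma norm_le_dot x : `|x| ^+ 2 <= dot x x.
Proof.
rewrite -[leRHS]sqr_sqrtr ?dot_ge0 // ler_sqr ?nnegrE ?sqrtr_ge0 //.
apply: norm_le_coord; first exact: sqrtr_ge0.
move=> k; rewrite -(@sqrtr_sqr R (x 0 k)) ler_sqrt ?dot_ge0 //.
rewrite /dot (bigD1 k) //= expr2 lerDl; apply: sumr_ge0 => i _.
by rewrite -expr2 sqr_ge0.
Qed.

Lemma norm_J_le x : `|J x| <= `|x|.
Proof.
apply: norm_le_coord => // k; rewrite /J mxE; case: splitP => j _; rewrite !mxE ?normrN;
  exact: coord_le_norm.
Qed.

Lemma dd_partial k f z : partial k f z = dd (delta_mx 0 k) f z.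
Proof. by rewrite ddE. Qed.

Lemma dd_sum_partial E f z : differentiable f z ->
  dd E f z = \sum_(k < 2 + 2) E 0 k * partial k f z.
Proof.
move=> df; rewrite ddE deriveE // [in LHS](row_sum_delta E) linear_sum /=.
by apply: eq_bigr => k _; rewrite linearZ /= /partial deriveE.
Qed.

Lemma Sm_sum A n (s : seq 'I_(2 + 2)) (F : 'I_(2 + 2) -> V -> R) : open A ->
  (forall k, Sm A n (F k)) -> Sm A n (fun z => \sum_(k <- s) F k z).
Proof.
move=> oA sF; elim: s => [|k s IH].
  by apply: (Sm_congr oA _ (Sm_cst A n 0)) => z _; rewrite big_nil.
by apply: (Sm_congr oA _ (Sm_add oA (sF k) IH)) => z _; rewrite big_cons.
Qed.

Lemma smooth_on_smooth A f : open A -> smooth_on A f -> smooth A f.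
Proof.
move=> oA sf n; elim: n f sf => [|n IH] f sf.
  by split=> // z Az; apply: (sf [::]).
split=> [z Az|E]; first exact: (sf [::]).
have h : Sm A n (fun z => \sum_(k <- index_enum 'I_(2 + 2)) E 0 k * partial k f z).
  apply: Sm_sum => // k; apply: Sm_mul => //; first exact: Sm_cst.
  by apply: IH => s z Az; have := sf (rcons s k) z Az; rewrite foldr_rcons.
by apply: (Sm_congr oA _ h) => z Az; rewrite dd_sum_partial //; apply: (sf [::]).
Qed.

Lemma midpointK (a b : V) : 2^-1 *: ((a + b) + (a - b)) = a.
Proof. by apply/rowP => k; rewrite !mxE; field. Qed.

End Coordinates.

(** * Hermitian parts of real symmetric forms *)

Section HermitianParts.
Context {R : realType}.
Notation V := (C2 R).
Implicit Types (E F G x y z : V) (Q K : V -> V -> R) (p : V -> R).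

Definition linform p := (forall E F, p (E + F) = p E + p F) /\
  (forall (a : R) E, p (a *: E) = a * p E).

Definition symform Q := [/\ forall E F G, Q (E + F) G = Q E G + Q F G,
  forall (a : R) E G, Q (a *: E) G = a * Q E G & forall E F, Q E F = Q F E].

(** The real and imaginary parts of the Hermitian form of Q. When Q is a real
    Hessian, they are four times those of the complex Hessian. *)
Definition qR Q E F := Q E F + Q (J E) (J F).
Definition qI Q E F := Q E (J F) - Q (J E) F.

(** The determinant of the Hermitian part of Q in the complex frame (E, F),
    and its polarization. *)
Definition hdet Q E F := qR Q E E * qR Q F F - qR Q E F ^+ 2 - qI Q E F ^+ 2.
Definition hpol Q K E F := qR Q E E * qR K F F + qR Q F F * qR K E E
  - 2 * (qR Q E F * qR K E F + qI Q E F * qI K E F).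

Lemma symDl Q E F G : symform Q -> Q (E + F) G = Q E G + Q F G.
Proof. by case. Qed.
Lemma symZl Q a E G : symform Q -> Q (a *: E) G = a * Q E G.
Proof. by case. Qed.
Lemma symC Q E F : symform Q -> Q E F = Q F E.
Proof. by case. Qed.
Lemma symDr Q E F G : symform Q -> Q G (E + F) = Q G E + Q G F.
Proof. by move=> h; rewrite !(symC G) // symDl. Qed.
Lemma symZr Q a E G : symform Q -> Q G (a *: E) = a * Q G E.
Proof. by move=> h; rewrite !(symC G) // symZl. Qed.
Lemma symNl Q E G : symform Q -> Q (- E) G = - Q E G.
Proof. by move=> h; rewrite -scaleN1r symZl // mulN1r. Qed.

Lemma linD p E F : linform p -> p (E + F) = p E + p F.
Proof. by case. Qed.
Lemma linZ p a E : linform p -> p (a *: E) = a * p E.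
Proof. by case. Qed.
Lemma linN p E : linform p -> p (- E) = - p E.
Proof. by move=> h; rewrite -scaleN1r linZ // mulN1r. Qed.

Lemma symform_dot : symform (@dot R).
Proof. by split=> *; rewrite ?dotDl ?dotZl // dotC. Qed.

Lemma symform_prod p q : linform p -> linform q ->
  symform (fun E F => p E * q F + q E * p F).
Proof.
by move=> [pD pZ] [qD qZ]; split=> *; rewrite ?pD ?qD ?pZ ?qZ; ring.
Qed.

Lemma symform_sqr p : linform p -> symform (fun E F => p E * p F).
Proof. by move=> [pD pZ]; split=> *; rewrite ?pD ?pZ; ring. Qed.

Lemma symform_lin Q K (a b : R) : symform Q -> symform K ->
  symform (fun E F => a * Q E F + b * K E F).
Proof.
move=> [QD QZ QC] [KD KZ KC]; split=> *; rewrite ?QD ?QZ ?KD ?KZ; try ring.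
by rewrite QC KC.
Qed.

Lemma qRJl Q E F : symform Q -> qR Q (J E) F = - qI Q E F.
Proof. by move=> h; rewrite /qR /qI JJ symNl // opprB. Qed.

Lemma qIJl Q E F : symform Q -> qI Q (J E) F = qR Q E F.
Proof. by move=> h; rewrite /qR /qI JJ symNl // opprK addrC. Qed.

Lemma qRC Q E F : symform Q -> qR Q E F = qR Q F E.
Proof. by move=> h; rewrite /qR !(@symC Q _ E) // (@symC Q (J E)). Qed.

Lemma qIC Q E F : symform Q -> qI Q E F = - qI Q F E.
Proof. by move=> h; rewrite /qI opprB (@symC Q E) // (@symC Q (J E)). Qed.

Lemma qRJr Q E F : symform Q -> qR Q E (J F) = qI Q E F.
Proof. by move=> h; rewrite qRC // qRJl // qIC // opprK. Qed.

Lemma qIJr Q E F : symform Q -> qI Q E (J F) = - qR Q E F.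
Proof. by move=> h; rewrite qIC // qIJl // qRC. Qed.

Lemma qRD Q E F G : symform Q -> qR Q (E + F) G = qR Q E G + qR Q F G.
Proof. by move=> h; rewrite /qR JD !symDl // addrACA. Qed.

Lemma qRZ Q a E G : symform Q -> qR Q (a *: E) G = a * qR Q E G.
Proof. by move=> h; rewrite /qR JZ !symZl // mulrDr. Qed.

Lemma qID Q E F G : symform Q -> qI Q (E + F) G = qI Q E G + qI Q F G.
Proof. by move=> h; rewrite /qI JD !symDl // opprD addrACA. Qed.

Lemma qIZ Q a E G : symform Q -> qI Q (a *: E) G = a * qI Q E G.
Proof. by move=> h; rewrite /qI JZ !symZl // mulrBr. Qed.

Lemma qRDr Q E F G : symform Q -> qR Q G (E + F) = qR Q G E + qR Q G F.
Proof. by move=> h; rewrite !(@qRC Q G) // qRD. Qed.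

Lemma qRZr Q a E G : symform Q -> qR Q G (a *: E) = a * qR Q G E.
Proof. by move=> h; rewrite !(@qRC Q G) // qRZ. Qed.

Lemma qIDr Q E F G : symform Q -> qI Q G (E + F) = qI Q G E + qI Q G F.
Proof. by move=> h; rewrite !(@qIC Q G) // qID // opprD. Qed.

Lemma qIZr Q a E G : symform Q -> qI Q G (a *: E) = a * qI Q G E.
Proof. by move=> h; rewrite !(@qIC Q G) // qIZ // mulrN. Qed.

Lemma qI_diag Q E : symform Q -> qI Q E E = 0.
Proof. by move=> h; rewrite /qI symC // subrr. Qed.

Lemma qRJJ Q E F : symform Q -> qR Q (J E) (J F) = qR Q E F.
Proof. by move=> h; rewrite qRJl // qIJr // opprK. Qed.

Lemma qIJJ Q E F : symform Q -> qI Q (J E) (J F) = qI Q E F.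
Proof. by move=> h; rewrite qIJl // qRJr. Qed.

Definition vec (a b c d : R) : V :=
  a *: re1 + b *: J re1 + c *: re2 + d *: J re2.

Lemma J_delta (j : 'I_2) : J (delta_mx 0 (lshift 2 j) : V) = delta_mx 0 (rshift 2 j).
Proof.
apply/rowP => k; rewrite /J; case: (split_ordP k) => i ->.
  by rewrite row_mxEl !mxE !eq_shift andbF oppr0.
by rewrite row_mxEr !mxE !eq_shift.
Qed.

Lemma vec_surj E : exists a b c d, E = vec a b c d.
Proof.
exists (E 0 (lshift 2 0)), (E 0 (rshift 2 0)), (E 0 (lshift 2 1)), (E 0 (rshift 2 1)).
rewrite /vec !J_delta [LHS](row_sum_delta E) big_split_ord /= !big_ord_recl !big_ord0 !addr0.
have -> : lift ord0 ord0 = 1 :> 'I_2 by apply/val_inj.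
by rewrite -!addrA; congr (_ + _); apply: addrCA.
Qed.

Lemma qR_vec Q a b c d a' b' c' d' : symform Q ->
  qR Q (vec a b c d) (vec a' b' c' d') =
  (a * a' + b * b') * qR Q re1 re1 + (c * c' + d * d') * qR Q re2 re2
  + (a * c' + b * d' + c * a' + d * b') * qR Q re1 re2
  + (a * d' - b * c' + d * a' - c * b') * qI Q re1 re2.
Proof.
move=> h; rewrite /vec !qRD // !qRZ // !qRDr // !qRZr // !qRJJ // !qRJl // !qRJr //.
rewrite !qI_diag // (@qRC Q re2 re1) // (@qIC Q re2 re1) //.
by move: (qR Q _ _) (qR Q _ _) (qR Q _ _) (qI Q _ _) => *; ring.
Qed.

Lemma qI_vec Q a b c d a' b' c' d' : symform Q ->
  qI Q (vec a b c d) (vec a' b' c' d') =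
  (b * a' - a * b') * qR Q re1 re1 + (d * c' - c * d') * qR Q re2 re2
  + (b * c' - a * d' + d * a' - c * b') * qR Q re1 re2
  + (a * c' + b * d' - c * a' - d * b') * qI Q re1 re2.
Proof.
move=> h; rewrite /vec !qID // !qIZ // !qIDr // !qIZr // !qIJJ // !qIJl // !qIJr //.
rewrite !qI_diag // (@qRC Q re2 re1) // (@qIC Q re2 re1) //.
by move: (qR Q _ _) (qR Q _ _) (qR Q _ _) (qI Q _ _) => *; ring.
Qed.

(** Changing the complex frame multiplies the determinant by the squared modulus
    of the determinant of the frame, which is read off the Euclidean form. *)
Lemma hpol_frame Q K E F : symform Q -> symform K ->
  4 * hpol Q K E F = hdet (@dot R) E F * hpol Q K re1 re2.
Proof.
move=> hQ hK.
have [a [b [c [d ->]]]] := vec_surj E; have [a' [b' [c' [d' ->]]]] := vec_surj F.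
rewrite /hdet /hpol !qR_vec ?qI_vec //; try exact: symform_dot.
have [-> -> -> ->] : [/\ qR (@dot R) re1 re1 = 2, qR (@dot R) re2 re2 = 2,
   qR (@dot R) re1 re2 = 0 & qI (@dot R) re1 re2 = 0].
  by rewrite /qR /qI /re1 /re2 !J_delta !dot_split !mxE !eq_shift /=; split; ring.
move: (qR Q _ _) (qR Q _ _) (qR Q _ _) (qI Q _ _) => *.
by move: (qR K _ _) (qR K _ _) (qR K _ _) (qI K _ _) => *; ring.
Qed.

Lemma hdet_hpol Q E F : 2 * hdet Q E F = hpol Q Q E F.
Proof. by rewrite /hdet /hpol; ring. Qed.

Lemma hdet_frame Q E F : symform Q ->
  4 * hdet Q E F = hdet (@dot R) E F * hdet Q re1 re2.
Proof.
move=> hQ; have := hpol_frame E F hQ hQ; rewrite -!hdet_hpol => h.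
have : 2 * (4 * hdet Q E F) = 2 * (hdet (@dot R) E F * hdet Q re1 re2) by lra.
by apply: mulfI; rewrite pnatr_eq0.
Qed.

(** The kernels of p and of p composed with J have codimension at most one, and
    the space has dimension four. Displacements along this complex line do not
    see the gradient terms of logarithmic forms, which leaves them free to be
    optimized in both touching arguments. *)
Lemma complex_kernel p : linform p ->
  exists t, [/\ dot t t = 1, p t = 0 & p (J t) = 0].
Proof.
move=> lp.
have [t [t0 pt pJt]] : exists t, [/\ t != 0, p t = 0 & p (J t) = 0].
  have [p0|] := pselect (forall E, p E = 0).
    exists re1; split=> //; apply/eqP => /rowP /(_ (lshift 2 0)).
    by rewrite !mxE !eqxx /= => /eqP; rewrite oner_eq0.
  move=> pn0; exists (vec (p re2) (- p (J re2)) (- p re1) (p (J re1))); split.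
  - apply/eqP => v0; apply: pn0 => E.
    have z q : dot q (vec (p re2) (- p (J re2)) (- p re1) (p (J re1))) = 0.
      by rewrite v0 -(scale0r (0 : V)) dotZr mul0r.
    have := (z re1, z (J re1), z re2, z (J re2)).
    rewrite /vec /re1 /re2 !J_delta !dot_split !mxE !eq_shift /=.
    rewrite !(mul0r, mul1r, mulr0, mulr1, add0r, addr0) -/re1 -/re2 -!J_delta -/re1 -/re2.
    move=> [[[z1 z2] z3] z4]; have [a [b [c [d ->]]]] := vec_surj E.
    by rewrite /vec !linD // !linZ //; nra.
  - by rewrite /vec !linD // !linZ //; ring.
  - by rewrite /vec !JD !JZ !JJ !linD // !linZ // !linN //; ring.
have tt := dot_gt0 t0; exists ((Num.sqrt (dot t t))^-1 *: t).
rewrite JZ !(linZ _ _ lp) pt pJt !mulr0 dotZl dotZr; split=> //.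
by rewrite mulrA -expr2 exprVn sqr_sqrtr ?mulVf ?lt0r_neq0 // ltW.
Qed.

(** In complex coordinates the complement of (t_1, t_2) is spanned by
    (- conj t_2, conj t_1). *)
Lemma unitary_complement t : dot t t = 1 ->
  exists E, [/\ dot E E = 1, hdet (@dot R) E t = 4, qR (@dot R) E t = 0 & qI (@dot R) E t = 0].
Proof.
have [a [b [c [d ->]]]] := vec_surj t => t1; exists (vec (- c) d a (- b)).
have [r11 r22 r12 i12] : [/\ qR (@dot R) re1 re1 = 2, qR (@dot R) re2 re2 = 2,
   qR (@dot R) re1 re2 = 0 & qI (@dot R) re1 re2 = 0].
  by rewrite /qR /qI /re1 /re2 !J_delta !dot_split !mxE !eq_shift /=; split; ring.
have sd := symform_dot.
have dE E : dot E E = qR (@dot R) E E / 2 by rewrite /qR dotJJ; field.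
have := t1; rewrite /hdet !dE !qR_vec // !qI_vec // r11 r22 r12 i12 => h.
have {}h : a ^+ 2 + b ^+ 2 + c ^+ 2 + d ^+ 2 = 1 by rewrite -h; field.
split; try ring; first by rewrite -[RHS]h; field.
transitivity (4 * (a ^+ 2 + b ^+ 2 + c ^+ 2 + d ^+ 2) ^+ 2); first by ring.
by rewrite h; ring.
Qed.

Lemma qR_lin Q K (a b : R) E F : qR (fun E F => a * Q E F + b * K E F) E F = a * qR Q E F + b * qR K E F.
Proof. by rewrite /qR !mulrDr addrACA. Qed.

Lemma qI_lin Q K (a b : R) E F : qI (fun E F => a * Q E F + b * K E F) E F = a * qI Q E F + b * qI K E F.
Proof. by rewrite /qI; ring. Qed.

Lemma hpol_lin Q K K' (a b : R) E F :
  hpol Q (fun E F => a * K E F + b * K' E F) E F = a * hpol Q K E F + b * hpol Q K' E F.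
Proof.
rewrite /hpol !qR_lin !qI_lin.
move: (qR Q _ _) (qR Q _ _) (qR Q _ _) (qI Q _ _) => *.
move: (qR K _ _) (qR K _ _) (qR K _ _) (qI K _ _) => *.
by move: (qR K' _ _) (qR K' _ _) (qR K' _ _) (qI K' _ _) => *; ring.
Qed.

Lemma hdet_lin Q K (s : R) E F :
  hdet (fun E F => 1 * Q E F + s * K E F) E F =
  hdet Q E F + s * hpol Q K E F + s ^+ 2 * hdet K E F.
Proof.
rewrite /hdet /hpol !qR_lin !qI_lin.
move: (qR Q _ _) (qR Q _ _) (qR Q _ _) (qI Q _ _) => *.
by move: (qR K _ _) (qR K _ _) (qR K _ _) (qI K _ _) => *; ring.
Qed.

Lemma hdet_le Q E F : hdet Q E F <= qR Q E E * qR Q F F.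
Proof. by rewrite /hdet -addrA gerDl -opprD oppr_le0 addr_ge0 ?sqr_ge0. Qed.

Lemma hdet_scale Q (c : R) E F : hdet (fun E F => c * Q E F) E F = c ^+ 2 * hdet Q E F.
Proof.
rewrite /hdet /qR /qI.
by move: (Q _ _) (Q _ _) (Q _ _) (Q _ _) (Q _ _) (Q _ _) (Q _ _) (Q _ _) => *; ring.
Qed.

End HermitianParts.

(** * The determinant of a harmonic mean *)

Section HermitianPositivity.
Context {R : realType}.
Notation V := (C2 R).
Implicit Types (E F G x y z : V) (Q K : V -> V -> R) (p : V -> R).

(** For a 2 x 2 Hermitian matrix H, the theorem of Cayley and Hamilton gives
    (tr H) H - (det H) I = H^2, whose quadratic form is a sum of squares. *)
Lemma qR_pos_coercive Q E : symform Q ->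
  0 < qR Q re1 re1 -> 0 < hdet Q re1 re2 ->
  hdet Q re1 re2 / (qR Q re1 re1 + qR Q re2 re2) * dot E E <= qR Q E E.
Proof.
move=> hQ; have [a [b [c [d ->]]]] := vec_surj E.
have -> : dot (vec a b c d) (vec a b c d) = a ^+ 2 + b ^+ 2 + c ^+ 2 + d ^+ 2.
  by rewrite /vec /re1 /re2 !J_delta dot_split !mxE !eq_shift /=; ring.
rewrite qR_vec // /hdet.
move: (qR Q re1 re1) (qR Q re2 re2) (qR Q re1 re2) (qI Q re1 re2) => h k r s h0 D0.
have k0 : 0 < k by rewrite -(pmulr_rgt0 _ h0); have := sqr_ge0 r; have := sqr_ge0 s; lra.
have t0 : 0 < h + k by rewrite addr_gt0.
rewrite mulrAC ler_pdivrMr // -subr_ge0.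
set X := (X in 0 <= X); suff -> : X = (h * a + r * c + s * d) ^+ 2
   + (h * b + r * d - s * c) ^+ 2
   + (k * c + r * a - s * b) ^+ 2 + (k * d + r * b + s * a) ^+ 2.
  by rewrite !addr_ge0 ?sqr_ge0.
by rewrite /X; ring.
Qed.

Lemma qR_pos Q E : symform Q -> 0 < qR Q re1 re1 -> 0 < hdet Q re1 re2 ->
  E != 0 -> 0 < qR Q E E.
Proof.
move=> hQ h0 D0 E0; apply: lt_le_trans (qR_pos_coercive E hQ h0 D0).
rewrite mulr_gt0 ?dot_gt0 // divr_gt0 // addr_gt0 //.
have : 0 < qR Q re1 re1 * qR Q re2 re2 by exact: lt_le_trans D0 (hdet_le _ _ _).
by rewrite pmulr_rgt0.
Qed.

(** The polarized determinant pairs a Hermitian form with the adjugate of that of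
    Q, a positive matrix with the same determinant and trace. *)
Lemma hpol_sqr_coercive Q z : symform Q ->
  0 < qR Q re1 re1 -> 0 < hdet Q re1 re2 ->
  hdet Q re1 re2 / (qR Q re1 re1 + qR Q re2 re2) * dot z z <=
  hpol Q (fun E F => dot z E * dot z F) re1 re2.
Proof.
move=> hQ; have [a [b [c [d zE]]]] := vec_surj z.
have dz : dot z z = a ^+ 2 + b ^+ 2 + c ^+ 2 + d ^+ 2 /\
   [/\ dot z re1 = a, dot z (J re1) = b, dot z re2 = c & dot z (J re2) = d].
  rewrite zE /vec /re1 /re2 !J_delta !dot_split !mxE !eq_shift /=.
  by split; [|split]; ring.
have [-> [d1 dJ1 d2 dJ2]] := dz.
rewrite /hpol /hdet.
move: (qR Q re1 re1) (qR Q re2 re2) (qR Q re1 re2) (qI Q re1 re2) => h k r s h0 D0.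
rewrite /qR /qI d1 dJ1 d2 dJ2.
have k0 : 0 < k by rewrite -(pmulr_rgt0 _ h0); have := sqr_ge0 r; have := sqr_ge0 s; lra.
have t0 : 0 < h + k by rewrite addr_gt0.
rewrite mulrAC ler_pdivrMr // -subr_ge0.
set X := (X in 0 <= X); suff -> : X = (h * c - r * a + s * b) ^+ 2
   + (h * d - r * b - s * a) ^+ 2
   + (k * a - r * c - s * d) ^+ 2 + (k * b - r * d + s * c) ^+ 2.
  by rewrite !addr_ge0 ?sqr_ge0.
by rewrite /X; ring.
Qed.

Lemma hdet_shear Q E t (a b : R) : symform Q ->
  hdet Q (E + (a *: t + b *: J t)) t = hdet Q E t.
Proof.
move=> hQ; rewrite /hdet !qRD // !qID // !qRDr // !qRZ // !qIZ // !qRZr //.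
rewrite !qRJJ // !qRJl // !qRJr // !qIJl // !qI_diag // (qRC t E hQ) (qIC t E hQ).
by move: (qR _ _ _) (qR _ _ _) (qR _ _ _) (qI _ _ _) => *; ring.
Qed.

(** The first factor is what the optimal displacement leaves of the mean of the
    two forms in the direction E, the second one what it leaves in the kernel
    direction t. *)
Lemma harmonic_mean_identity (ax ay bx b_y ix iy gx gy L : R) : 0 < gx -> 0 < gy ->
  gy * bx + gx * b_y = 0 -> gy * ix + gx * iy = 0 ->
  ax * gx - bx ^+ 2 - ix ^+ 2 = L -> ay * gy - b_y ^+ 2 - iy ^+ 2 = L ->
  ((ax + ay) / 2 - ((bx - b_y) ^+ 2 + (ix - iy) ^+ 2) / (4 * ((gx + gy) / 2))) *
  ((gx + gy) / 2 - ((gx - gy) / 2) ^+ 2 / ((gx + gy) / 2)) = L.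
Proof.
move=> gx0 gy0 hb hi hx hy.
have gxy : gx + gy != 0 by rewrite lt0r_neq0 // addr_gt0.
have gxn := lt0r_neq0 gx0; have gyn := lt0r_neq0 gy0.
pose b := bx / gx; pose i := ix / gx.
have ebx : bx = gx * b by rewrite /b; field.
have eix : ix = gx * i by rewrite /i; field.
have eby : b_y = - gy * b.
  by apply: (mulfI gxn); rewrite /b; move: hb => /eqP; rewrite addr_eq0 => /eqP h; field: h.
have eiy : iy = - gy * i.
  by apply: (mulfI gxn); rewrite /i; move: hi => /eqP; rewrite addr_eq0 => /eqP h; field: h.
have eax : ax = (L + bx ^+ 2 + ix ^+ 2) / gx by rewrite -hx; field.
have eay : ay = (L + b_y ^+ 2 + iy ^+ 2) / gy by rewrite -hy; field.
by rewrite eax eay ebx eix eby eiy; field; rewrite gxn gyn gxy.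
Qed.

(** Two Hermitian forms with the same positive determinant L have a harmonic type
    mean of determinant at most L. The vectors a and b may be chosen freely: with
    t in the complex kernel of p, moving the two base points in opposite
    directions along t leaves the gradient terms unchanged, and the optimal such
    displacement produces a form whose determinant is exactly L. *)
Lemma harmonic_mean_det Ax Ay An p (L : R) : symform Ax -> symform Ay -> symform An ->
  linform p ->
  let M K := fun E F => K E F - p E * p F in
  (forall a b, An (2^-1 *: (a + b)) (2^-1 *: (a + b)) <= (Ax a a + Ay b b) / 2) ->
  (forall E, E != 0 -> 0 < qR (M Ax) E E) -> (forall E, E != 0 -> 0 < qR (M Ay) E E) ->
  (forall E, E != 0 -> 0 < qR (M An) E E) ->
  hdet (M Ax) re1 re2 = L -> hdet (M Ay) re1 re2 = L -> hdet (M An) re1 re2 <= L.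
Proof.
move=> sAx sAy sAn lp M hmean posx posy posn detx dety.
have sM K : symform K -> symform (M K).
  move=> hK; have := symform_lin 1 (-1) hK (symform_sqr lp).
  by congr symform; apply/funext => E; apply/funext => F; rewrite /M; ring.
have [t [t1 pt pJt]] := complex_kernel lp.
have [E0 [_ dE0 _ _]] := unitary_complement t1.
have t0 : t != 0.
  by apply/eqP => t0; move: t1; rewrite t0 -(scale0r (0 : V)) dotZl mul0r => /eqP; rewrite eq_sym oner_eq0.
pose gx := qR (M Ax) t t; pose gy := qR (M Ay) t t.
have gx0 : 0 < gx by apply: posx.
have gy0 : 0 < gy by apply: posy.
pose g := (gx + gy) / 2; pose c := (gx - gy) / 2.
have g0 : 0 < g by rewrite divr_gt0 // addr_gt0.
(* E is chosen so that the minimal form below is diagonal in the frame (E, t). *)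
pose K := fun E F => (g - c) * M Ax E F + (g + c) * M Ay E F.
have sK : symform K by apply: symform_lin; apply: sM.
have Ktt : qR K t t = 2 * gx * gy.
  have -> : qR K t t = (g - c) * gx + (g + c) * gy by rewrite /K /gx /gy /qR; ring.
  by rewrite /g /c; field.
have Kt0 : qR K t t != 0 by rewrite Ktt lt0r_neq0 // !mulr_gt0.
pose E := E0 + (- (qR K E0 t / qR K t t) *: t + - (qI K E0 t / qR K t t) *: J t).
have KR : qR K E t = 0.
  rewrite /E !qRD // !qRZ // qRJl // qI_diag // oppr0 mulr0 addr0 mulNr divfK //.
  by rewrite subrr.
have KI : qI K E t = 0.
  by rewrite /E !qID // !qIZ // qIJl // qI_diag // mulr0 add0r mulNr divfK // subrr.
have frame : forall Q, symform Q -> hdet Q E t = hdet Q re1 re2.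
  move=> Q sQ; have := hdet_frame E t sQ.
  rewrite [hdet (@dot R) E t]hdet_shear; last exact: symform_dot.
  by rewrite dE0; apply: mulfI; rewrite pnatr_eq0.
pose ax := qR (M Ax) E E; pose ay := qR (M Ay) E E.
pose bx := qR (M Ax) E t; pose b_y := qR (M Ay) E t.
pose ix := qI (M Ax) E t; pose iy := qI (M Ay) E t.
have KR' : (g - c) * bx + (g + c) * b_y = 0 by rewrite -KR /K /bx /b_y /qR; ring.
have KI' : (g - c) * ix + (g + c) * iy = 0 by rewrite -KI /K /ix /iy /qI; ring.
have Dx : ax * gx - bx ^+ 2 - ix ^+ 2 = L by rewrite -detx -frame //; apply: sM.
have Dy : ay * gy - b_y ^+ 2 - iy ^+ 2 = L by rewrite -dety -frame //; apply: sM.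
(* The two points move by F + T and F - T, and by J of these; T lies in the
   complex line of t, so that it does not change the gradient terms. *)
have split_mean (s r : R) F : let T := s *: t + r *: J t in
    qR (M An) F F <= (qR (M Ax) F F + qR (M Ay) F F) / 2
     + s * (qR (M Ax) F t - qR (M Ay) F t) + r * (qI (M Ax) F t - qI (M Ay) F t)
     + (s ^+ 2 + r ^+ 2) * g.
  move=> T.
  have pT : p T = 0 by rewrite /T linD // !linZ // pt pJt !mulr0 addr0.
  have pJT : p (J T) = 0 by rewrite /T JD !JZ JJ linD // !linZ // linN // pt pJt oppr0 !mulr0 addr0.
  have JT a : J (a - T) = J a - J T by rewrite JD JN.
  have h1 := hmean (F + T) (F - T); rewrite midpointK in h1.
  have h2 := hmean (J (F + T)) (J (F - T)); rewrite JD JT in h2.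
  rewrite midpointK in h2.
  have e1 : qR (M Ax) (F + T) (F + T) = qR (M Ax) F F + 2 * (s * qR (M Ax) F t + r * qI (M Ax) F t)
      + (s ^+ 2 + r ^+ 2) * gx.
    rewrite /T /gx; have sMx := sM _ sAx.
    rewrite !qRD // !qRDr // !qRZ // !qRZr // !qRJJ // !qRJl // !qRJr // !qI_diag //.
    rewrite (qRC t F sMx) (qIC t F sMx).
    by move: (qR _ _ _) (qR _ _ _) (qR _ _ _) (qI _ _ _) => *; ring.
  have e2 : qR (M Ay) (F - T) (F - T) = qR (M Ay) F F - 2 * (s * qR (M Ay) F t + r * qI (M Ay) F t)
      + (s ^+ 2 + r ^+ 2) * gy.
    rewrite /T /gy -scaleN1r; have sMy := sM _ sAy.
    rewrite !qRD // !qRDr // !qRZ // !qRZr // !qRD // !qRDr // !qRZ // !qRZr // !qRJJ // !qRJl // !qRJr // !qI_diag //.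
    rewrite (qRC t F sMy) (qIC t F sMy).
    by move: (qR _ _ _) (qR _ _ _) (qR _ _ _) (qI _ _ _) => *; ring.
  clearbody T.
  have m1 : qR (M Ax) (F + T) (F + T) = Ax (F + T) (F + T) + Ax (J F + J T) (J F + J T)
      - (p F ^+ 2 + p (J F) ^+ 2).
    by rewrite /qR /M JD !(linD _ _ lp) pT pJT; ring.
  have m2 : qR (M Ay) (F - T) (F - T) = Ay (F - T) (F - T) + Ay (J F - J T) (J F - J T)
      - (p F ^+ 2 + p (J F) ^+ 2).
    by rewrite /qR /M JT !(linD _ _ lp) !(linN _ lp) pT pJT; ring.
  have m3 : qR (M An) F F = An F F + An (J F) (J F) - (p F ^+ 2 + p (J F) ^+ 2).
    by rewrite /qR /M; ring.
  rewrite m3 /g; move: e1 e2 m1 m2 h1 h2.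
  move: (qR _ (F + T) _) (qR _ (F - T) _) (Ax _ _) (Ax _ _) (Ay _ _) (Ay _ _) (An _ _) (An _ _) => *.
  lra.
(* The minimizers of the two quadratic polynomials of split_mean. *)
have nE : qR (M An) E E <= (ax + ay) / 2 - ((bx - b_y) ^+ 2 + (ix - iy) ^+ 2) / (4 * g).
  apply: le_trans (split_mean (- (bx - b_y) / (2 * g)) (- (ix - iy) / (2 * g)) E) _.
  rewrite -/ax -/ay -/bx -/b_y -/ix -/iy le_eqVlt; apply/orP; left; apply/eqP.
  by field; rewrite lt0r_neq0.
have nt : qR (M An) t t <= g - c ^+ 2 / g.
  apply: le_trans (split_mean (- c / g) 0 t) _.
  rewrite -/gx -/gy le_eqVlt; apply/orP; left; apply/eqP.
  have -> : gx - gy = 2 * c by rewrite /c; field.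
  have -> : (gx + gy) / 2 = g by [].
  by field; rewrite lt0r_neq0.
rewrite -frame; last exact: sM.
have pE : 0 <= qR (M An) E E.
  have [->|/posn/ltW //] := eqVneq E 0.
  by rewrite -(scale0r (0 : V)) qRZ ?mul0r //; apply: sM.
have pt0 : 0 <= qR (M An) t t by apply/ltW/posn.
apply: (@le_trans _ _ (qR (M An) E E * qR (M An) t t)).
  exact: hdet_le.
apply: le_trans (ler_pM pE pt0 nE nt) _.
have gc1 : g - c = gy by rewrite /g /c; field.
have gc2 : g + c = gx by rewrite /g /c; field.
rewrite gc1 gc2 in KR' KI'.
by rewrite (harmonic_mean_identity gx0 gy0 KR' KI' Dx Dy).
Qed.

End HermitianPositivity.

(** * The algebra of the constant rank argument *)

Section ConstantRankAlgebra.
Context {R : realType}.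
Notation V := (C2 R).
Implicit Types (E F G x y z : V) (Q K : V -> V -> R) (p : V -> R).

Lemma ler_normM (a b A B : R) : `|a| <= A -> `|b| <= B -> `|a * b| <= A * B.
Proof. by move=> ha hb; rewrite normrM ler_pM. Qed.

Lemma ler_normD2 (W : normedZmodType R) (a b : W) (A B : R) : `|a| <= A -> `|b| <= B -> `|a + b| <= A + B.
Proof. by move=> ha hb; rewrite (le_trans (ler_normD _ _)) // lerD. Qed.

Lemma ler_normB2 (W : normedZmodType R) (a b : W) (A B : R) : `|a| <= A -> `|b| <= B -> `|a - b| <= A + B.
Proof. by move=> ha hb; apply: ler_normD2; rewrite ?normrN. Qed.

Lemma norm_unit E : dot E E = 1 -> `|E| <= 1.
Proof.
by move=> h; have := norm_le_dot E; rewrite h expr_le1.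
Qed.

(** The forms stand for derivatives of v at the touching point: p is the gradient,
    A the Hessian, X and S its first and second derivatives along e; d and Xi are
    the gradient and the Hessian of the touching function xi. The second variation
    of the touching condition along (z, c) is nonnegative. If c depends complex
    linearly on z and takes values in the complex kernel of p, then its optimal
    choice cancels all third and fourth order terms of the twice differentiated
    determinant equation. What remains is controlled by xi and its gradient, since
    c is bounded in terms of the coercivity m of the Hermitian part alone, however
    degenerate the real Hessian is. *)
Lemma constant_rank_algebra A X S Xi p d e (xi delta B m N : R) :
  symform A -> symform X -> symform S -> symform Xi -> linform p -> linform d ->
  let M := fun E F => A E F - p E * p F in
  let M1 := fun E F => X E F - (A e E * p F + A e F * p E) in
  let M2 := fun E F => S E F - (X e E * p F + X e F * p E) - 2 * (A e E * A e F) in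
  dot e e = 1 -> (forall E, A e E = xi * dot e E) -> (forall E, X e E = d E) ->
  0 <= xi <= delta -> delta <= 1 -> (forall E, `|d E| <= delta * `|E|) ->
  (forall z c, 0 <= S z z + 4 * X c z + 2 * A c c - Xi z z
      - 4 * (d z * dot e c) - 2 * (xi * dot c c)) ->
  hpol M M1 re1 re2 = 0 ->
  hpol M M2 re1 re2 + 2 * hdet M1 re1 re2 = 0 ->
  0 < m -> (forall E, m * dot E E <= qR M E E) -> 0 <= B ->
  (forall E, `|p E| <= B * `|E|) -> (forall E F, `|M E F| <= B * `|E| * `|F|) ->
  (forall E F, `|M1 E F| <= B * `|E| * `|F|) ->
  N = 1 + 4 * B / m ->
  hpol M Xi re1 re2 <= (2 * B * (N ^+ 2 * (4 * B + 64) + 256 * B ^+ 2 * N ^+ 2 / m + 128 * B * N ^+ 2 / m)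
    + 2 * B * N ^+ 2 * (64 + 128 * B / m)) * delta.
Proof.
move=> sA sX sS sXi lp ld M M1 M2 e1 Ae Xe /andP[xi0 xid] d1 db test det1 det2 m0 coerc B0 pb Mb M1b NE.
have d0 : 0 <= delta by apply: le_trans xid.
have lA E : linform (A E).
  by split=> *; rewrite ?symDr ?symZr.
have lX E : linform (X E).
  by split=> *; rewrite ?symDr ?symZr.
have sP1 := symform_prod (lA e) lp.
have sP2 := symform_prod (lX e) lp.
have sM : symform M.
  have := symform_lin 1 (-1) sA (symform_sqr lp).
  by congr symform; apply/funext => E; apply/funext => F; rewrite /M; ring.
have sM1 : symform M1.
  have := symform_lin 1 (-1) sX sP1.
  by congr symform; apply/funext => E; apply/funext => F; rewrite /M1; ring.
have sM2 : symform M2.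
  have := symform_lin 1 (-2) (symform_lin 1 (-1) sS sP2) (symform_sqr (lA e)).
  by congr symform; apply/funext => E; apply/funext => F; rewrite /M2; ring.
have [t [t1 pt pJt]] := complex_kernel lp.
have [E0 [E01 dE0 _ _]] := unitary_complement t1.
have nt := norm_unit t1; have nJt := le_trans (norm_J_le t) nt.
have nE0 := norm_unit E01; have nJE0 := le_trans (norm_J_le E0) nE0.
have ne := norm_unit e1.
pose g := qR M t t.
have gm : m <= g by have := coerc t; rewrite t1 mulr1.
have g0 : 0 < g by apply: lt_le_trans gm.
have gn0 := lt0r_neq0 g0.
have ginv : g^-1 <= m^-1 by rewrite lef_pV2.
have ginv0 : 0 <= g^-1 by rewrite invr_ge0 ltW.
have qRb Q C : 0 <= C -> (forall E F, `|Q E F| <= C * `|E| * `|F|) -> forall E F (a b : R),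
   `|E| <= a -> `|F| <= b -> `|qR Q E F| <= 2 * (C * a * b) /\ `|qI Q E F| <= 2 * (C * a * b).
  move=> C0 Qb E F a b Ea Fb.
  have JEa := le_trans (norm_J_le E) Ea; have JFb := le_trans (norm_J_le F) Fb.
  have a0 := le_trans (normr_ge0 _) Ea; have b0 := le_trans (normr_ge0 _) Fb.
  have bd E' F' : `|E'| <= a -> `|F'| <= b -> `|Q E' F'| <= C * a * b.
    by move=> h1 h2; apply: le_trans (Qb _ _) _; rewrite ler_pM ?mulr_ge0 // ler_wpM2l.
  by split; rewrite mulr2n mulrDl mul1r; [apply: ler_normD2|apply: ler_normB2]; apply: bd.
have B0' : 0 <= B / m by rewrite divr_ge0 // ltW.
have N1 : 1 <= N by rewrite NE lerDl -mulrA mulr_ge0.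
have N0 : 0 <= N by apply: le_trans N1.
have ME0 := qRb _ _ B0 Mb E0 t 1 1 nE0 nt.
pose mr := qR M E0 t / g; pose mi := qI M E0 t / g.
have mrb : `|mr| <= 2 * (B / m) /\ `|mi| <= 2 * (B / m).
  by split; rewrite /mr /mi mulrA; apply: ler_normM;
    rewrite ?(ger0_norm ginv0) //; case: ME0; rewrite !mulr1.
(* E completes t to a frame that is orthogonal for M. *)
pose E := E0 + (- mr *: t + - mi *: J t).
have nE : `|E| <= N.
  have -> : N = 1 + (2 * (B / m) * 1 + 2 * (B / m) * 1) by rewrite NE; field; apply: lt0r_neq0.
  by apply: ler_normD2 => //; apply: ler_normD2; rewrite normrZ ler_pM // normrN; case: mrb.
have nJE := le_trans (norm_J_le E) nE.
have MR : qR M E t = 0.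
  rewrite /E !qRD // !qRZ // qRJl // qI_diag // oppr0 mulr0 addr0 mulNr /mr divfK //.
  by rewrite subrr.
have MI : qI M E t = 0.
  by rewrite /E !qID // !qIZ // qIJl // qI_diag // mulr0 add0r mulNr /mi divfK // subrr.
have frame : forall Q K, symform Q -> symform K -> hpol Q K E t = hpol Q K re1 re2.
  move=> Q K sQ sK; have := hpol_frame E t sQ sK.
  rewrite [hdet (@dot R) E t]hdet_shear; last exact: symform_dot.
  by rewrite dE0; apply: mulfI; rewrite pnatr_eq0.
have frame1 : hdet M1 E t = hdet M1 re1 re2.
  apply: (@mulfI _ 2); first by rewrite pnatr_eq0.
  by rewrite !hdet_hpol frame.
pose al := qR M E E.
have al0 : 0 <= al by apply: le_trans (coerc E); rewrite mulr_ge0 ?dot_ge0 // ltW.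
have alb : al <= 2 * B * N ^+ 2.
  have [h _] := qRb _ _ B0 Mb E E N N nE nE.
  by apply: le_trans (ler_norm _) (le_trans h _); rewrite expr2 !mulrA.
have gb : g <= 2 * B.
  have [h _] := qRb _ _ B0 Mb t t 1 1 nt nt.
  by apply: le_trans (ler_norm _) (le_trans h _); rewrite !mulr1.
pose a1 := qR M1 E E; pose c1 := qR M1 t t; pose b1 := qR M1 E t; pose i1 := qI M1 E t.
have D1 : al * c1 + g * a1 = 0.
  by rewrite -det1 -frame // /hpol MR MI !mul0r addr0 mulr0 subr0.
have D2 : al * qR M2 t t + g * qR M2 E E + 2 * (a1 * c1 - b1 ^+ 2 - i1 ^+ 2) = 0.
  by rewrite -det2 -frame // -frame1 /hpol MR MI !mul0r addr0 mulr0 subr0.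
have peb F : `|A e F| <= 4 * delta * `|F|.
  rewrite Ae mulrC; apply: le_trans (ler_normM (dot_le_norm e F) (_ : `|xi| <= delta)) _.
    by rewrite ger0_norm.
  rewrite [leRHS]mulrAC ler_wpM2r // ler_wpM2l // -[leRHS]mul1r ler_wpM2r //.
pose P1 := fun E F => A e E * p F + A e F * p E.
pose P2 := fun E F => X e E * p F + X e F * p E.
pose P3 := fun E F => A e E * A e F.
have P1b F G : `|P1 F G| <= 8 * B * delta * `|F| * `|G|.
  have -> : 8 * B * delta * `|F| * `|G| =
     (4 * delta * `|F|) * (B * `|G|) + (4 * delta * `|G|) * (B * `|F|) by ring.
  by apply: ler_normD2; apply: ler_normM.
have P2b F G : `|P2 F G| <= 2 * B * delta * `|F| * `|G|.
  have -> : 2 * B * delta * `|F| * `|G| =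
     (delta * `|F|) * (B * `|G|) + (delta * `|G|) * (B * `|F|) by ring.
  by rewrite /P2 !Xe; apply: ler_normD2; apply: ler_normM.
have P3b F G : `|P3 F G| <= 16 * delta * `|F| * `|G|.
  apply: le_trans (ler_normM (peb F) (peb G)) _.
  have -> : 4 * delta * `|F| * (4 * delta * `|G|) = delta * (16 * delta * `|F| * `|G|) by ring.
  by rewrite -[leRHS]mul1r ler_wpM2r // !mulr_ge0.
(* The second variation along F and J F, with the displacement s t + r J t. *)
have U F s r (n ss : R) : `|F| <= n -> `|s| <= ss -> `|r| <= ss ->
    qR Xi F F <= qR M2 F F + 4 * (s * qR M1 F t + r * qI M1 F t) + 2 * (s ^+ 2 + r ^+ 2) * g
      + (qR P2 F F + 4 * (s * qR P1 F t + r * qI P1 F t)) + (64 * n ^+ 2 + 64 * n * ss) * delta.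
  move=> nF sb rb; have nJF := le_trans (norm_J_le F) nF.
  have n0 : 0 <= n := le_trans (normr_ge0 _) nF.
  have s0 : 0 <= ss := le_trans (normr_ge0 _) sb.
  pose c := s *: t + r *: J t.
  have nc : `|c| <= 2 * ss.
    have -> : 2 * ss = ss * 1 + ss * 1 by ring.
    by apply: ler_normD2; rewrite normrZ ler_pM.
  have nJc := le_trans (norm_J_le c) nc.
  have pc : p c = 0 by rewrite /c linD // !linZ // pt pJt !mulr0 addr0.
  have pJc : p (J c) = 0 by rewrite /c JD !JZ JJ linD // !linZ // linN // pt pJt oppr0 !mulr0 addr0.
  have Acc : qR A c c = (s ^+ 2 + r ^+ 2) * g.
    transitivity (qR M c c); first by rewrite /qR /M pc pJc; ring.
    rewrite /c /g !qRD // !qRDr // !qRZ // !qRZr // !qRJJ // !qRJl // !qRJr // !qI_diag //.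
    by move: (qR _ _ _) => *; ring.
  have XcF : qR X c F = s * (qR M1 F t + qR P1 F t) + r * (qI M1 F t + qI P1 F t).
    have -> : qR M1 F t + qR P1 F t = qR X F t by rewrite /qR /M1 /P1; ring.
    have -> : qI M1 F t + qI P1 F t = qI X F t by rewrite /qI /M1 /P1; ring.
    rewrite /c qRD // !qRZ // qRJl // (qRC t F sX) (qIC t F sX); ring.
  have SF : qR S F F = qR M2 F F + qR P2 F F + 2 * qR P3 F F by rewrite /qR /M2 /P2 /P3; ring.
  have dc : forall G H, `|G| <= n -> `|H| <= 2 * ss -> `|d G * dot e H| <= 8 * n * ss * delta.
    move=> G H hG hH.
    have h1 : `|d G| <= delta * n by apply: le_trans (db G) _; rewrite ler_wpM2l.
    have h2 : `|dot e H| <= 4 * (1 * (2 * ss)).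
      by apply: le_trans (dot_le_norm _ _) _; rewrite ler_wpM2l // ler_pM.
    by apply: le_trans (ler_normM h1 h2) _; rewrite le_eqVlt; apply/orP; left; apply/eqP; ring.
  have p3 : qR P3 F F <= 32 * n ^+ 2 * delta.
    have [h _] := qRb _ (16 * delta) (mulr_ge0 (ler0n _ 16) d0) P3b F F n n nF nF.
    by apply: le_trans (ler_norm _) (le_trans h _); rewrite le_eqVlt; apply/orP; left; apply/eqP; ring.
  have x1 : 0 <= xi * dot c c by rewrite mulr_ge0 ?dot_ge0.
  have t1' := test F c; have t2' := test (J F) (J c).
  rewrite dotJJ in t2'.
  have h1 := dc _ _ nF nc; have h2 := dc _ _ nJF nJc.
  rewrite ler_norml in h1; rewrite ler_norml in h2.
  have [h1' _] := andP h1; have [h2' _] := andP h2.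
  rewrite {1}/qR in Acc; rewrite {1}/qR in XcF; rewrite {1}/qR in SF; rewrite {1}/qR.
  move: (qR M2 F F) (qR P2 F F) (qR P3 F F) (d F * _) (d (J F) * _) Acc XcF SF p3 x1 t1' t2' h1' h2'.
  move: (qR M1 F t) (qI M1 F t) (qR P1 F t) (qI P1 F t).
  move: (S _ _) (S _ _) (X _ _) (X _ _) (A c c) (A _ _) (Xi _ _) (Xi _ _) (xi * _) => *.
  lra.
have sE (z : R) : `|z| <= 2 * (B * N) -> `|- z / g| <= 2 * B * N / m.
  move=> hz; have -> : 2 * B * N / m = 2 * (B * N) * m^-1 by ring.
  by apply: ler_normM; rewrite ?normrN // ger0_norm.
have [b1b i1b] := qRb _ _ B0 M1b E t N 1 nE nt; rewrite mulr1 in b1b i1b.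
have [c1b _] := qRb _ _ B0 M1b t t 1 1 nt nt; rewrite !mulr1 in c1b.
have UE := U E (- b1 / g) (- i1 / g) N (2 * B * N / m) nE (sE _ b1b) (sE _ i1b).
have c1b' : `|- c1 / g| <= 2 * B / m by apply: ler_normM; rewrite ?normrN // ger0_norm.
have z0 : `|0 : R| <= 2 * B / m by rewrite normr0 -mulrA mulr_ge0.
have Ut := U t (- c1 / g) 0 1 (2 * B / m) nt c1b' z0.
have P2t : qR P2 t t = 0 by rewrite /qR /P2 pt pJt; ring.
have P1t : qR P1 t t = 0 by rewrite /qR /P1 pt pJt; ring.
have [P2E _] := qRb P2 _ (mulr_ge0 (mulr_ge0 (ler0n _ 2) B0) d0) P2b E E N N nE nE.
have [P1E P1I] := qRb P1 _ (mulr_ge0 (mulr_ge0 (ler0n _ 8) B0) d0) P1b E t N 1 nE nt.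
have s1 := ler_normM (sE _ b1b) P1E; have s2 := ler_normM (sE _ i1b) P1I.
rewrite -frame // /hpol MR MI !mul0r addr0 mulr0 subr0 -/al -/g.
have HE : qR Xi E E <= qR M2 E E - 2 * (b1 ^+ 2 + i1 ^+ 2) / g +
   (N ^+ 2 * (4 * B + 64) + 256 * B ^+ 2 * N ^+ 2 / m + 128 * B * N ^+ 2 / m) * delta.
  apply: le_trans UE _; rewrite -/b1 -/i1.
  have -> : (- b1 / g * b1 + - i1 / g * i1) = - (b1 ^+ 2 + i1 ^+ 2) / g by field.
  have -> : 2 * ((- b1 / g) ^+ 2 + (- i1 / g) ^+ 2) * g = 2 * (b1 ^+ 2 + i1 ^+ 2) / g by field.
  have -> : 2 * (b1 ^+ 2 + i1 ^+ 2) / g = 2 * ((b1 ^+ 2 + i1 ^+ 2) / g) by ring.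
  have s1' : - b1 / g * qR P1 E t <= 2 * B * N / m * (2 * (8 * B * delta * N * 1)).
    exact: le_trans (ler_norm _) s1.
  have s2' : - i1 / g * qI P1 E t <= 2 * B * N / m * (2 * (8 * B * delta * N * 1)).
    exact: le_trans (ler_norm _) s2.
  move: (le_trans (ler_norm _) P2E) s1' s2'.
  move: (- b1 / g * qR P1 E t) (- i1 / g * qI P1 E t).
  by rewrite mulNr; move: (qR P2 E E) ((_ + _) / g) => *; lra.
have Ht : qR Xi t t <= qR M2 t t - 2 * c1 ^+ 2 / g + (64 + 128 * B / m) * delta.
  apply: le_trans Ut _; rewrite P2t P1t -/c1 !(mul0r, mulr0, addr0) expr0n addr0.
  rewrite le_eqVlt; apply/orP; left; apply/eqP.
  by field; rewrite gn0 lt0r_neq0.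
have dg : g * (b1 ^+ 2 + i1 ^+ 2) / g = b1 ^+ 2 + i1 ^+ 2 by field.
(* The third order terms that optimizing (s, r) produces are those of the twice
   differentiated equation. *)
have zero : g * (2 * (b1 ^+ 2 + i1 ^+ 2) / g) + al * (2 * c1 ^+ 2 / g) =
    al * qR M2 t t + g * qR M2 E E.
  have -> : al * qR M2 t t + g * qR M2 E E = - 2 * (a1 * c1 - b1 ^+ 2 - i1 ^+ 2).
    by apply/eqP; rewrite -subr_eq0 -D2; apply/eqP; ring.
  have -> : al * (2 * c1 ^+ 2 / g) = 2 * c1 * (al * c1) / g by ring.
  have -> : al * c1 = - (g * a1) by apply/eqP; rewrite -addr_eq0 D1.
  by field.
set K1 := (N ^+ 2 * (4 * B + 64) + _ + _) in HE *.
set K2 := (64 + 128 * B / m) in Ht *.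
have mi0 : 0 <= m^-1 by rewrite invr_ge0 ltW.
have K10 : 0 <= K1.
  have N2 := exprn_ge0 2 N0; have B2 := exprn_ge0 2 B0; have n0 := @ler0n R.
  exact: (addr_ge0 (addr_ge0 (mulr_ge0 N2 (addr_ge0 (mulr_ge0 (n0 4) B0) (n0 64)))
    (mulr_ge0 (mulr_ge0 (mulr_ge0 (n0 256) B2) N2) mi0))
    (mulr_ge0 (mulr_ge0 (mulr_ge0 (n0 128) B0) N2) mi0)).
have K20 : 0 <= K2 by exact: addr_ge0 (ler0n _ 64) (mulr_ge0 (mulr_ge0 (ler0n _ 128) B0) mi0).
have h1 := ler_wpM2l (ltW g0) HE; have h2 := ler_wpM2l al0 Ht.
have h3 : g * (K1 * delta) <= 2 * B * (K1 * delta) by rewrite ler_wpM2r // mulr_ge0.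
have h4 : al * (K2 * delta) <= 2 * B * N ^+ 2 * (K2 * delta) by rewrite ler_wpM2r // mulr_ge0.
clear HE Ht; move: zero h1 h2 h3 h4; move: (qR Xi t t) (qR Xi E E) (qR M2 t t) (qR M2 E E).
move: (2 * (b1 ^+ 2 + _) / g) (2 * c1 ^+ 2 / g).
  move: (N ^+ 2) K1 K2 K10 K20 => *.
lra.
Qed.

End ConstantRankAlgebra.

(** * Gradients, Hessians and the Gaussian barrier *)

Section HessianForms.
Context {R : realType}.
Notation V := (C2 R).
Implicit Types (A : set V) (f g : V -> R) (E F G x y z : V).

Definition grad f x : V -> R := fun E => dd E f x.
Definition hess f x : V -> V -> R := fun E F => dd E (dd F f) x.

(** For f = - ln w, this is minus the Hessian of w, divided by w. *)
Definition logform f x : V -> V -> R := fun E F => hess f x E F - grad f x E * grad f x F.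

Lemma linform_grad A f x : smooth A f -> A x -> linform (grad f x).
Proof.
move=> sf Ax; have df := smooth_diff sf Ax.
by split=> *; rewrite /grad ?(ddD _ _ df) ?(ddZ _ _ df).
Qed.

Lemma symform_hess A f x : open A -> smooth A f -> A x -> symform (hess f x).
Proof.
move=> oA sf Ax; split=> [E F G|a E G|E F]; rewrite /hess.
- exact: (ddD _ _ (smooth_diff (smooth_dd G sf) Ax)).
- exact: (ddZ _ _ (smooth_diff (smooth_dd G sf) Ax)).
- exact: (dd_comm _ _ oA sf Ax).
Qed.

Lemma dd_comm2 A f E F G x : open A -> smooth A f -> A x ->
  dd E (dd F (dd G f)) x = dd E (dd G (dd F f)) x.
Proof.
move=> oA sf; have C z : A z -> dd F (dd G f) z = dd G (dd F f) z.
  by move=> Az; apply: (dd_comm F G oA sf Az).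
exact: (dd_congr E oA C).
Qed.

Lemma dd_comm_in A f e E F x : open A -> smooth A f -> A x ->
  dd e (dd E (dd F f)) x = hess (dd e f) x E F.
Proof.
move=> oA sf Ax; rewrite (dd_comm e E oA (smooth_dd F sf) Ax).
exact: (dd_comm2 E e F oA sf Ax).
Qed.

Lemma symform_dd_hess A f x e : open A -> smooth A f -> A x ->
  symform (fun E F => dd e (dd E (dd F f)) x).
Proof.
move=> oA sf Ax; have C E F := @dd_comm_in A f e E F x oA sf Ax.
have -> : (fun E F => dd e (dd E (dd F f)) x) = hess (dd e f) x.
  by apply/funext => E; apply/funext => F; exact: C.
exact: symform_hess oA (smooth_dd e sf) Ax.
Qed.

Lemma symform_dd2_hess A f x e : open A -> smooth A f -> A x ->
  symform (fun E F => dd e (dd e (dd E (dd F f))) x).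
Proof.
move=> oA sf Ax; have C E F : dd e (dd e (dd E (dd F f))) x = dd e (dd E (dd F (dd e f))) x.
  have C1 z : A z -> dd e (dd E (dd F f)) z = dd E (dd F (dd e f)) z.
    by move=> Az; exact: (dd_comm_in e E F oA sf Az).
  exact: (dd_congr e oA C1 Ax).
have -> : (fun E F => dd e (dd e (dd E (dd F f))) x) = fun E F => dd e (dd E (dd F (dd e f))) x.
  by apply/funext => E; apply/funext => F; exact: C.
exact: symform_dd_hess e oA (smooth_dd e sf) Ax.
Qed.

Lemma symform_logform A f x : open A -> smooth A f -> A x -> symform (logform f x).
Proof.
move=> oA sf Ax; have := symform_lin 1 (-1) (symform_hess oA sf Ax)
  (symform_sqr (linform_grad sf Ax)).
by congr symform; apply/funext => E; apply/funext => F; rewrite /logform; ring.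
Qed.

Lemma linform_bound p E : linform p ->
  `|p E| <= (\sum_(k < 2 + 2) `|p (delta_mx 0 k)|) * `|E|.
Proof.
move=> lp; have -> : p E = \sum_(k < 2 + 2) E 0 k * p (delta_mx 0 k).
  have pS (s : seq 'I_(2 + 2)) (F : 'I_(2 + 2) -> V) : p (\sum_(k <- s) F k) = \sum_(k <- s) p (F k).
    elim: s => [|k s IH]; last by rewrite !big_cons (linD _ _ lp) IH.
    by rewrite !big_nil -(scale0r (0 : V)) (linZ _ _ lp) mul0r.
  by rewrite {1}(row_sum_delta E) pS; apply: eq_bigr => k _; rewrite (linZ _ _ lp).
rewrite mulr_suml; apply: le_trans (ler_norm_sum _ _ _) _; apply: ler_sum => k _.
by rewrite normrM mulrC ler_wpM2l // coord_le_norm.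
Qed.

Lemma symform_bound Q E F : symform Q ->
  `|Q E F| <= (\sum_(k < 2 + 2) \sum_(l < 2 + 2) `|Q (delta_mx 0 k) (delta_mx 0 l)|) * `|E| * `|F|.
Proof.
move=> hQ; have l1 G : linform (Q^~ G) by split=> *; rewrite ?symDl ?symZl.
have l2 G : linform (Q G) by split=> *; rewrite ?symDr ?symZr.
apply: le_trans (linform_bound E (l1 F)) _.
rewrite mulrAC; apply: ler_wpM2r => //; rewrite mulr_suml; apply: ler_sum => k _.
exact: (linform_bound F (l2 _)).
Qed.

Lemma smooth_bounded A f (K : set V) : smooth A f -> compact K -> K `<=` A ->
  exists2 B : R, 0 <= B & forall z, K z -> `|f z| <= B.
Proof.
move=> sf cK KA.
have [->|/set0P K0] := eqVneq K set0; first by exists 0.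
have cf : {within K, continuous (fun z => `|f z|)}.
  apply: continuous_in_subspaceT => z /set_mem/KA Az.
  by apply: continuous_comp; [exact: smooth_continuous sf Az|exact: norm_continuous].
have [c _ h] := EVT_max_rV K0 cK cf.
by exists `|f c| => // z Kz; apply: h; apply/mem_set.
Qed.

Lemma smooth_bounded_sum A (I : Type) (s : seq I) (F : I -> V -> R) (K : set V) :
  (forall i, smooth A (F i)) -> compact K -> K `<=` A ->
  exists2 B : R, 0 <= B & forall z, K z -> \sum_(i <- s) `|F i z| <= B.
Proof.
move=> sf cK KA; elim: s => [|i s [B B0 h]].
  by exists 0 => // z _; rewrite big_nil.
have [C C0 h'] := smooth_bounded (sf i) cK KA.
by exists (C + B) => [|z Kz]; rewrite ?addr_ge0 // big_cons lerD ?h ?h'.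
Qed.

Definition coord (k : 'I_(2 + 2)) : V -> R := fun z => z 0 k.

Lemma diff_coord k z : differentiable (coord k) z.
Proof. exact: differentiable_coord. Qed.

Lemma dd_coord k E z : dd E (coord k) z = E 0 k.
Proof.
have h := is_derive_line (t := 0) (E := E) (f := coord k) (x := z) (diff_coord k _).
have := @derive_val _ _ _ _ _ _ _ h; rewrite scale0r addr0 => <-.
have -> : (fun s : R => coord k (z + s *: E)) = cst (z 0 k) + (fun s : R => s *: (E 0 k)).
  by apply/funext => s; rewrite /coord !mxE.
have d0 : is_derive (0 : R) 1 (fun s : R => s *: (E 0 k)) (E 0 k).
  apply: DeriveDef; first by apply/derivable1_diffP.
  by rewrite deriveE // diff_val scale1r.
by rewrite deriveD // derive_cst add0r (@derive_val _ _ _ _ _ _ _ d0).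
Qed.

Lemma smooth_coord A k : open A -> smooth A (coord k).
Proof.
move=> oA [|n]; (split; first by move=> *; apply: diff_coord) => // E.
by apply: (Sm_congr oA _ (Sm_cst A n (E 0 k))) => z _; rewrite dd_coord.
Qed.

Lemma smooth_sum A (s : seq 'I_(2 + 2)) (F : 'I_(2 + 2) -> V -> R) : open A ->
  (forall k, smooth A (F k)) -> smooth A (fun z => \sum_(k <- s) F k z).
Proof. by move=> oA sF n; apply: Sm_sum => // k; apply: sF. Qed.

Lemma smooth_dot A y E : open A -> smooth A (fun z => dot (z - y) E).
Proof.
move=> oA; apply: (smooth_congr oA _ (f := fun z => \sum_(k < 2 + 2) (coord k z + - y 0 k) * E 0 k)).
  by move=> z _; apply: eq_bigr => k _; rewrite !mxE.
apply: smooth_sum => // k; apply: smooth_mul => //; last exact: smooth_cst.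
by apply: smooth_add => //; [exact: smooth_coord|exact: smooth_cst].
Qed.

Lemma smooth_sqdist A y : open A -> smooth A (fun z => dot (z - y) (z - y)).
Proof.
move=> oA; apply: (smooth_congr oA _ (f := fun z => \sum_(k < 2 + 2) (coord k z + - y 0 k) * (coord k z + - y 0 k))).
  by move=> z _; apply: eq_bigr => k _; rewrite !mxE.
apply: smooth_sum => // k.
by apply: smooth_mul => //; apply: smooth_add => //; (exact: smooth_coord || exact: smooth_cst).
Qed.

Lemma dd_line_eq f E z (l : R) : differentiable f z ->
  is_derive (0 : R) 1 (fun s : R => f (z + s *: E)) l -> dd E f z = l.
Proof.
move=> df h; have df' : differentiable f (z + (0 : R) *: E) by rewrite scale0r addr0.
have := @derive_val _ _ _ _ _ _ _ (is_derive_line df'); rewrite scale0r addr0 => <-.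
exact: derive_val.
Qed.

Lemma dd_dot y E F z : dd F (fun z => dot (z - y) E) z = dot F E.
Proof.
have sD := @smooth_dot setT y E openT.
apply: dd_line_eq; first exact: (smooth_diff sD).
have -> : (fun s : R => dot (z + s *: F - y) E) = cst (dot (z - y) E) + (fun s : R => s *: dot F E).
  by apply/funext => s; rewrite (addrAC z) (dotDl (z - y)) dotZl.
have d0 : is_derive (0 : R) 1 (fun s : R => s *: dot F E) (dot F E).
  apply: DeriveDef; first by apply/derivable1_diffP.
  by rewrite deriveE // diff_val scale1r.
by rewrite -[X in is_derive _ _ _ X]add0r; apply: is_deriveD.
Qed.

Lemma dd_sqdist y F z : dd F (fun z => dot (z - y) (z - y)) z = 2 * dot (z - y) F.
Proof.
have sD := @smooth_sqdist setT y openT.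
apply: dd_line_eq; first exact: (smooth_diff sD).
have -> : (fun s : R => dot (z + s *: F - y) (z + s *: F - y)) =
   cst (dot (z - y) (z - y)) + (fun s : R => s *: (2 * dot (z - y) F)) + (fun s : R => dot F F * (s * s)).
  apply/funext => s; rewrite (addrAC z); move: (z - y) => w.
  rewrite [RHS](_ : _ = dot w w + s * (2 * dot w F) + dot F F * (s * s)) //.
  by rewrite !(dotDl, dotDr, dotZl, dotZr) (dotC F w); ring.
have := isd_add (isd_add (isd_cst (dot (z - y) (z - y)) 0)
  (isd_mul (isd_id 0) (isd_cst (2 * dot (z - y) F) 0)))
  (isd_scale (dot F F) (isd_mul (isd_id (0 : R)) (isd_id 0))).
by move=> h; apply: isd_eq h _; ring.
Qed.

(** The barrier of Hopf: when k is large, the square of the gradient of its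
    exponent, of order k^2, dominates its Hessian away from y. *)
Definition gauss (k : R) y : V -> R := fun z => expR (- k * dot (z - y) (z - y)).

Lemma gauss_diff k y z : differentiable (gauss k y) z /\
  forall E, dd E (gauss k y) z = - 2 * k * dot (z - y) E * gauss k y z.
Proof.
have sD : smooth setT (fun z => - k * dot (z - y) (z - y)).
  by apply: smooth_scale; [exact: openT|apply: smooth_sqdist; exact: openT].
have [d h] := is_diff_comp1 (smooth_diff (x := z) sD I) (is_derive_expR _).
split=> // E; rewrite /gauss h mulrC.
rewrite dd_scale ?dd_sqdist; first by ring.
exact: (smooth_diff (x := z) (smooth_sqdist y openT) I).
Qed.

Lemma smooth_gauss A k y : open A -> smooth A (gauss k y).
Proof.
move=> oA; elim=> [|n IH]; (split; first by move=> z _; case: (gauss_diff k y z)) => // E.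
apply: (@Sm_congr _ _ A n (fun z => - 2 * k * dot (z - y) E * gauss k y z)) => //.
  by move=> z _; rewrite (gauss_diff k y z).2.
by apply: Sm_mul => //; apply: smooth_scale => //; apply: smooth_dot.
Qed.

Lemma hess_gauss k y z E F : hess (gauss k y) z E F =
  (4 * k ^+ 2 * (dot (z - y) E * dot (z - y) F) - 2 * k * dot E F) * gauss k y z.
Proof.
rewrite /hess (dd_congr (g := fun z => - 2 * k * dot (z - y) F * gauss k y z) E openT) //; last first.
  by move=> x _; rewrite (gauss_diff k y x).2.
have s1 := smooth_scale (- 2 * k) openT (smooth_dot y F openT).
rewrite (dd_mul E (smooth_diff (x := z) s1 I) (gauss_diff k y z).1) (gauss_diff k y z).2.
rewrite dd_scale ?dd_dot; first by ring.
exact: (smooth_diff (x := z) (smooth_dot y F openT) I).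
Qed.

Lemma gauss_gt0 k y z : 0 < gauss k y z.
Proof. exact: expR_gt0. Qed.

Lemma gauss_le1 k y z : 0 <= k -> gauss k y z <= 1.
Proof. by move=> k0; rewrite /gauss -expR0 ler_expR mulNr oppr_le0 mulr_ge0 ?dot_ge0. Qed.

Lemma norm_delta k : `|delta_mx 0 k : V| <= 1.
Proof. by apply: norm_le_coord => // l; rewrite mxE eqxx /=; case: eqP => _; rewrite ?normr0 ?normr1. Qed.

Lemma taylor_le (U : set V) (f : V -> R) x E (B : R) : smooth U f -> 0 <= B ->
  (forall t : R, 0 <= t <= 1 -> U (x + t *: E)) ->
  (forall z F, U z -> `|hess f z F F| <= B * `|F| * `|F|) ->
  `|f (x + E) - f x - dd E f x| <= B * `|E| ^+ 2.
Proof.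
move=> sf B0 seg hB; have [|c /andP[c0 c1] hc] := @MVT_line R _ f x E 1 ltr01.
  by move=> t /seg Ut; exact: smooth_diff sf Ut.
have [|c' /andP[c'0 c'1] hc'] := @MVT_line R _ (dd E f) x E c c0.
  by move=> t /andP[t0 tc]; apply: smooth_diff (smooth_dd E sf) _; apply: seg; rewrite t0; exact: le_trans tc (ltW c1).
rewrite scale1r mul1r in hc; rewrite hc hc' normrM (gtr0_norm c0).
have Uc' : U (x + c' *: E) by apply: seg; rewrite (ltW c'0) (le_trans (ltW c'1)) // ltW.
apply: le_trans (_ : 1 * (B * `|E| * `|E|) <= _); last by rewrite mul1r expr2 mulrA.
by apply: ler_pM => //; [exact: ltW|exact: ltW|exact: hB].
Qed.

Lemma laplacianE f z : \sum_(k < 2 + 2) hess f z (delta_mx 0 k) (delta_mx 0 k) =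
  qR (hess f z) re1 re1 + qR (hess f z) re2 re2.
Proof.
rewrite big_split_ord /= !big_ord_recl !big_ord0 !addr0 /qR /re1 /re2 !J_delta.
have -> : lift ord0 ord0 = 1 :> 'I_2 by apply/val_inj.
by rewrite addrACA.
Qed.

Lemma laplacian_gauss k y z : \sum_(l < 2 + 2) hess (gauss k y) z (delta_mx 0 l) (delta_mx 0 l) =
  (4 * k ^+ 2 * dot (z - y) (z - y) - 8 * k) * gauss k y z.
Proof.
have dl (x : V) l : dot x (delta_mx 0 l) = x 0 l.
  rewrite /dot (bigD1 l) //= mxE !eqxx mulr1 big1 ?addr0 // => i il.
  by rewrite mxE eqxx (negbTE il) mulr0.
have d1 l : dot (delta_mx 0 l : V) (delta_mx 0 l) = 1 by rewrite dl mxE !eqxx.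
under eq_bigr => l _ do rewrite hess_gauss dl d1.
rewrite -mulr_suml sumrB -mulr_sumr sumr_const card_ord; congr (_ * _).
by rewrite -mulr_natl; congr (_ - _); ring.
Qed.

End HessianForms.

(** * The strong maximum principle *)

Section StrongMaximumPrinciple.
Context {R : realType}.
Notation V := (C2 R).
Implicit Types (A : set V) (x y z a : V).

Definition disc y (r : R) : set V := [set z | dot (z - y) (z - y) <= r].

Lemma dot_continuous y : continuous (fun z : V => dot (z - y) (z - y)).
Proof. by move=> z; apply: (smooth_continuous (smooth_sqdist y openT) (x := z)). Qed.

Lemma gauss_continuous k y : continuous (gauss k y).
Proof. by move=> z; apply: differentiable_continuous (gauss_diff k y z).1. Qed.

Lemma closed_disc y (r : R) : closed (disc y r).
Proof.
have -> : disc y r = (fun z : V => dot (z - y) (z - y)) @^-1` [set t | t <= r] by [].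
by apply: closed_comp; [move=> z _; exact: dot_continuous|exact: closed_le].
Qed.

Lemma disc_norm y (r : R) z : 0 <= r -> disc y (r ^+ 2) z -> `|z - y| <= r.
Proof.
move=> r0 h; rewrite -ler_sqr ?nnegrE //.
exact: le_trans (norm_le_dot _) h.
Qed.

Lemma norm_disc y (r : R) z : `|z - y| <= r -> disc y (4 * r ^+ 2) z.
Proof.
move=> h; rewrite /disc /=; apply: le_trans (ler_norm _) (le_trans (dot_le_norm _ _) _).
by rewrite ler_wpM2l // expr2 ler_pM.
Qed.

Lemma compact_sublevel (T : topologicalType) (K : set T) (f : T -> R) (c : R) :
  compact K -> (forall t, K t -> {for t, continuous f}) ->
  compact (K `&` [set t | c <= f t]).
Proof.
move=> cK cf F FF FK.
have [p [Kp cp]] : K `&` cluster F !=set0 by apply: cK; apply: filterS FK => t [].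
exists p; split=> //; split=> //=; rewrite leNgt; apply/negP => fpc.
have n1 : nbhs p [set t | f t < c].
  by apply: (cvgr_lt _ (cf p Kp)).
have [t [[_ h1] h2]] := cp _ _ FK n1.
by move: h2; rewrite /= ltNge h1.
Qed.

Lemma closed_ball_compact a (r : R) : 0 < r -> compact (closed_ball a r : set V).
Proof.
move=> r0; apply: bounded_closed_compact; last exact: closed_ball_closed.
rewrite closed_ballE //; exists (`|a| + r); split; first by rewrite num_real.
move=> M hM z /= hz; apply: le_trans (ltW hM).
rewrite -[z](subrK a) addrC (le_trans (ler_normD _ _)) // lerD2l distrC //.
Qed.

Lemma open_norm_ball A x : open A -> A x ->
  exists2 r : R, 0 < r & forall z, `|z - x| < r -> A z.
Proof.
move=> oA Ax; have /nbhs_ballP[r /= r0 h] : nbhs x A by apply: open_nbhs_nbhs.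
by exists r => // z hz; apply: h; rewrite -ball_normE /= distrC.
Qed.

(** The functions W to which the maximum principle applies live on a family of
    fibres D z over the points z, and the maximum is also taken along the fibres.
    Being a strict subsolution is replaced by its only consequence of use: small
    multiples of the barrier added to W have no local maximum in an annulus. *)
Definition no_touching (D : V -> V -> Prop) (W : V -> V -> R) (mu : R) y (r0 r1 : R) a (rho : R) :=
  exists2 k : R, 0 < k & exists2 e0 : R, 0 < e0 & forall e, 0 < e < e0 ->
  forall x h, `|x - a| < rho -> r0 < dot (x - y) (x - y) < r1 -> D x h ->
  mu <= W x h + e * gauss k y x ->
  (\forall z \near x, forall h', D z h' -> W z h' + e * gauss k y z <= W x h + e * gauss k y x) ->
  False.

(** Hopf's argument. If the contact set were not open, some disc missing it would
    be close to one of its points; the barrier centred in that disc, added to W,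
    would have a local maximum in an annulus. The compact set T replaces the
    properness of the fibres. *)
Lemma strong_maximum_principle A (D : V -> V -> Prop) (W : V -> V -> R) (mu eta : R) :
  open A -> connected A -> 0 < eta ->
  (forall x h, A x -> D x h -> W x h <= mu) ->
  (forall a, A a -> exists2 rho : R, 0 < rho & exists T : set (V * V),
     [/\ forall z, `|z - a| <= rho -> A z, compact T,
         forall t, T t -> D t.1 t.2 /\ {for t, continuous (fun t : V * V => W t.1 t.2)},
         forall z h, `|z - a| <= rho -> D z h -> mu - eta < W z h -> T (z, h) &
         forall y r0 r1, `|y - a| < rho -> 0 < r0 -> no_touching D W mu y r0 r1 a rho]) ->
  (exists2 x, A x & exists2 h, D x h & W x h = mu) ->
  forall x, A x -> exists2 h, D x h & W x h = mu.
Proof.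
move=> oA cA eta0 Wmu loc [x0 Ax0 [h0 Dh0 Wh0]].
pose S : set V := A `&` [set x | exists2 h, D x h & W x h = mu].
(* The contact set is closed in A: it is locally a projection of a compact set. *)
have away y : A y -> ~ S y -> exists2 r : R, 0 < r & forall z, `|z - y| < r -> ~ S z.
  move=> Ay nSy; have [rho rho0 [T [TA cT TD inT _]]] := loc y Ay.
  pose T' := T `&` [set t | mu <= W t.1 t.2].
  have cT' : compact T' by apply: compact_sublevel => // t /TD[].
  have cP : compact (fst @` T').
    by apply: continuous_compact => //; apply: continuous_subspaceT => t; exact: cvg_fst.
  have clP : closed (fst @` T') by apply: compact_closed => //; exact: norm_hausdorff.
  have nP : (~` (fst @` T')) y.
    move=> [[y' h] [/= Tyh muW] eyy]; apply: nSy; split=> //; rewrite -eyy.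
    have [/= Dyh _] := TD _ Tyh.
    exists h => //; apply/eqP; rewrite eq_le muW andbT; apply: Wmu => //.
    by rewrite eyy.
  have [r r0 hr] := open_norm_ball (closed_openC clP) nP.
  exists (Num.min r rho); first by rewrite lt_min r0.
  move=> z; rewrite lt_min => /andP[zr zrho] [Az [h Dzh Wzh]].
  apply: (hr z zr); exists (z, h) => //; split; last by rewrite /= Wzh.
  by apply: inT => //; [exact: ltW|rewrite Wzh ltrBlDr ltrDl].
(* A point y off the contact set near a is the centre of the barrier. *)
have oS : open S.
  rewrite openE => a [Aa [ha Dha Wha]].
  have [rho rho0 [T [TA cT TD inT nt]]] := loc a Aa.
  apply/nbhs_ballP; exists (rho / 8) => /=; first by rewrite divr_gt0.
  move=> y; rewrite -ball_normE /= => hya; apply: contrapT => nSy.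
  have yrho : `|y - a| < rho by rewrite distrC (lt_trans hya) // ltr_pdivrMr // ltr_pMr // ltr1n.
  have Ay : A y by apply: TA; exact: ltW.
  have [r1 r10 far] := away y Ay nSy.
  pose r := Num.min r1 (rho / 8) / 2.
  have m0 : 0 < Num.min r1 (rho / 8) by rewrite lt_min r10 divr_gt0.
  have [mr mrho] : Num.min r1 (rho / 8) <= r1 /\ Num.min r1 (rho / 8) <= rho / 8.
    by rewrite !ge_min !lexx orbT.
  have r0 : 0 < r by rewrite divr_gt0.
  have rr1 : r < r1 by rewrite /r; lra.
  have rrho : r < rho / 8 by rewrite /r; lra.
  have discA z : disc y ((rho / 2) ^+ 2) z -> `|z - a| < rho.
    move=> /(disc_norm (divr_ge0 (ltW rho0) (ler0n _ 2))) hz.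
    apply: le_lt_trans (ler_distD y _ _) _; rewrite (distrC y); lra.
  pose T1 := T `&` (fst @^-1` disc y (r ^+ 2)).
  pose T2 := T `&` (fst @^-1` disc y ((rho / 2) ^+ 2)).
  have clf s : closed (fst @^-1` disc y s : set (V * V)).
    by apply: closed_comp; [move=> t _; exact: cvg_fst|exact: closed_disc].
  have cT1 : compact T1 by apply: compact_closedI.
  have cT2 : compact T2 by apply: compact_closedI.
  (* A gap below mu on the small disc around y. *)
  have [d d0 gap] : exists2 d : R, 0 < d & forall t, T1 t -> W t.1 t.2 <= mu - d.
    have [->|/set0P T10] := eqVneq T1 set0; first by exists 1.
    have cW : {within T1, continuous (fun t : V * V => W t.1 t.2)}.
      by apply: continuous_in_subspaceT => t /set_mem[/TD[]].
    have [c /set_mem[Tc dc] hc] := compact_EVT_max T10 cT1 cW.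
    have cA' : `|c.1 - y| <= r by apply: disc_norm => //; exact: ltW.
    have Ac : A c.1.
      apply: TA; apply: ltW; apply: discA; apply: le_trans dc _.
      by rewrite ler_sqr ?nnegrE ?(ltW r0) ?divr_ge0 ?ltW //; lra.
    exists (mu - W c.1 c.2); last by move=> t Tt; rewrite subKr; apply: hc; exact/mem_set.
    rewrite subr_gt0 lt_def (Wmu _ _ Ac (TD _ Tc).1) andbT; apply/eqP => e.
    apply: (far c.1); first by apply: le_lt_trans cA' rr1.
    by split=> //; exists c.2 => //; exact: (TD _ Tc).1.
  have [k k0 [e0 e00 touch]] := nt y (r ^+ 2) ((rho / 2) ^+ 2) yrho (exprn_gt0 2 r0).
  pose e := Num.min e0 (Num.min d eta) / 2.
  have em0 : 0 < Num.min e0 (Num.min d eta) by rewrite !lt_min e00 d0.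
  have [e1 [e2 e3]] : Num.min e0 (Num.min d eta) <= e0 /\ Num.min e0 (Num.min d eta) <= d /\
     Num.min e0 (Num.min d eta) <= eta by rewrite !ge_min !lexx !orbT.
  have ep : 0 < e by rewrite divr_gt0.
  have ee0 : e < e0 by rewrite /e; lra.
  have ed : e < d by rewrite /e; lra.
  have eeta : e < eta by rewrite /e; lra.
  have g1 z : e * gauss k y z <= e.
    by rewrite -[leRHS]mulr1 ler_wpM2l ?(ltW ep) // gauss_le1 // ltW.
  have g0 z : 0 < e * gauss k y z by rewrite mulr_gt0 // gauss_gt0.
  have ay : dot (a - y) (a - y) < (rho / 2) ^+ 2.
    have : disc y (4 * (rho / 8) ^+ 2) a by apply: norm_disc; rewrite ltW.
    move=> /le_lt_trans; apply; rewrite -subr_gt0.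
    have -> : (rho / 2) ^+ 2 - 4 * (rho / 8) ^+ 2 = 3 / 16 * rho ^+ 2 by field.
    by rewrite mulr_gt0 // exprn_gt0.
  have T2a : T2 (a, ha).
    split; last exact: ltW.
    by apply: inT; rewrite ?subrr ?normr0 ?(ltW rho0) // Wha ltrBlDr ltrDl.
  have cWg : {within T2, continuous (fun t : V * V => W t.1 t.2 + e * gauss k y t.1)}.
    apply: continuous_in_subspaceT => t /set_mem[/TD[_ cWt] _].
    apply: cvgD; first exact: cWt.
    apply: cvgM; first exact: cvg_cst.
    by apply: continuous_comp; [exact: cvg_fst|exact: gauss_continuous].
  have [[x h] /set_mem[Txh /= dx] hmax] := compact_EVT_max (ex_intro _ _ T2a) cT2 cWg.
  have vmax : mu + e * gauss k y a <= W x h + e * gauss k y x.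
    by have := hmax _ (mem_set T2a); rewrite /= Wha.
  have [Dxh _] := TD _ Txh; rewrite /= in Dxh.
  have xrho : `|x - a| < rho by apply: discA.
  have Wx : W x h <= mu by apply: Wmu => //; apply: TA; exact: ltW.
  have ga := g0 a.
  have inner : r ^+ 2 < dot (x - y) (x - y).
    rewrite ltNge; apply/negP => hx.
    have /= := gap (x, h) (conj Txh hx); have := g1 x; lra.
  have outer : dot (x - y) (x - y) < (rho / 2) ^+ 2.
    rewrite ltNge; apply/negP => hx.
    have : gauss k y x < gauss k y a.
      rewrite /gauss ltr_expR !mulNr ltrN2 ltr_pM2l //.
      exact: lt_le_trans ay hx.
    by rewrite -(ltr_pM2l ep) => ?; lra.
  apply: (touch e _ x h) => //; first by rewrite ep ee0.
  - by rewrite inner outer.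
  - by apply: le_trans vmax; rewrite lerDl ltW.
  have od : open ((fun z : V => dot (z - y) (z - y)) @^-1` [set t | t < (rho / 2) ^+ 2]).
    by apply: open_comp; [move=> z _; exact: dot_continuous|exact: open_lt].
  have : nbhs x [set z : V | dot (z - y) (z - y) < (rho / 2) ^+ 2].
    by apply: open_nbhs_nbhs.
  apply: filterS => z /ltW dz h' Dzh'.
  have zrho := discA z dz.
  have [hlt|hge] := leP (W z h') (mu - eta); last first.
    by have /= := hmax (z, h') (mem_set (conj (inT _ _ (ltW zrho) Dzh' hge) dz)).
  by have := g1 z; lra.
have SA : S = A.
  apply: cA; first by exists x0; split=> //; exists h0.
    by exists S => //; rewrite setIA setIid.
  exists (~` (A `\` S)); last first.
    apply/seteqP; split=> z; first by move=> Sz; split; [case: Sz|case].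
    by move=> [Az nz]; apply: contrapT => nS; apply: nz.
  apply: open_closedC; rewrite openE => y [Ay nSy].
  have [r r0 hr] := away y Ay nSy; have [r' r'0 hr'] := open_norm_ball oA Ay.
  apply/nbhs_ballP; exists (Num.min r r') => /=; first by rewrite lt_min r0.
  move=> z; rewrite -ball_normE /= distrC lt_min => /andP[z1 z2].
  by split; [exact: hr'|exact: hr].
by move=> x Ax; have [] : S x by rewrite SA.
Qed.

End StrongMaximumPrinciple.

(** * Interior estimates for the equation *)

Section InteriorEstimates.
Context {R : realType}.
Notation V := (C2 R).
Implicit Types (E F G x y z a b c : V).
Context (A : set V) (v : V -> R) (L : R).
Hypothesis oA : open A.
Hypothesis sv : smooth A v.
Hypothesis L0 : 0 < L.
Hypothesis pde : forall x, A x -> hdet (logform v x) re1 re2 = L.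
Hypothesis pos : forall x, A x -> 0 < qR (logform v x) re1 re1.

Lemma norm_re1 : `|re1 : V| <= 1.
Proof.
by apply: norm_unit; rewrite /re1 dot_split !mxE !eq_shift /=; ring.
Qed.

Lemma norm_re2 : `|re2 : V| <= 1.
Proof.
by apply: norm_unit; rewrite /re2 dot_split !mxE !eq_shift /=; ring.
Qed.

Lemma hpol_bound Q K (B C : R) : 0 <= B -> 0 <= C ->
  (forall E F, `|Q E F| <= B * `|E| * `|F|) -> (forall E F, `|K E F| <= C * `|E| * `|F|) ->
  `|hpol Q K re1 re2| <= 24 * B * C.
Proof.
move=> B0 C0 hQ hK.
have b Q' (B' : R) : 0 <= B' -> (forall E F, `|Q' E F| <= B' * `|E| * `|F|) ->
    forall E F, `|E| <= 1 -> `|F| <= 1 -> `|qR Q' E F| <= 2 * B' /\ `|qI Q' E F| <= 2 * B'.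
  move=> B'0 h E F hE hF.
  have h1 E' F' : `|E'| <= 1 -> `|F'| <= 1 -> `|Q' E' F'| <= B'.
    move=> h2 h3; apply: le_trans (h _ _) _; rewrite -[leRHS]mulr1 ler_pM ?mulr_ge0 //.
    by rewrite -[leRHS]mulr1 ler_wpM2l.
  have hJE := le_trans (norm_J_le E) hE; have hJF := le_trans (norm_J_le F) hF.
  by split; rewrite mulr2n mulrDl mul1r; [apply: ler_normD2|apply: ler_normB2]; apply: h1.
have q := b Q B B0 hQ; have k := b K C C0 hK.
have n1 := norm_re1; have n2 := norm_re2.
have -> : 24 * B * C = (2 * B) * (2 * C) + (2 * B) * (2 * C) +
   2 * ((2 * B) * (2 * C) + (2 * B) * (2 * C)) by ring.
have [q11 _] := q _ _ n1 n1; have [q22 _] := q _ _ n2 n2; have [q12 i12] := q _ _ n1 n2.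
have [k11 _] := k _ _ n1 n1; have [k22 _] := k _ _ n2 n2; have [k12 j12] := k _ _ n1 n2.
rewrite /hpol; apply: ler_normB2; first by apply: ler_normD2; apply: ler_normM.
apply: ler_normM; first by rewrite ger0_norm.
by apply: ler_normD2; apply: ler_normM.
Qed.

Lemma pos_coercive x E : A x ->
  L / (qR (logform v x) re1 re1 + qR (logform v x) re2 re2) * dot E E <= qR (logform v x) E E.
Proof.
move=> Ax; rewrite -(pde Ax).
apply: qR_pos_coercive; [exact: (symform_logform oA sv Ax)|exact: pos|by rewrite pde].
Qed.

Lemma logform_trace x : A x -> 0 < qR (logform v x) re1 re1 + qR (logform v x) re2 re2.
Proof.
move=> Ax; apply: addr_gt0; first exact: pos.
have : 0 < qR (logform v x) re1 re1 * qR (logform v x) re2 re2.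
  by apply: lt_le_trans (hdet_le _ _ _); rewrite pde.
by rewrite (pmulr_rgt0 _ (pos Ax)).
Qed.

Lemma logform_pos x E : A x -> E != 0 -> 0 < qR (logform v x) E E.
Proof.
move=> Ax; apply: qR_pos; [exact: (symform_logform oA sv Ax)|exact: pos|by rewrite pde].
Qed.

Definition logform1 z e : V -> V -> R := fun E F =>
  dd e (dd E (dd F v)) z - (hess v z e E * grad v z F + hess v z e F * grad v z E).

Lemma dd2_bound (K : set V) : compact K -> K `<=` A -> exists2 B : R, 0 <= B &
  forall z, K z -> forall E F, `|hess v z E F| <= B * `|E| * `|F|.
Proof.
move=> cK KA.
have [B B0 h] := smooth_bounded_sum (index_enum ('I_(2 + 2) * 'I_(2 + 2))%type)
  (fun kl => smooth_dd (delta_mx 0 kl.1) (smooth_dd (delta_mx 0 kl.2) sv)) cK KA.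
exists B => // z Kz E F; apply: le_trans (symform_bound E F (symform_hess oA sv (KA _ Kz))) _.
by rewrite !ler_wpM2r // pair_big; apply: h.
Qed.

Lemma dd3_bound (K : set V) : compact K -> K `<=` A -> exists2 B : R, 0 <= B &
  forall z, K z -> forall e E F, `|dd e (dd E (dd F v)) z| <= B * `|e| * `|E| * `|F|.
Proof.
move=> cK KA.
have [B B0 h] := smooth_bounded_sum (index_enum ('I_(2 + 2) * ('I_(2 + 2) * 'I_(2 + 2)))%type)
  (fun kl => smooth_dd (delta_mx 0 kl.1)
    (smooth_dd (delta_mx 0 kl.2.1) (smooth_dd (delta_mx 0 kl.2.2) sv))) cK KA.
exists B => // z Kz e E F; have Az := KA _ Kz.
have le1 : linform (fun e => dd e (dd E (dd F v)) z).
  exact: linform_grad (smooth_dd E (smooth_dd F sv)) Az.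
apply: le_trans (linform_bound e le1) _.
rewrite -!mulrA mulrC [B * _]mulrC -mulrA ler_wpM2l //.
apply: (@le_trans _ _ (\sum_(k < 2 + 2) (\sum_(i < 2 + 2) \sum_(j < 2 + 2)
   `|dd (delta_mx 0 k) (dd (delta_mx 0 i) (dd (delta_mx 0 j) v)) z|) * `|E| * `|F|)).
  apply: ler_sum => k _.
  exact: (symform_bound E F (symform_dd_hess (delta_mx 0 k) oA sv Az)).
have -> : \sum_(k < 2 + 2) (\sum_(i < 2 + 2) \sum_(j < 2 + 2)
   `|dd (delta_mx 0 k) (dd (delta_mx 0 i) (dd (delta_mx 0 j) v)) z|) * `|E| * `|F| =
   `|E| * `|F| * \sum_(k < 2 + 2) (\sum_(i < 2 + 2) \sum_(j < 2 + 2)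
   `|dd (delta_mx 0 k) (dd (delta_mx 0 i) (dd (delta_mx 0 j) v)) z|).
  by rewrite mulr_sumr; apply: eq_bigr => k _; rewrite mulrC mulrA mulrC mulrA mulrC.
rewrite ler_wpM2l ?mulr_ge0 //.
apply: le_trans (h z Kz); rewrite le_eqVlt; apply/orP; left; apply/eqP.
under eq_bigr do rewrite pair_big.
by rewrite pair_big.
Qed.

Lemma local_bounds a : A a -> exists2 rho : R, 0 < rho & exists B m : R,
  [/\ forall z, `|z - a| <= rho -> A z, 0 <= B /\ 0 < m,
      forall z, `|z - a| <= rho -> forall E, `|grad v z E| <= B * `|E|,
      forall z, `|z - a| <= rho -> forall E F, `|logform v z E F| <= B * `|E| * `|F| &
      forall z, `|z - a| <= rho -> [/\ forall E, m * dot E E <= qR (logform v z) E E,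
        forall w, m * dot w w <= hpol (logform v z) (fun E F => dot w E * dot w F) re1 re2 &
        forall e E F, `|e| <= 1 -> `|logform1 z e E F| <= B * `|E| * `|F|]].
Proof.
move=> Aa; have [r r0 hr] := open_norm_ball oA Aa.
pose rho := r / 2; have rho0 : 0 < rho by rewrite divr_gt0.
have rA z : `|z - a| <= rho -> A z by move=> h; apply: hr; apply: le_lt_trans h _; rewrite /rho; lra.
pose K : set V := closed_ball a rho.
have KE z : `|z - a| <= rho -> K z by rewrite /K closed_ballE // /closed_ball_ /= distrC.
have KA : K `<=` A by rewrite /K closed_ballE // => z; rewrite /closed_ball_ /= distrC => /rA.
have cK : compact K by apply: closed_ball_compact.
have [B1 B10 h1] := smooth_bounded_sum (index_enum 'I_(2 + 2))
  (fun k => smooth_dd (delta_mx 0 k) sv) cK KA.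
have [B2 B20 h2] := dd2_bound cK KA.
have [B3 B30 h3] := dd3_bound cK KA.
have gb z E : K z -> `|grad v z E| <= B1 * `|E|.
  move=> Kz; apply: le_trans (linform_bound E (linform_grad sv (KA _ Kz))) _.
  by rewrite ler_wpM2r //; apply: h1.
pose B := B1 + (B2 + B1 ^+ 2) + (B3 + 2 * B2 * B1).
have [b1 b2] : 0 <= B1 ^+ 2 /\ 0 <= 2 * B2 * B1 by rewrite exprn_ge0 // !mulr_ge0.
have B0 : 0 <= B by rewrite /B; lra.
have [BB1 [BB2 BB3]] : B1 <= B /\ B2 + B1 ^+ 2 <= B /\ B3 + 2 * B2 * B1 <= B by rewrite /B; lra.
clearbody B.
have lb z E F : K z -> `|logform v z E F| <= (B2 + B1 ^+ 2) * `|E| * `|F|.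
  move=> Kz; have -> : (B2 + B1 ^+ 2) * `|E| * `|F| = B2 * `|E| * `|F| + (B1 * `|E|) * (B1 * `|F|) by ring.
  by apply: ler_normB2; [exact: h2|apply: ler_normM; exact: gb].
have tr z : K z -> qR (logform v z) re1 re1 + qR (logform v z) re2 re2 <= 4 * B + 1.
  move=> Kz; have n1 := norm_re1; have n2 := norm_re2.
  have bd E : `|E| <= 1 -> logform v z E E <= B.
    move=> hE; apply: le_trans (ler_norm _) (le_trans (lb _ _ _ Kz) _).
    rewrite -[leRHS]mulr1 ler_pM ?mulr_ge0 ?addr_ge0 //.
    by rewrite -[leRHS]mulr1 ler_pM ?addr_ge0.
  have j1 := bd _ (le_trans (norm_J_le re1) n1); have j2 := bd _ (le_trans (norm_J_le re2) n2).
  rewrite /qR; move: (bd _ n1) (bd _ n2) j1 j2.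
  move: (logform v z re1 re1) (logform v z re2 re2) => w1 w2.
  by move: (logform v z (J re1) (J re1)) (logform v z (J re2) (J re2)) => w3 w4 *; lra.
have B410 : 0 < 4 * B + 1 by lra.
exists rho => //; exists B, (L / (4 * B + 1)); split => //.
- by split=> //; rewrite divr_gt0.
- by move=> z /KE Kz E; apply: le_trans (gb _ _ Kz) _; rewrite ler_wpM2r.
- by move=> z /KE Kz E F; apply: le_trans (lb _ _ _ Kz) _; rewrite !ler_wpM2r.
move=> z /KE Kz; have Az := KA _ Kz.
have mL w : L / (4 * B + 1) * dot w w <=
    L / (qR (logform v z) re1 re1 + qR (logform v z) re2 re2) * dot w w.
  apply: ler_wpM2r; first exact: dot_ge0.
  have t0 := logform_trace Az; have t1 := tr z Kz.
  by rewrite ler_pM2l // lef_pV2.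
split=> [E|w|e E F he].
- exact: le_trans (mL E) (pos_coercive E Az).
- apply: le_trans (mL w) _; rewrite -{1}(pde Az).
  by apply: hpol_sqr_coercive; [exact: (symform_logform oA sv Az)|exact: pos|rewrite pde].
apply: (@le_trans _ _ ((B3 + 2 * B2 * B1) * `|E| * `|F|)); last by rewrite !ler_wpM2r.
have -> : (B3 + 2 * B2 * B1) * `|E| * `|F| =
  B3 * 1 * `|E| * `|F| + ((B2 * 1 * `|E|) * (B1 * `|F|) + (B2 * 1 * `|F|) * (B1 * `|E|)) by ring.
apply: ler_normB2.
  by apply: le_trans (h3 _ Kz _ _ _) _; rewrite !ler_wpM2r // ler_wpM2l.
have hb G : `|hess v z e G| <= B2 * 1 * `|G|.
  by apply: le_trans (h2 _ Kz _ _) _; rewrite ler_wpM2r // ler_wpM2l.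
by apply: ler_normD2; [exact: ler_normM (hb E) (gb z F Kz)|exact: ler_normM (hb F) (gb z E Kz)].
Qed.

End InteriorEstimates.

(** * Touching the two-point mean of a solution *)

Section Touching.
Context {R : realType}.
Notation V := (C2 R).
Implicit Types (E F G x y z a b c : V).
Context (A : set V) (v : V -> R) (L : R).
Hypothesis oA : open A.
Hypothesis sv : smooth A v.
Hypothesis L0 : 0 < L.
Hypothesis pde : forall x, A x -> hdet (logform v x) re1 re2 = L.
Hypothesis pos : forall x, A x -> 0 < qR (logform v x) re1 re1.

Lemma line_in (U : set V) x E : open U -> U x ->
  exists2 e : R, 0 < e & forall t : R, `|t| < e -> U (x + t *: E).
Proof.
move=> oU Ux; have [r r0 hr] := open_norm_ball oU Ux.
have N0 : 0 < `|E| + 1 by rewrite ltr_wpDl.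
exists (r / (`|E| + 1)); first by rewrite divr_gt0.
move=> t ht; apply: hr; rewrite addrAC subrr add0r normrZ.
apply: le_lt_trans (_ : `|t| * (`|E| + 1) < r); last by rewrite -ltr_pdivlMr.
by rewrite ler_wpM2l // lerDl.
Qed.

(** At a maximum of phi (mid-point) minus the mean of v at two points, first
    variations identify the three gradients and second variations bound the Hessian
    of phi by the mean of the Hessians of v under every pair of displacements. The
    determinant of such a mean is at most L. *)
Lemma touch_midpoint (U : set V) (phi : V -> R) x y m (r : R) : open U -> smooth U phi ->
  A x -> A y -> m = 2^-1 *: (x + y) -> U m -> 0 < r ->
  (forall a b, `|a| < r -> `|b| < r ->
    phi (m + 2^-1 *: (a + b)) - (v (x + a) + v (y + b)) / 2 <= phi m - (v x + v y) / 2) ->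
  (forall E, E != 0 -> 0 < qR (logform phi m) E E) -> hdet (logform phi m) re1 re2 <= L.
Proof.
move=> oU sphi Ax Ay mE Um r0 hmax posn.
have second a b : dd (2^-1 *: (a + b)) phi m = (dd a v x + dd b v y) / 2 /\
    hess phi m (2^-1 *: (a + b)) (2^-1 *: (a + b)) <= (hess v x a a + hess v y b b) / 2.
  pose c := 2^-1 *: (a + b).
  have [e1 e10 h1] := line_in c oU Um.
  have [e2 e20 h2] := line_in a oA Ax.
  have [e3 e30 h3] := line_in b oA Ay.
  have [e4 e40 h4] : exists2 e : R, 0 < e & forall t : R, `|t| < e -> `|t *: a| < r /\ `|t *: b| < r.
    have N0 : 0 < `|a| + `|b| + 1 by rewrite ltr_wpDl // addr_ge0.
    exists (r / (`|a| + `|b| + 1)); first by rewrite divr_gt0.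
    move=> t; rewrite ltr_pdivlMr // => ht; rewrite !normrZ.
    have [ta tb] : 0 <= `|t| * `|a| /\ 0 <= `|t| * `|b| by rewrite !mulr_ge0.
    have t0 := normr_ge0 t.
    by move: ht; rewrite !mulrDr mulr1; split; lra.
  pose e := Num.min (Num.min e1 e2) (Num.min e3 e4).
  have e0 : 0 < e by rewrite !lt_min e10 e20 e30 e40.
  have es (t : R) : `|t| < e -> [/\ `|t| < e1, `|t| < e2, `|t| < e3 & `|t| < e4].
    by rewrite !lt_min => /andP[/andP[-> ->] /andP[-> ->]].
  pose g (s : R) := phi (m + s *: c) - 2^-1 * (v (x + s *: a) + v (y + s *: b)).
  pose g1 (s : R) := dd c phi (m + s *: c) - 2^-1 * (dd a v (x + s *: a) + dd b v (y + s *: b)).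
  have dg (t : R) : `|t| < e -> is_derive t 1 g (g1 t).
    move=> /es[/h1 t1 /h2 t2 /h3 t3 _]; apply: isd_sub; first exact: is_derive_line (smooth_diff sphi t1).
    apply: isd_scale; apply: isd_add; first exact: is_derive_line (smooth_diff sv t2).
    exact: is_derive_line (smooth_diff sv t3).
  have z0 : `|0 : R| < e by rewrite normr0.
  have dg1 : is_derive (0 : R) 1 g1
     (dd c (dd c phi) (m + 0 *: c) - 2^-1 * (dd a (dd a v) (x + 0 *: a) + dd b (dd b v) (y + 0 *: b))).
    have [/h1 t1 /h2 t2 /h3 t3 _] := es _ z0.
    apply: isd_sub; first exact: is_derive_line (smooth_diff (smooth_dd c sphi) t1).
    apply: isd_scale; apply: isd_add; first exact: is_derive_line (smooth_diff (smooth_dd a sv) t2).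
    exact: is_derive_line (smooth_diff (smooth_dd b sv) t3).
  have gm (t : R) : `|t| < e -> g t <= g 0.
    move=> /es[_ _ _ /h4[ta tb]]; have := hmax _ _ ta tb.
    have -> : 2^-1 *: (t *: a + t *: b) = t *: c by rewrite -scalerDr !scalerA mulrC.
    by rewrite /g !scale0r !addr0 ![2^-1 * _]mulrC.
  have [q1 q2] := max_second_derivative e0 dg dg1 gm.
  move: q1 q2; rewrite /g1 !scale0r !addr0 => q1 q2; split.
    by apply/eqP; rewrite -subr_eq0 mulrC q1.
  by rewrite mulrC -subr_le0.
have dphi := smooth_diff sphi Um.
have gx a : dd a v x = dd a phi m.
  have [h _] := second a 0; move: h; rewrite addr0 dd0 addr0 (ddZ _ _ dphi) => h.
  apply: (@mulfI _ 2^-1); first by rewrite invr_neq0 // pnatr_eq0.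
  by rewrite h mulrC.
have gy a : dd a v y = dd a phi m.
  have [h _] := second 0 a; move: h; rewrite add0r dd0 add0r (ddZ _ _ dphi) => h.
  apply: (@mulfI _ 2^-1); first by rewrite invr_neq0 // pnatr_eq0.
  by rewrite h mulrC.
have lx : (fun E F => hess v x E F - grad phi m E * grad phi m F) = logform v x.
  by apply/funext => E; apply/funext => F; rewrite /logform /grad !gx.
have ly : (fun E F => hess v y E F - grad phi m E * grad phi m F) = logform v y.
  by apply/funext => E; apply/funext => F; rewrite /logform /grad !gy.
apply: (@harmonic_mean_det _ (hess v x) (hess v y) (hess phi m) (grad phi m) L).
- exact: symform_hess oA sv Ax.
- exact: symform_hess oA sv Ay.
- exact: symform_hess oU sphi Um.
- exact: linform_grad sphi Um.
- by move=> a b; case: (second a b).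
- by rewrite lx => E; apply: (logform_pos oA sv L0 pde pos Ax).
- by rewrite ly => E; apply: (logform_pos oA sv L0 pde pos Ay).
- exact: posn.
- by rewrite lx pde.
- by rewrite ly pde.
Qed.

(** Adding a small multiple of a steep Gaussian to v makes the determinant
    exceed L away from the centre: the square of the gradient of the exponent
    dominates, with the weight given by the coercivity of the polarized determinant. *)
Lemma gauss_strict a (rho B m r0 : R) y :
  (forall z, `|z - a| <= rho -> A z) -> 0 <= B -> 0 < m ->
  (forall z, `|z - a| <= rho -> forall E, `|grad v z E| <= B * `|E|) ->
  (forall z, `|z - a| <= rho -> forall E F, `|logform v z E F| <= B * `|E| * `|F|) ->
  (forall z, `|z - a| <= rho -> [/\ forall E, m * dot E E <= qR (logform v z) E E &
     forall w, m * dot w w <= hpol (logform v z) (fun E F => dot w E * dot w F) re1 re2]) ->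
  `|y - a| < rho -> 0 < r0 ->
  exists2 k : R, 0 < k & exists2 e0 : R, 0 < e0 & forall e, 0 < e < e0 ->
  forall x, `|x - a| < rho -> r0 < dot (x - y) (x - y) ->
  let phi := fun z => v z + e * gauss k y z in
  (forall E, E != 0 -> 0 < qR (logform phi x) E E) /\ L < hdet (logform phi x) re1 re2.
Proof.
move=> rA B0 m0 gb lb mb ya r00.
have rho0 : 0 < rho := le_lt_trans (normr_ge0 _) ya.
pose C := 96 * B + 384 * B ^+ 2 * rho.
have rhow := ltW rho0; have nn := @ler0n R; have B2 := exprn_ge0 2 B0.
have C0 : 0 <= C.
  exact: addr_ge0 (mulr_ge0 (nn 96) B0) (mulr_ge0 (mulr_ge0 (nn 384) B2) rhow).
have mr0 : 0 < m * r0 by rewrite mulr_gt0.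
pose k := (2 * C + 1) / (2 * (m * r0)) + 1.
have k1 : 1 <= k.
  rewrite lerDr; apply: divr_ge0; first exact: addr_ge0 (mulr_ge0 (nn 2) C0) ler01.
  exact: mulr_ge0 (nn 2) (ltW mr0).
have k0 : 0 < k by apply: lt_le_trans k1.
have kC : 2 * C + 1 <= 2 * k * (m * r0).
  have -> : 2 * k * (m * r0) = 2 * C + 1 + 2 * (m * r0) by rewrite /k; field; rewrite !lt0r_neq0.
  by rewrite lerDl (mulr_ge0 (nn 2) (ltW mr0)).
pose Y0 := 256 * k ^+ 2 * rho ^+ 2 + 8 * k + 32 * k * B * rho.
have kw := ltW k0; have k2 := exprn_ge0 2 kw.
have Y00 : 0 <= Y0.
  exact: addr_ge0 (addr_ge0 (mulr_ge0 (mulr_ge0 (nn 256) k2) (exprn_ge0 2 rhow)) (mulr_ge0 (nn 8) kw))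
    (mulr_ge0 (mulr_ge0 (mulr_ge0 (nn 32) kw) B0) rhow).
clearbody k.
pose N := 2 + 12 * Y0 ^+ 2 + 2 * Y0 / m.
have N1 : 0 <= 12 * Y0 ^+ 2 := mulr_ge0 (nn 12) (exprn_ge0 2 Y00).
have N2 : 0 <= 2 * Y0 / m by rewrite divr_ge0 ?(mulr_ge0 (nn 2) Y00) // ltW.
have N0 : 0 < N by rewrite /N; lra.
exists k => //; exists N^-1; rewrite ?invr_gt0 // => e /andP[e0 eN] x xa dxy phi.
have Ax : A x by apply: rA; exact: ltW.
have xa' := ltW xa.
pose g := gauss k y x; pose d := x - y.
have g0 : 0 < g by exact: gauss_gt0.
have g1 : g <= 1 by apply: gauss_le1; exact: ltW.
pose s := e * g; have s0 : 0 < s by rewrite mulr_gt0.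
have sN : s * N < 1.
  apply: le_lt_trans (_ : e * N < 1); last by rewrite -ltr_pdivlMr // div1r.
  by rewrite ler_pM2r // -[leRHS]mulr1 ler_wpM2l // ltW.
have [s1 [s2 s3]] : s <= 2^-1 /\ s * (12 * Y0 ^+ 2) < 1 /\ s * (2 * Y0 / m) < 1.
  have h1 := mulr_ge0 (ltW s0) N1; have h2 := mulr_ge0 (ltW s0) N2.
  move: sN h1 h2; rewrite /N !mulrDr.
  by move: (s * (12 * _)) (s * (2 * Y0 / m)) => *; split; [|split]; lra.
have nd : `|d| <= 2 * rho.
  by rewrite /d; apply: le_trans (ler_distD a _ _) _; rewrite (distrC a) mulr2n mulrDl mul1r lerD // ltW.
have dE E : `|dot d E| <= 8 * rho * `|E|.
  apply: le_trans (dot_le_norm _ _) _.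
  have -> : 8 * rho * `|E| = 4 * (2 * rho * `|E|) by ring.
  by rewrite ler_wpM2l // ler_wpM2r.
have sMx := symform_logform oA sv Ax; have lp := linform_grad sv Ax.
have ld : linform (dot d) by split=> *; rewrite ?dotDr ?dotZr.
pose M := logform v x; pose p := grad v x.
pose Z := fun E F => dot d E * dot d F.
pose P := fun E F => p E * dot d F + p F * dot d E.
pose Y := fun E F => 4 * k ^+ 2 * (1 - s) * Z E F + 1 * (2 * k * P E F + - (2 * k) * dot E F).
have sphi : smooth A phi.
  by apply: smooth_add => //; apply: smooth_scale => //; apply: smooth_gauss.
have logE : logform phi x = fun E F => 1 * M E F + s * Y E F.
  apply/funext => E; apply/funext => F.
  have dphi z G : A z -> dd G phi z = dd G v z + e * dd G (gauss k y) z.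
    move=> Az; rewrite dd_add; last by apply: (smooth_diff (smooth_scale e oA (smooth_gauss k y oA)) Az).
      by rewrite (dd_scale _ _ (gauss_diff k y z).1).
    exact: smooth_diff sv Az.
  have hphi : hess phi x E F = hess v x E F + e * hess (gauss k y) x E F.
    rewrite /hess (dd_congr E oA (fun z Az => dphi z F Az) Ax).
    have sg := smooth_dd F (smooth_gauss k y oA).
    rewrite dd_add; last by apply: (smooth_diff (smooth_scale e oA sg) Ax).
      by rewrite (dd_scale _ _ (smooth_diff sg Ax)).
    exact: smooth_diff (smooth_dd F sv) Ax.
  rewrite /logform hphi hess_gauss /grad !dphi // !(gauss_diff k y x).2 -/g -/d.
  rewrite /Y /Z /P /M /logform /p /grad /s.
  by move: (hess v x E F) (dd E v x) (dd F v x) (dot d E) (dot d F) (dot E F) => *; ring.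
have [coerc polc] := mb x xa'.
have Zb E F : `|Z E F| <= 64 * rho ^+ 2 * `|E| * `|F|.
  have -> : 64 * rho ^+ 2 * `|E| * `|F| = (8 * rho * `|E|) * (8 * rho * `|F|) by ring.
  by apply: ler_normM.
have Pb E F : `|P E F| <= 16 * B * rho * `|E| * `|F|.
  have -> : 16 * B * rho * `|E| * `|F| = (B * `|E|) * (8 * rho * `|F|) + (B * `|F|) * (8 * rho * `|E|) by ring.
  by apply: ler_normD2; apply: ler_normM => //; exact: gb.
have db E F : `|dot E F| <= 4 * `|E| * `|F| by rewrite -mulrA; exact: dot_le_norm.
have Yb E F : `|Y E F| <= Y0 * `|E| * `|F|.
  have -> : Y0 * `|E| * `|F| = 4 * k ^+ 2 * 1 * (64 * rho ^+ 2 * `|E| * `|F|) +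
    (2 * k * (16 * B * rho * `|E| * `|F|) + 2 * k * (4 * `|E| * `|F|)) by rewrite /Y0; ring.
  have k20 : 0 <= 2 * k := mulr_ge0 (nn 2) kw.
  have nk : `|2 * k| <= 2 * k by rewrite ger0_norm.
  apply: ler_normD2; last by rewrite mul1r mulNr; apply: ler_normB2; apply: ler_normM.
  apply: ler_normM => //; apply: ler_normM; first by rewrite ger0_norm // (mulr_ge0 (nn 4) k2).
  by clear -s1 s0; rewrite ger0_norm; lra.
have hY : hpol M Y re1 re2 = 4 * k ^+ 2 * (1 - s) * hpol M Z re1 re2 +
    (2 * k * hpol M P re1 re2 - 2 * k * hpol M (@dot R) re1 re2).
  by rewrite !hpol_lin mul1r mulNr.
have h1 := hpol_bound B0 (_ : 0 <= 16 * B * rho) (lb x xa') Pb.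
have h2 := hpol_bound B0 (ler0n R 4) (lb x xa') db.
have h3 := polc d.
have h4 : m * r0 <= hpol M Z re1 re2.
  by apply: le_trans h3; rewrite ler_wpM2l ?(ltW m0) // ltW.
have Br : 0 <= 16 * B * rho := mulr_ge0 (mulr_ge0 (nn 16) B0) rhow.
have hY1 : 1 <= hpol M Y re1 re2.
  rewrite hY; move: (h1 Br) h2; rewrite !ler_norml -/M => /andP[h1' _] /andP[_ h2'].
  have h5 : 2 * k ^+ 2 * (m * r0) <= 4 * k ^+ 2 * (1 - s) * hpol M Z re1 re2.
    have -> : 2 * k ^+ 2 * (m * r0) = 4 * k ^+ 2 * 2^-1 * (m * r0) by field.
    have kk : 0 <= 4 * k ^+ 2 := mulr_ge0 (nn 4) k2.
    apply: ler_pM => //; first by rewrite mulr_ge0.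
      exact: ltW.
    by rewrite ler_wpM2l //; lra.
  have h6 : 2 * k * - (24 * B * (16 * B * rho)) <= 2 * k * hpol M P re1 re2.
    by rewrite ler_wpM2l // (mulr_ge0 (nn 2) kw).
  have h7 : 2 * k * hpol M (@dot R) re1 re2 <= 2 * k * (24 * B * 4).
    by rewrite ler_wpM2l // (mulr_ge0 (nn 2) kw).
  have h8 : k * (2 * C + 1) <= k * (2 * k * (m * r0)) by rewrite ler_wpM2l // ltW.
  move: h5 h6 h7 h8; rewrite /C.
  by move: (hpol M P _ _) (hpol M (@dot R) _ _) (4 * k ^+ 2 * _ * _) => *; lra.
have sZ : symform Z by apply: symform_sqr.
have sP : symform P.
  have := symform_prod lp ld; congr symform; apply/funext => E; apply/funext => F.
  by rewrite /P /p; ring.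
have sY : symform Y.
  exact: (symform_lin _ 1 sZ (symform_lin _ _ sP (@symform_dot R))).
have hdY : `|hdet Y re1 re2| <= 12 * Y0 ^+ 2.
  have := hpol_bound Y00 Y00 Yb Yb; rewrite -hdet_hpol normrM (ger0_norm (ler0n _ 2)) => h.
  by rewrite -(ler_pM2l (ltr0n R 2)); apply: le_trans h _; rewrite le_eqVlt; apply/orP; left; apply/eqP; ring.
have detE : hdet (logform phi x) re1 re2 = L + s * hpol M Y re1 re2 + s ^+ 2 * hdet Y re1 re2.
  by rewrite logE hdet_lin -(pde Ax).
have detL : L < hdet (logform phi x) re1 re2.
  rewrite detE -addrA ltrDl expr2 -mulrA -mulrDr mulr_gt0 //.
  move: hdY; rewrite ler_norml => /andP[hdY _].
  have := ler_wpM2l (ltW s0) hdY; move: hY1 s2.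
  by rewrite mulrN; move: (hpol M Y _ _) (s * hdet _ _ _) (s * (12 * _)) => *; lra.
have p1 : 0 < qR (logform phi x) re1 re1.
  have c1 := coerc re1; have n1 := @norm_re1 R.
  have nJ1 := le_trans (norm_J_le re1) n1.
  have yb E : `|E| <= 1 -> - Y0 <= Y E E.
    move=> hE; have := le_trans (Yb E E) (_ : _ <= Y0); rewrite ler_norml => h.
    have h' : Y0 * `|E| * `|E| <= Y0.
      by rewrite -[leRHS]mulr1 ler_pM ?mulr_ge0 // -[leRHS]mulr1 ler_wpM2l.
    by case/andP: (h h').
  have y1 := yb _ n1; have y2 := yb _ nJ1.
  have d11 : dot re1 re1 = 1 :> R by rewrite /re1 dot_split !mxE !eq_shift /=; ring.
  rewrite d11 mulr1 in c1.
  have -> : qR (logform phi x) re1 re1 = qR M re1 re1 + s * (Y re1 re1 + Y (J re1) (J re1)).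
    by rewrite logE qR_lin mul1r.
  have h5 : s * (2 * Y0) < m by move: s3; rewrite mulrA ltr_pdivrMr // mul1r.
  have h6 : s * (- (2 * Y0)) <= s * (Y re1 re1 + Y (J re1) (J re1)).
    by rewrite ler_wpM2l ?(ltW s0) //; move: (Y _ _) (Y _ _) y1 y2 => *; lra.
  move: c1 h6; rewrite mulrN -/M.
  by move: (qR M _ _) (s * (_ + _)) => *; lra.
split; last exact: detL.
move=> E E0; exact: (qR_pos (symform_logform oA sphi Ax) p1 (lt_trans L0 detL) E0).
Qed.

(** The touching function v plus a multiple of the Gaussian is a strict
    subsolution, while moving the two points x + h and x - h independently shows
    that it is a subsolution at most. *)
Lemma no_touching_midpoint a : A a -> exists2 rho : R, 0 < rho &
  (forall z, `|z - a| <= rho -> A z) /\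
  forall mu y r0 r1, `|y - a| < rho -> 0 < r0 ->
  no_touching (fun z h => A (z + h) /\ A (z - h))
    (fun z h => v z - (v (z + h) + v (z - h)) / 2) mu y r0 r1 a rho.
Proof.
move=> Aa; have [rho rho0 [B [m [rA [B0 m0] gb lb mb]]]] := local_bounds oA sv L0 pde pos Aa.
exists rho => //; split=> // mu y r0 r1 ya r00.
have mb' z : `|z - a| <= rho -> (forall E, m * dot E E <= qR (logform v z) E E) /\
   forall w, m * dot w w <= hpol (logform v z) (fun E F => dot w E * dot w F) re1 re2.
  by move=> /mb[].
have [k k0 [e0 e00 strict]] := gauss_strict rA B0 m0 gb lb mb' ya r00.
exists k => //; exists e0 => // e ee x h xa /andP[xy _] [Dx1 Dx2] _ /nbhs_ballP[r /= r_gt0 hr].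
have [posn detL] := strict e ee x xa xy.
have Ax : A x by apply: rA; exact: ltW.
have [r2 r20 h2] := open_norm_ball oA Dx1; have [r3 r30 h3] := open_norm_ball oA Dx2.
move: detL; apply/negP; rewrite -leNgt.
apply: (@touch_midpoint A _ (x + h) (x - h) x (Num.min r (Num.min r2 r3))) => //.
- apply: smooth_add => //; apply: smooth_scale => //; exact: smooth_gauss.
- by rewrite midpointK.
- by rewrite !lt_min r_gt0 r20.
move=> b c; rewrite !lt_min => /andP[b1 /andP[b2 b3]] /andP[c1 /andP[c2 c3]].
have n12 w w' (s : R) : `|w| < s -> `|w'| < s -> `|2^-1 *: (w + w')| < s.
  move=> hw hw'; rewrite normrZ ger0_norm ?invr_ge0 // mulrC ltr_pdivrMr //.
  by apply: le_lt_trans (ler_normD _ _) _; rewrite mulrDr mulr1 ltrD.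
have zb : ball x r (x + 2^-1 *: (b + c)).
  by rewrite -ball_normE /= opprD addNKr normrN n12.
have e1 : x + 2^-1 *: (b + c) + (h + 2^-1 *: (b - c)) = x + h + b.
  by apply/rowP => i; rewrite !mxE; field.
have e2 : x + 2^-1 *: (b + c) - (h + 2^-1 *: (b - c)) = x - h + c.
  by apply/rowP => i; rewrite !mxE; field.
have := hr _ zb (h + 2^-1 *: (b - c)); rewrite e1 e2 => H.
have /H : A (x + h + b) /\ A (x - h + c).
  by split; [apply: h2; rewrite addrAC subrr add0r|apply: h3; rewrite addrAC subrr add0r].
move: (v (x + 2^-1 *: (b + c))) (e * _) (v (x + h + b)) (v (x - h + c)) (v x) => t1 t2 t3 t4 t5.
by move: (v (x + h)) (v (x - h)) (e * _) => t6 t7 t8; lra.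
Qed.

End Touching.

(** * Touching the least eigenvalue of the Hessian *)

Section HessianTouching.
Context {R : realType}.
Notation V := (C2 R).
Implicit Types (E F G x y z a b c : V).

Lemma symform_expand (Q : V -> V -> R) E F (s : R) : symform Q ->
  Q (E + s *: F) (E + s *: F) = Q E E + 2 * s * Q E F + s * s * Q F F.
Proof.
move=> h; rewrite (symDl _ _ _ h) !(symDr _ _ _ h) !(symZl _ _ _ h) !(symZr _ _ _ h) (symC F E h).
by move: (Q E E) (Q E F) (Q F F) => *; ring.
Qed.

Lemma isd_zero (f : R -> R) (l e t : R) : (forall s : R, `|s| < e -> f s = l) -> `|t| < e ->
  is_derive t 1 f 0.
Proof.
move=> fl te; apply: (@near_eq_is_derive R R R (fun=> l) f t 1 0 _ (isd_cst l t)).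
have d0 : 0 < e - `|t| by rewrite subr_gt0.
apply/nbhs_ballP; exists (e - `|t|) => //= s; rewrite /ball /= => hs.
rewrite fl // -[s](subKr t); apply: le_lt_trans (ler_normB _ _) _.
by rewrite -ltrBrDl.
Qed.

Lemma det_constant_derivatives (Q Q1 : R -> V -> V -> R) (Q2 : V -> V -> R) E F (L e : R) :
  0 < e -> (forall t : R, `|t| < e -> forall E F, is_derive t 1 (fun s => Q s E F) (Q1 t E F)) ->
  (forall E F, is_derive (0 : R) 1 (fun s => Q1 s E F) (Q2 E F)) ->
  (forall t : R, `|t| < e -> hdet (Q t) E F = L) ->
  hpol (Q 0) (Q1 0) E F = 0 /\ hpol (Q 0) Q2 E F + 2 * hdet (Q1 0) E F = 0.
Proof.
move=> e0 d1 d2 QL; have z0 : `|0 : R| < e by rewrite normr0.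
have dR (t : R) : `|t| < e -> forall E F, is_derive t 1 (fun s => qR (Q s) E F) (qR (Q1 t) E F).
  by move=> te E' F'; apply: isd_add; apply: d1.
have dI (t : R) : `|t| < e -> forall E F, is_derive t 1 (fun s => qI (Q s) E F) (qI (Q1 t) E F).
  by move=> te E' F'; apply: isd_sub; apply: d1.
have dR1 E' F' : is_derive (0 : R) 1 (fun s => qR (Q1 s) E' F') (qR Q2 E' F').
  by apply: isd_add; apply: d2.
have dI1 E' F' : is_derive (0 : R) 1 (fun s => qI (Q1 s) E' F') (qI Q2 E' F').
  by apply: isd_sub; apply: d2.
have first (t : R) : `|t| < e -> hpol (Q t) (Q1 t) E F = 0.
  move=> te; apply: isd_unique (isd_zero QL te).
  apply: isd_eq (isd_sub (isd_sub (isd_mul (dR t te E E) (dR t te F F))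
     (isd_mul (dR t te E F) (dR t te E F))) (isd_mul (dI t te E F) (dI t te E F))) _.
  rewrite /hpol; move: (qR (Q t) _ _) (qR (Q t) _ _) (qR (Q t) _ _) (qI (Q t) _ _) => *.
  by move: (qR (Q1 t) _ _) (qR (Q1 t) _ _) (qR (Q1 t) _ _) (qI (Q1 t) _ _) => *; ring.
split; first exact: first.
apply: isd_unique (isd_zero first z0).
have h := isd_sub (isd_add (isd_mul (dR 0 z0 E E) (dR1 F F)) (isd_mul (dR 0 z0 F F) (dR1 E E)))
  (isd_scale 2 (isd_add (isd_mul (dR 0 z0 E F) (dR1 E F)) (isd_mul (dI 0 z0 E F) (dI1 E F)))).
apply: isd_eq h _; rewrite /hpol /hdet.
move: (qR (Q 0) _ _) (qR (Q 0) _ _) (qR (Q 0) _ _) (qI (Q 0) _ _) => *.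
move: (qR (Q1 0) _ _) (qR (Q1 0) _ _) (qR (Q1 0) _ _) (qI (Q1 0) _ _) => *.
by move: (qR Q2 _ _) (qR Q2 _ _) (qR Q2 _ _) (qI Q2 _ _) => *; ring.
Qed.

Lemma quadratic_ge0_linear0 (b q : R) : 0 <= q -> (forall s : R, 0 <= 2 * s * b + s ^+ 2 * q) -> b = 0.
Proof.
move=> q0 h; apply/eqP; rewrite -sqrf_eq0 eq_le sqr_ge0 andbT leNgt; apply/negP => b0.
have := h (- b / (q + 1)).
have q1 : 0 < q + 1 by rewrite ltr_wpDl.
have -> : 2 * (- b / (q + 1)) * b + (- b / (q + 1)) ^+ 2 * q = - (b ^+ 2 * (q + 2) / (q + 1) ^+ 2).
  by field; exact: lt0r_neq0.
rewrite oppr_ge0 leNgt divr_gt0 ?exprn_gt0 // mulr_gt0 // ltr_wpDl //.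
Qed.

(** The direction e + s c moves together with the point x + s zeta: f0, f1 and f2
    are the coefficients of the second derivative of v in that direction, and
    1 + 2 s p + s^2 q is the square of its length. *)
Lemma line_second_variation (A : set V) (xi f0 f1 f2 : V -> R) x zeta (p q e : R) :
  open A -> A x -> smooth A xi -> smooth A f0 -> smooth A f1 -> smooth A f2 -> 0 < e ->
  (forall t : R, `|t| < e -> A (x + t *: zeta)) -> f0 x = xi x ->
  (forall s : R, `|s| < e -> xi (x + s *: zeta) * (1 + 2 * s * p + s * s * q) <=
     f0 (x + s *: zeta) + 2 * s * f1 (x + s *: zeta) + s * s * f2 (x + s *: zeta)) ->
  dd zeta f0 x + 2 * f1 x = dd zeta xi x + 2 * xi x * p /\
  0 <= dd zeta (dd zeta f0) x + 4 * dd zeta f1 x + 2 * f2 x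
    - dd zeta (dd zeta xi) x - 4 * (dd zeta xi x * p) - 2 * (xi x * q).
Proof.
move=> oA Ax sxi s0 s1 s2 e0 inA f0x hle.
pose l (s : R) := x + s *: zeta.
have D f (t : R) : smooth A f -> `|t| < e -> is_derive t 1 (fun s => f (l s)) (dd zeta f (l t)).
  by move=> sf te; exact: is_derive_line (smooth_diff sf (inA t te)).
have l0 : l 0 = x by rewrite /l scale0r addr0.
pose qq (s : R) := 1 + (s * (2 * p) + s * s * q).
pose q1 (s : R) := 2 * p + 2 * (s * q).
have dq (t : R) : is_derive t 1 qq (q1 t).
  have := isd_add (isd_cst 1 t) (isd_add (isd_mul (isd_id t) (isd_cst (2 * p) t))
    (isd_mul (isd_mul (isd_id t) (isd_id t)) (isd_cst q t))).
  by move=> h; apply: isd_eq h _; rewrite /q1; ring.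
have dq1 (t : R) : is_derive t 1 q1 (2 * q).
  have := isd_add (isd_cst (2 * p) t) (isd_scale 2 (isd_mul (isd_id t) (isd_cst q t))).
  by move=> h; apply: isd_eq h _; ring.
pose g (s : R) := xi (l s) * qq s - (f0 (l s) + 2 * (s * f1 (l s)) + s * s * f2 (l s)).
pose g1 (s : R) := (xi (l s) * q1 s + qq s * dd zeta xi (l s)) -
  (dd zeta f0 (l s) + 2 * (s * dd zeta f1 (l s) + f1 (l s) * 1) +
   (s * s * dd zeta f2 (l s) + f2 (l s) * (s * 1 + s * 1))).
have dg (t : R) : `|t| < e -> is_derive t 1 g (g1 t).
  move=> te; exact: (isd_sub (isd_mul (D _ t sxi te) (dq t)) (isd_add (isd_add (D _ t s0 te)
    (isd_scale 2 (isd_mul (isd_id t) (D _ t s1 te))))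
    (isd_mul (isd_mul (isd_id t) (isd_id t)) (D _ t s2 te)))).
have z0 : `|0 : R| < e by rewrite normr0.
have sD f := smooth_dd zeta (f := f).
have idx := isd_id (0 : R).
have dg1 := isd_sub (isd_add (isd_mul (D _ 0 sxi z0) (dq1 0)) (isd_mul (dq 0) (D _ 0 (sD _ _ sxi) z0)))
  (isd_add (isd_add (D _ 0 (sD _ _ s0) z0) (isd_scale 2 (isd_add (isd_mul idx (D _ 0 (sD _ _ s1) z0))
    (isd_mul (D _ 0 s1 z0) (isd_cst 1 0)))))
   (isd_add (isd_mul (isd_mul idx idx) (D _ 0 (sD _ _ s2) z0))
     (isd_mul (D _ 0 s2 z0) (isd_add (isd_mul idx (isd_cst 1 0)) (isd_mul idx (isd_cst 1 0)))))).
have gE (s : R) : g s = xi (l s) * (1 + 2 * s * p + s * s * q) -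
   (f0 (l s) + 2 * s * f1 (l s) + s * s * f2 (l s)).
  by rewrite /g /qq; move: (xi (l s)) (f0 (l s)) (f1 (l s)) (f2 (l s)) => *; ring.
have g0 : g 0 = 0.
  by rewrite gE l0 f0x; move: (xi x) (f1 x) (f2 x) => *; ring.
have gm (t : R) : `|t| < e -> g t <= g 0.
  by move=> te; rewrite g0 gE subr_le0; exact: hle.
have [h1 h2] := max_second_derivative e0 dg dg1 gm.
move: h1 h2; rewrite /g1 /qq /q1 l0.
move: (f0 x) (f1 x) (f2 x) (xi x) (dd zeta xi x) (dd zeta (dd zeta xi) x) (dd zeta f0 x) (dd zeta f1 x) (dd zeta f2 x).
move: (dd zeta (dd zeta f0) x) (dd zeta (dd zeta f1) x) (dd zeta (dd zeta f2) x).
move=> {dg1 dg gE g0 gm hle} t1 t2 t3 t4 t5 t6 t7 t8 t9 t10 t11 t12 h1 h2.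
by split; lra.
Qed.

(** Minimality in c alone makes e an eigenvector. Letting the direction move with
    the point gives the other two conditions, in which third and fourth derivatives
    of v appear. *)
Lemma touch_hessian (A : set V) (v xi : V -> R) x e : open A -> smooth A v -> smooth A xi ->
  A x -> dot e e = 1 -> hess v x e e = xi x ->
  (\forall z \near x, forall c, xi z * dot c c <= hess v z c c) ->
  [/\ forall E, hess v x e E = xi x * dot e E,
      forall E, dd e (dd e (dd E v)) x = dd E xi x &
      forall z c, 0 <= dd e (dd e (dd z (dd z v))) x + 4 * dd e (dd c (dd z v)) x
        + 2 * hess v x c c - hess xi x z z - 4 * (dd z xi x * dot e c) - 2 * (xi x * dot c c)].
Proof.
move=> oA sv sxi Ax e1 exi near_le.
have near0 := nbhs_singleton near_le.
have sh z : A z -> symform (hess v z) := symform_hess oA sv.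
have shx := sh x Ax.
have eig E : hess v x e E = xi x * dot e E.
  apply/eqP; rewrite -subr_eq0; apply/eqP.
  apply: (@quadratic_ge0_linear0 _ (hess v x E E - xi x * dot E E)).
    by rewrite subr_ge0.
  move=> s; have := near0 (e + s *: E).
  rewrite (symform_expand _ _ _ shx) (symform_expand _ _ _ (@symform_dot R)) e1 exi.
  rewrite -subr_ge0; congr (0 <= _).
  by move: (hess v x e E) (hess v x E E) (dot e E) (dot E E) => *; ring.
have second zeta c : dd zeta (dd e (dd e v)) x = dd zeta xi x /\
    0 <= dd zeta (dd zeta (dd e (dd e v))) x + 4 * dd zeta (dd e (dd c v)) x
        + 2 * hess v x c c - hess xi x zeta zeta - 4 * (dd zeta xi x * dot e c) - 2 * (xi x * dot c c).
  have [ea ea0 ha] := line_in zeta oA Ax.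
  move: near_le => /nbhs_ballP[r /= r0 hr].
  have [eb eb0 hb] := line_in zeta (ball_open x r) (ballxx x r0).
  pose ee := Num.min ea eb; have ee0 : 0 < ee by rewrite lt_min ea0.
  have s0 : smooth A (dd e (dd e v)) by do 2!apply: smooth_dd.
  have s1 : smooth A (dd e (dd c v)) by do 2!apply: smooth_dd.
  have s2 : smooth A (dd c (dd c v)) by do 2!apply: smooth_dd.
  have [||| h1 h2] := @line_second_variation A xi _ _ _ x zeta (dot e c) (dot c c) ee oA Ax sxi s0 s1 s2 ee0.
  - by move=> t; rewrite lt_min => /andP[/ha].
  - by rewrite -exi.
  - move=> s; rewrite lt_min => /andP[/ha sA /hb /hr /(_ (e + s *: c))].
    by rewrite (symform_expand _ _ _ (sh _ sA)) (symform_expand _ _ _ (@symform_dot R)) e1.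
  have h3 : dd e (dd c v) x = xi x * dot e c := eig c.
  move: h1 h2; rewrite h3 => h1 h2; split; last exact: h2.
  apply: (addIr (2 * (xi x * dot e c))); rewrite h1; congr (_ + _); ring.
split=> // [E|z c].
  rewrite -(second E 0).1 (dd_comm2 e e E oA sv Ax).
  exact: (dd_comm e E oA (smooth_dd e sv) Ax).
have swap w y : smooth A w -> A y -> dd z (dd e (dd e w)) y = dd e (dd e (dd z w)) y.
  move=> sw Ay; rewrite (dd_comm z e oA (smooth_dd e sw) Ay).
  exact: (dd_comm2 e z e oA sw Ay).
have E1 : dd e (dd e (dd z (dd z v))) x = dd z (dd z (dd e (dd e v))) x.
  rewrite -(swap _ _ (smooth_dd z sv) Ax).
  have C y : A y -> dd e (dd e (dd z v)) y = dd z (dd e (dd e v)) y by move=> /(swap _ _ sv) ->.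
  exact: (dd_congr z oA C Ax).
have E2 : dd e (dd c (dd z v)) x = dd z (dd e (dd c v)) x.
  exact: etrans (dd_comm2 e c z oA sv Ax) (dd_comm e z oA (smooth_dd c sv) Ax).
by rewrite E1 E2; exact: (second z c).2.
Qed.

End HessianTouching.

Section HessianNoTouching.
Context {R : realType}.
Notation V := (C2 R).
Implicit Types (E F G x y z a b c : V).
Context (A : set V) (v : V -> R) (L : R).
Hypothesis oA : open A.
Hypothesis sv : smooth A v.
Hypothesis L0 : 0 < L.
Hypothesis pde : forall x, A x -> hdet (logform v x) re1 re2 = L.
Hypothesis pos : forall x, A x -> 0 < qR (logform v x) re1 re1.

Definition logform2 z e : V -> V -> R := fun E F =>
  dd e (dd e (dd E (dd F v))) z
  - (dd e (dd e (dd E v)) z * grad v z F + dd e (dd e (dd F v)) z * grad v z E)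
  - 2 * (hess v z e E * hess v z e F).

(** logform1 and logform2 are the first two derivatives along e of a form whose
    determinant is constant. *)
Lemma det_derivatives x e : A x ->
  hpol (logform v x) (logform1 v x e) re1 re2 = 0 /\
  hpol (logform v x) (logform2 x e) re1 re2 + 2 * hdet (logform1 v x e) re1 re2 = 0.
Proof.
move=> Ax; have [r r0 hr] := line_in e oA Ax.
have d f (t : R) : smooth A f -> `|t| < r ->
    is_derive t 1 (fun s : R => f (x + s *: e)) (dd e f (x + t *: e)).
  by move=> sf /hr At; exact: is_derive_line (smooth_diff sf At).
have d0 (t : R) : `|t| < r -> forall E F, is_derive t 1
    (fun s : R => logform v (x + s *: e) E F) (logform1 v (x + t *: e) e E F).
  move=> tr E F.
  have h := isd_sub (d _ t (smooth_dd E (smooth_dd F sv)) tr)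
    (isd_mul (d _ t (smooth_dd E sv) tr) (d _ t (smooth_dd F sv) tr)).
  apply: isd_eq h _; rewrite /logform1 /hess /grad.
  by move: (dd e (dd E (dd F v)) _) (dd E v _) (dd F v _) (dd e (dd E v) _) (dd e (dd F v) _) => *; ring.
have z0 : `|0 : R| < r by rewrite normr0.
have d1 E F : is_derive (0 : R) 1 (fun s : R => logform1 v (x + s *: e) e E F)
    (logform2 (x + 0 *: e) e E F).
  have h G := d _ 0 (smooth_dd G sv) z0; have h' G := d _ 0 (smooth_dd e (smooth_dd G sv)) z0.
  have hh := isd_sub (d _ 0 (smooth_dd e (smooth_dd E (smooth_dd F sv))) z0)
    (isd_add (isd_mul (h' E) (h F)) (isd_mul (h' F) (h E))).
  apply: isd_eq hh _; rewrite /logform2 /hess /grad.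
  move: (dd e (dd e (dd E (dd F v))) _) (dd e (dd e (dd E v)) _) (dd e (dd e (dd F v)) _).
  by move: (dd E v _) (dd F v _) (dd e (dd E v) _) (dd e (dd F v) _) => *; ring.
have := det_constant_derivatives r0 d0 d1 (fun t tr => pde (hr t tr)).
by rewrite scale0r addr0.
Qed.

(** If the least eigenvalue of the Hessian were touched from below by a small
    multiple of the Gaussian plus a constant, then the linearized operator applied to the
    Gaussian would be of order k by the constant rank computation, although it is
    of order k^2. *)
Lemma no_touching_hessian a : (forall x e, A x -> 0 <= hess v x e e) -> A a ->
  exists2 rho : R, 0 < rho & (forall z, `|z - a| <= rho -> A z) /\
  forall y r0 r1, `|y - a| < rho -> 0 < r0 ->
  no_touching (fun z e => dot e e = 1) (fun z e => - hess v z e e) 0 y r0 r1 a rho.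
Proof.
move=> conv Aa; have [rho rho0 [B [m [rA [B0 m0] gb lb mb]]]] := local_bounds oA sv L0 pde pos Aa.
exists rho => //; split=> // y r0 r1 ya r00.
have rhow := ltW rho0; have nn := @ler0n R.
pose N := 1 + 4 * B / m.
pose C := `|2 * B * (N ^+ 2 * (4 * B + 64) + 256 * B ^+ 2 * N ^+ 2 / m + 128 * B * N ^+ 2 / m)
    + 2 * B * N ^+ 2 * (64 + 128 * B / m)|.
have C0 : 0 <= C := normr_ge0 _.
have algebra := @constant_rank_algebra R.
have mr0 : 0 < m * r0 by rewrite mulr_gt0.
pose D := 192 * B + C * (1 + 16 * rho).
have r16 : 0 <= 16 * rho := mulr_ge0 (nn 16) rhow.
have D0 : 0 <= D := addr_ge0 (mulr_ge0 (nn 192) B0) (mulr_ge0 C0 (addr_ge0 ler01 r16)).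
pose k := D / (4 * (m * r0)) + 1.
have k1 : 1 <= k.
  by rewrite lerDr; apply: divr_ge0 => //; exact: mulr_ge0 (nn 4) (ltW mr0).
have k0 : 0 < k by apply: lt_le_trans k1.
have kw := ltW k0.
have kD : D < 4 * k * (m * r0).
  have -> : 4 * k * (m * r0) = D + 4 * (m * r0) by rewrite /k; field; rewrite !lt0r_neq0.
  by rewrite ltrDl mulr_gt0.
clearbody k.
pose Q := 1 + 16 * k * rho.
have Q1 : 1 <= Q by rewrite lerDl (mulr_ge0 (mulr_ge0 (nn 16) kw) rhow).
have Q0 : 0 < Q by apply: lt_le_trans Q1.
exists k => //; exists Q^-1; rewrite ?invr_gt0 // => e /andP[e0 eQ] x h xa /andP[xy _] h1 le0 near_le.
have xa' := ltW xa; have Ax := rA x xa'.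
pose g := gauss k y x; have g0 : 0 < g by exact: gauss_gt0.
have g1 : g <= 1 by apply: gauss_le1.
pose M0 := - hess v x h h + e * g.
pose xi := fun z => e * gauss k y z + - M0.
have sxi : smooth A xi.
  apply: smooth_add => //; last exact: smooth_cst.
  by apply: smooth_scale => //; apply: smooth_gauss.
have xix : hess v x h h = xi x by rewrite /xi /M0 -/g; ring.
have dxi z G : dd G xi z = e * dd G (gauss k y) z.
  have dg := (gauss_diff k y z).1.
  rewrite dd_add; last exact: differentiable_cst.
    by rewrite (dd_scale _ _ dg) dd_cst addr0.
  exact: (smooth_diff (smooth_scale e openT (smooth_gauss k y openT)) I).
have hxi E F : hess xi x E F = e * hess (gauss k y) x E F.
  rewrite /hess (dd_congr E openT (fun z _ => dxi z F) I).
  by rewrite (dd_scale _ _ (smooth_diff (smooth_dd F (smooth_gauss k y openT)) I)).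
have near_xi : \forall z \near x, forall c, xi z * dot c c <= hess v z c c.
  have nA : nbhs x A by apply: open_nbhs_nbhs.
  apply: filterS2 near_le nA => z hz Az c.
  have sz := symform_hess oA sv Az.
  have [->|c0] := eqVneq c 0.
    by rewrite -(scale0r (0 : V)) dotZl (symZl _ _ _ sz) !mul0r mulr0.
  have cc := dot_gt0 c0; pose s := (Num.sqrt (dot c c))^-1.
  have ss : s * s * dot c c = 1.
    by rewrite -expr2 exprVn sqr_sqrtr ?mulVf ?lt0r_neq0 // ltW.
  have u1 : dot (s *: c) (s *: c) = 1 by rewrite dotZl dotZr mulrA.
  have := hz _ u1; rewrite (symZl _ _ _ sz) (symZr _ _ _ sz) -/g -/M0 => hh.
  have h2 : xi z <= s * s * hess v z c c.
    by move: hh; rewrite /xi mulrA; move: (s * s * _) (e * _) => *; lra.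
  have := ler_wpM2r (ltW cc) h2.
  have -> : s * s * hess v z c c * dot c c = s * s * dot c c * hess v z c c by ring.
  by rewrite ss mul1r.
have [eig third test] := touch_hessian oA sv sxi Ax h1 xix near_xi.
have s0 : 0 < e * g by rewrite mulr_gt0.
pose delta := Q * (e * g).
have xi0 : 0 <= xi x by rewrite -xix; exact: conv.
have xid : xi x <= delta.
  apply: (@le_trans _ _ (e * g)); last by rewrite /delta -[leLHS]mul1r ler_wpM2r // ltW.
  by move: le0; rewrite /xi /M0 -/g; move: (hess v x h h) (e * g) => *; lra.
have d1 : delta <= 1.
  have h2 : e * g <= e by rewrite -[leRHS]mulr1 ler_wpM2l // ltW.
  have h3 : e * Q <= 1 by apply: ltW; rewrite -ltr_pdivlMr // div1r.
  by apply: le_trans h3; rewrite /delta mulrC ler_wpM2r // ltW.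
have nd : `|x - y| <= 2 * rho.
  by apply: le_trans (ler_distD a _ _) _; rewrite (distrC a) mulr2n mulrDl mul1r lerD // ltW.
have db E : `|grad xi x E| <= delta * `|E|.
  rewrite /grad dxi (gauss_diff k y x).2 -/g.
  have -> : e * (- 2 * k * dot (x - y) E * g) = - (2 * k * (e * g) * dot (x - y) E) by ring.
  have c0 : 0 <= 2 * k * (e * g) := mulr_ge0 (mulr_ge0 (nn 2) kw) (ltW s0).
  rewrite normrN normrM (ger0_norm c0).
  apply: (@le_trans _ _ (2 * k * (e * g) * (4 * (2 * rho * `|E|)))).
    apply: ler_wpM2l => //; apply: le_trans (dot_le_norm _ _) _.
    by rewrite ler_wpM2l // ler_wpM2r.
  have -> : 2 * k * (e * g) * (4 * (2 * rho * `|E|)) = 16 * k * rho * (e * g) * `|E| by ring.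
  by rewrite ler_wpM2r // /delta ler_wpM2r ?(ltW s0) // /Q lerDr.
have [coerc polc M1b] := mb x xa'.
have nh : `|h| <= 1 by apply: norm_unit.
have [det1 det2] := det_derivatives h Ax.
have := algebra (hess v x) (fun E F => dd h (dd E (dd F v)) x)
  (fun E F => dd h (dd h (dd E (dd F v))) x) (hess xi x) (grad v x) (grad xi x) h (xi x) delta B m N
  (symform_hess oA sv Ax) (symform_dd_hess h oA sv Ax) (symform_dd2_hess h oA sv Ax)
  (symform_hess oA sxi Ax) (linform_grad sv Ax) (linform_grad sxi Ax) h1 eig third.
rewrite xi0 xid => /(_ isT d1 db test det1 det2 m0 coerc B0 (gb x xa') (lb x xa')).
move=> /(_ (fun E F => M1b h E F nh) erefl) bound.
have upper : hpol (logform v x) (hess xi x) re1 re2 <= C * delta.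
  apply: le_trans bound _; rewrite ler_wpM2r ?ler_norm //.
  by rewrite /delta mulr_ge0 // ltW.
have hE : hess xi x = fun E F => (e * g * (4 * k ^+ 2)) * (dot (x - y) E * dot (x - y) F) +
    (- (e * g * (2 * k))) * dot E F.
  apply/funext => E; apply/funext => F; rewrite hxi hess_gauss -/g.
  by move: (dot _ E) (dot _ F) (dot E F) => *; ring.
move: upper; rewrite hE hpol_lin.
have h2 := hpol_bound B0 (ler0n R 4) (lb x xa') (_ : forall E F, `|dot E F| <= 4 * `|E| * `|F|).
have {}h2 : hpol (logform v x) (@dot R) re1 re2 <= 96 * B.
  apply: le_trans (ler_norm _) _; apply: le_trans (h2 _) _.
    by move=> E F; rewrite -mulrA; exact: dot_le_norm.
  by rewrite le_eqVlt; apply/orP; left; apply/eqP; ring.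
have h3 : m * r0 <= hpol (logform v x) (fun E F => dot (x - y) E * dot (x - y) F) re1 re2.
  by apply: le_trans (polc (x - y)); rewrite ler_wpM2l ?(ltW m0) // ltW.
move: h2 h3; move: (hpol _ _ _ _) (hpol _ _ _ _) => hz hd h2 h3; apply/negP; rewrite -ltNge.
have -> : C * delta = e * g * (C * Q) by rewrite /delta; ring.
have -> : e * g * (4 * k ^+ 2) * hz + - (e * g * (2 * k)) * hd = e * g * (4 * k ^+ 2 * hz - 2 * k * hd) by ring.
rewrite ltr_pM2l //.
have h4 : 4 * k ^+ 2 * (m * r0) <= 4 * k ^+ 2 * hz.
  by rewrite ler_wpM2l // (mulr_ge0 (nn 4) (exprn_ge0 2 kw)).
have h5 : 2 * k * hd <= 2 * k * (96 * B) by rewrite ler_wpM2l // (mulr_ge0 (nn 2) kw).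
have h6 : k * D < k * (4 * k * (m * r0)) by rewrite ltr_pM2l.
have h7 : C * Q <= k * (C * (1 + 16 * rho)).
  have -> : k * (C * (1 + 16 * rho)) = C * (k + 16 * k * rho) by ring.
  by rewrite ler_wpM2l // /Q lerD2r.
move: h4 h5 h6 h7; rewrite /D; clear -k.
move: (m * r0) (C * Q) => mr CQ h4 h5 h6 h7.
by lra.
Qed.

End HessianNoTouching.

(** * Strict convexity of exhausting solutions *)

Section ExhaustingSolution.
Context {R : realType}.
Notation V := (C2 R).
Implicit Types (E F G x y z a b c : V).
Context (A : set V) (v : V -> R) (L : R).
Hypothesis oA : open A.
Hypothesis sv : smooth A v.
Hypothesis L0 : 0 < L.
Hypothesis pde : forall x, A x -> hdet (logform v x) re1 re2 = L.
Hypothesis pos : forall x, A x -> 0 < qR (logform v x) re1 re1.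
Hypothesis cA : connected A.
Hypothesis convA : forall x y (t : R), A x -> A y -> 0 <= t <= 1 -> A (t *: x + (1 - t) *: y).
Hypothesis A0 : A !=set0.
Hypothesis exhaust : forall c : R, compact (A `&` [set x | v x <= c]).

Lemma mid_in x y : A x -> A y -> A (2^-1 *: (x + y)).
Proof.
move=> Ax Ay; have -> : 2^-1 *: (x + y) = 2^-1 *: x + (1 - 2^-1) *: y.
  by apply/rowP => i; rewrite !mxE; field.
by apply: convA => //; lra.
Qed.

Lemma continuous_at f x : smooth A f -> A x -> {for x, continuous f}.
Proof. exact: smooth_continuous. Qed.

(** As f is at least v up to a constant, its sublevel sets are compact too. *)
Lemma exhausting_min (f : V -> R) (d : R) : smooth A f -> (forall x, A x -> v x - d <= f x) ->
  exists2 x, A x & forall y, A y -> f x <= f y.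
Proof.
move=> sf vf; have [x0 Ax0] := A0.
pose K := A `&` [set x | v x <= f x0 + d].
have K0 : K !=set0 by exists x0; split=> //=; have := vf x0 Ax0; lra.
have cf : {within K, continuous f}.
  by apply: continuous_in_subspaceT => x /set_mem[Ax _]; exact: continuous_at.
have cK : compact K by exact: exhaust.
have [x /set_mem[Ax vx] hx] := EVT_min_rV K0 cK cf.
exists x => // y Ay; have [vy|vy] := leP (v y) (f x0 + d); first exact: hx (mem_set (conj Ay vy)).
have := hx x0 (mem_set (conj Ax0 _)); have := vf x0 Ax0; have := vf y Ay => h1 h2 h3.
have {}h3 : f x <= f x0 by apply: h3; rewrite /=; lra.
lra.
Qed.

(** Midpoint convexity of v is the nonpositivity of this function. *)
Definition gap x y := v (2^-1 *: (x + y)) - (v x + v y) / 2.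

Hypothesis W_bound : exists W : R, forall x y, A x -> A y -> gap x y <= W.
Hypothesis strip : exists c0 : R, forall e : R, 0 < e < 1 / 4 -> forall x, A x -> c0 < v x ->
  (forall E, E != 0 -> 0 < qR (logform (fun z => (1 - e) * v z) x) E E) /\
  L < hdet (logform (fun z => (1 - e) * v z) x) re1 re2.

Lemma continuous_midpoint : continuous (fun t : V * V => 2^-1 *: (t.1 + t.2)).
Proof.
move=> t; apply: cvgZ; first exact: cvg_cst.
apply: cvgD; [exact: cvg_fst|exact: cvg_snd].
Qed.

Lemma continuous_on_pair (f : V * V -> V) t : {for t, continuous f} -> A (f t) ->
  {for t, continuous (fun s => v (f s))}.
Proof. by move=> cf Af; apply: continuous_comp => //; exact: continuous_at. Qed.

Lemma pair_max (Q : V * V -> R) (c : R) x0 y0 :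
  A x0 -> A y0 -> v x0 <= c -> v y0 <= c ->
  (forall t, A t.1 -> A t.2 -> {for t, continuous Q}) ->
  exists x y, [/\ A x, A y, v x <= c, v y <= c &
    forall x' y', A x' -> A y' -> v x' <= c -> v y' <= c -> Q (x', y') <= Q (x, y)].
Proof.
move=> Ax0 Ay0 vx0 vy0 cQ; pose K := A `&` [set x | v x <= c].
have cK : compact (K `*` K) by apply: compact_setX; exact: exhaust.
have KK0 : (K `*` K) !=set0 by exists (x0, y0); do 2!split.
have cQ' : {within K `*` K, continuous Q}.
  by apply: continuous_in_subspaceT => t /set_mem[[A1 _] [A2 _]]; exact: cQ.
have [[x y] /set_mem[[/= Ax vx] [/= Ay vy]] h] := compact_EVT_max KK0 cK cQ'.
exists x, y; split=> // x' y' Ax' Ay' vx' vy'.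
by apply: h; apply/mem_set; do 2!split.
Qed.

Lemma gap_continuous (e : R) t : A t.1 -> A t.2 ->
  {for t, continuous (fun t : V * V => (1 - e) * v (2^-1 *: (t.1 + t.2)) - (v t.1 + v t.2) / 2)}.
Proof.
move=> A1 A2.
have c0 := continuous_on_pair (@continuous_midpoint t) (mid_in A1 A2).
have c1 : {for t, continuous (fun s : V * V => v s.1)} by exact: continuous_on_pair cvg_fst A1.
have c2 : {for t, continuous (fun s : V * V => v s.2)} by exact: continuous_on_pair cvg_snd A2.
have c3 : {for t, continuous (fun s : V * V => (1 - e) * v (2^-1 *: (s.1 + s.2)))}.
  by apply: continuousM; [exact: cst_continuous|exact: c0].
have c4 : {for t, continuous (fun s : V * V => v s.1 + v s.2)} by apply: continuousD; [exact: c1|exact: c2].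
have c5 : {for t, continuous (fun s : V * V => (v s.1 + v s.2) / 2)}.
  by apply: continuousM; [exact: c4|exact: cst_continuous].
by apply: continuousB; [exact: c3|exact: c5].
Qed.

(** Near the boundary (1 - e) v is a strict subsolution, so the penalized gap
    is maximal at pairs whose midpoint stays in a fixed compact set. *)
Lemma gap_attained x0 y0 : A x0 -> A y0 -> 0 < gap x0 y0 ->
  exists x y, [/\ A x, A y, 0 < gap x y & forall x' y', A x' -> A y' -> gap x' y' <= gap x y].
Proof.
move=> Ax0 Ay0 g0.
have [xm Axm vmin] := exhausting_min (d := 0) sv (fun x _ => ltac:(by rewrite subr0)).
pose vm := v xm.
have [W hW] := W_bound; have [c0 hs] := strip.
(* The penalty makes the gap small once v is large at one of the points, so that
   its maximum is attained; in the strip the midpoint would be touched by the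
   strict subsolution (1 - e) v. *)
have pen e : 0 < e < 1 / 4 -> exists x y, [/\ A x, A y, v (2^-1 *: (x + y)) <= c0 &
    forall x' y', A x' -> A y' ->
      gap x' y' - e * v (2^-1 *: (x' + y')) <= gap x y - e * v (2^-1 *: (x + y))].
  move=> ee; have /andP[e0 e4] := ee.
  pose Q t := (1 - e) * v (2^-1 *: (t.1 + t.2)) - (v t.1 + v t.2) / 2.
  have QE x y : Q (x, y) = gap x y - e * v (2^-1 *: (x + y)).
    by rewrite /Q /gap /=; move: (v _) (v _) (v _) => *; ring.
  have QW x y : A x -> A y -> Q (x, y) <= `|W| - e * ((v x + v y) / 2).
    move=> Ax Ay; have h := le_trans (hW x y Ax Ay) (ler_norm W).
    have h2 : (1 - e) * gap x y <= `|W|.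
      have e1 : 0 <= 1 - e by lra.
      have := ler_wpM2l e1 h; have : (1 - e) * `|W| <= `|W|.
        by rewrite -[leRHS]mul1r ler_wpM2r //; lra.
      by move: ((1 - e) * gap x y) ((1 - e) * `|W|) => *; lra.
    by move: h2; rewrite /Q /gap /=; move: (v (2^-1 *: (x + y))) (v x) (v y) => *; lra.
  have half (q m a b c' : R) : 2 * q - m <= c' -> m <= a -> c' <= b -> q <= (a + b) / 2.
    by move=> *; lra.
  pose q := (`|W| - Q (x0, y0)) / e.
  have far s : q <= s -> `|W| - e * s <= Q (x0, y0).
    by rewrite /q ler_pdivrMr // [s * e]mulrC; move: (Q _) (e * s) => *; lra.
  pose c := Num.max (Num.max (v x0) (v y0)) (2 * q - vm).
  have cx0 : v x0 <= c by rewrite !le_max lexx.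
  have cy0 : v y0 <= c by rewrite !le_max lexx orbT.
  have cW : 2 * q - vm <= c by rewrite !le_max lexx !orbT.
  have [x [y [Ax Ay vx vy h]]] := pair_max Ax0 Ay0 cx0 cy0 (fun t => @gap_continuous e t).
  have glob x' y' : A x' -> A y' -> Q (x', y') <= Q (x, y).
    move=> Ax' Ay'; have [cx'|cx'] := leP (v x') c; first have [cy'|cy'] := leP (v y') c.
    - exact: h.
    - apply: le_trans (h x0 y0 Ax0 Ay0 cx0 cy0); apply: le_trans (QW _ _ Ax' Ay') _.
      apply: far; apply: (half _ _ _ _ c cW); [exact: vmin x' Ax'|exact: ltW cy'].
    - apply: le_trans (h x0 y0 Ax0 Ay0 cx0 cy0); apply: le_trans (QW _ _ Ax' Ay') _.
      apply: far; rewrite [v x' + _]addrC; apply: (half _ _ _ _ c cW); [exact: vmin y' Ay'|exact: ltW cx'].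
  exists x, y; split=> //; last by move=> x' y' Ax' Ay'; rewrite -!QE; exact: glob.
  rewrite leNgt; apply/negP => hc.
  have [posn] := hs e ee _ (mid_in Ax Ay) hc; apply/negP; rewrite -leNgt.
  have [r1 r10 h1] := open_norm_ball oA Ax; have [r2 r20 h2] := open_norm_ball oA Ay.
  apply: (@touch_midpoint _ A v L oA sv L0 pde pos A _ x y _ (Num.min r1 r2)) => //.
  - exact: smooth_scale.
  - exact: mid_in.
  - by rewrite lt_min r10.
  move=> a b; rewrite !lt_min => /andP[a1 _] /andP[_ b2].
  have Axa : A (x + a) by apply: h1; rewrite addrAC subrr add0r.
  have Ayb : A (y + b) by apply: h2; rewrite addrAC subrr add0r.
  have := glob _ _ Axa Ayb; rewrite /Q /=.
  by have -> : 2^-1 *: (x + a + (y + b)) = 2^-1 *: (x + y) + 2^-1 *: (a + b) by rewrite addrACA scalerDr.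
(* With a midpoint in the compact set v <= c0 and a point where v > c the gap would
   be negative, so the penalized maxima lie in a fixed compact set as e tends to 0. *)
pose c := Num.max (Num.max (v x0) (v y0)) (2 * c0 - vm).
have cx0 : v x0 <= c by rewrite !le_max lexx.
have cy0 : v y0 <= c by rewrite !le_max lexx orbT.
have cc0 : 2 * c0 - vm <= c by rewrite !le_max lexx !orbT.
have [x [y [Ax Ay vx vy h]]] := pair_max Ax0 Ay0 cx0 cy0 (fun t => @gap_continuous 0 t).
have h' x' y' : A x' -> A y' -> v x' <= c -> v y' <= c -> gap x' y' <= gap x y.
  by move=> A1 A2 v1 v2; have := h x' y' A1 A2 v1 v2; rewrite /= subr0 !mul1r.
exists x, y; split=> //; first by apply: lt_le_trans g0 (h' _ _ Ax0 Ay0 cx0 cy0).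
have gxy : 0 < gap x y by apply: lt_le_trans g0 (h' _ _ Ax0 Ay0 cx0 cy0).
move=> x' y' Ax' Ay'.
have key e : 0 < e < 1 / 4 -> gap x' y' <= gap x y + e * (v (2^-1 *: (x' + y')) - vm).
  move=> ee; have /andP[e0 _] := ee.
  have [xe [ye [Axe Aye cm he]]] := pen e ee.
  have h1 := he x' y' Ax' Ay'.
  have h2 : gap xe ye <= gap x y.
    have m1 := vmin xe Axe; have m2 := vmin ye Aye; rewrite -/vm in m1 m2.
    have [cx'|cx'] := leP (v xe) c; first have [cy'|cy'] := leP (v ye) c.
    - exact: h'.
    - apply: ltW; apply: le_lt_trans gxy; rewrite /gap.
      by move: (v (2^-1 *: (xe + ye))) cm => *; lra.
    - apply: ltW; apply: le_lt_trans gxy; rewrite /gap.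
      by move: (v (2^-1 *: (xe + ye))) cm => *; lra.
  have h3 : e * vm <= e * v (2^-1 *: (xe + ye)).
    by rewrite ler_pM2l //; apply: vmin; exact: mid_in.
  move: h1 h2 h3; rewrite mulrBr; move: (e * v _) (e * v _) (gap _ _) (gap _ _) (gap _ _) => *.
  lra.
apply/ler_addgt0Pl => d d0; pose D := v (2^-1 *: (x' + y')) - vm.
have D0 : 0 <= D by rewrite subr_ge0; apply: vmin; exact: mid_in.
pose e := Num.min (1 / 8) (d / (D + 1)).
have D1 : 0 < D + 1 by rewrite ltr_wpDl.
have e0 : 0 < e by rewrite lt_min (divr_gt0 d0 D1) andbT; lra.
have e1 : e <= 1 / 8 by rewrite ge_min lexx.
have e2 : e <= d / (D + 1) by rewrite ge_min lexx orbT.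
have ee : 0 < e < 1 / 4 by apply/andP; split=> //; apply: le_lt_trans e1 _; lra.
apply: le_trans (key e ee) _; rewrite addrC lerD2r -/D.
apply: (@le_trans _ _ (e * (D + 1))); first by rewrite ler_wpM2l ?(ltW e0) // lerDl ler01.
by rewrite -(ler_pdivlMr _ _ D1).
Qed.

(** A positive maximum of the gap would propagate, by the strong maximum principle,
    to all midpoints; but over a minimum of v the gap is nonpositive. *)
Lemma gap_le0 x0 y0 : A x0 -> A y0 -> gap x0 y0 <= 0.
Proof.
move=> Ax0 Ay0; rewrite leNgt; apply/negP => g0.
have [x [y [Ax Ay mu0 gmax]]] := gap_attained Ax0 Ay0 g0.
have [xm Axm vmin] := exhausting_min (d := 0) sv (fun x _ => ltac:(by rewrite subr0)).
pose W (z h : V) := v z - (v (z + h) + v (z - h)) / 2.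
pose D (z h : V) := A (z + h) /\ A (z - h).
have gapW z h : gap (z + h) (z - h) = W z h by rewrite /gap midpointK.
have DA z h : D z h -> A z by case=> h1 h2; rewrite -(midpointK z h); exact: mid_in.
suff [h [Dh1 Dh2]] : exists2 h, D xm h & W xm h = gap x y.
  rewrite /W; have := vmin _ Dh1; have := vmin _ Dh2.
  by move: (v xm) (v (xm + h)) (v (xm - h)) (gap x y) mu0 => *; lra.
apply: (@strong_maximum_principle _ A D W (gap x y) (gap x y) oA cA mu0 _ _ _ xm Axm).
- by move=> z h Az [D1 D2]; rewrite -gapW; exact: gmax.
- move=> a Aa; have [rho rho0 [rA nt]] := no_touching_midpoint oA sv L0 pde pos Aa.
  exists rho => //.
  have cB : compact (closed_ball a rho : set V) by exact: closed_ball_compact.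
  have BA : (closed_ball a rho : set V) `<=` A.
    by move=> z; rewrite closed_ballE // => /= hz; apply: rA; rewrite distrC.
  have [M M0 hM] := smooth_bounded sv cB BA.
  pose c := 2 * M - v xm; pose K := A `&` [set x | v x <= c].
  have cKK : compact (K `*` K) by apply: compact_setX; exact: exhaust.
  pose P (t : V * V) : V * V := (2^-1 *: (t.1 + t.2), 2^-1 *: (t.1 - t.2)).
  have mK (p q : V) : 2^-1 *: (p + q) + 2^-1 *: (p - q) = p.
    by apply/rowP => i; rewrite !mxE; field.
  have mK' (p q : V) : 2^-1 *: (p + q) - 2^-1 *: (p - q) = q.
    by apply/rowP => i; rewrite !mxE; field.
  exists (P @` (K `*` K)); split=> //.
  + apply: continuous_compact => //; apply: continuous_subspaceT => t.
    have cd : {for t, continuous (fun s : V * V => 2^-1 *: (s.1 - s.2))}.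
      apply: cvgZ; first exact: cvg_cst.
      by apply: cvgB; [exact: cvg_fst|exact: cvg_snd].
    exact: (cvg_pair (continuous_midpoint (x := t)) cd).
  + move=> _ [[p q] [[/= Ap _] [/= Aq _]] <-] /=.
    have Dpq : D (2^-1 *: (p + q)) (2^-1 *: (p - q)) by split; rewrite ?mK ?mK'.
    split=> //; set t := P (p, q).
    have c0 : {for t, continuous (fun s : V * V => v s.1)}.
      by apply: continuous_on_pair; [exact: cvg_fst|exact: mid_in].
    have c1 : {for t, continuous (fun s : V * V => v (s.1 + s.2))}.
      apply: continuous_on_pair; last exact: Dpq.1.
      by apply: cvgD; [exact: cvg_fst|exact: cvg_snd].
    have c2 : {for t, continuous (fun s : V * V => v (s.1 - s.2))}.
      apply: continuous_on_pair; last exact: Dpq.2.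
      by apply: cvgB; [exact: cvg_fst|exact: cvg_snd].
    have c3 : {for t, continuous (fun s : V * V => v (s.1 + s.2) + v (s.1 - s.2))}.
      by apply: continuousD; [exact: c1|exact: c2].
    have c4 : {for t, continuous (fun s : V * V => (v (s.1 + s.2) + v (s.1 - s.2)) / 2)}.
      by apply: continuousM; [exact: c3|exact: cst_continuous].
    by apply: continuousB; [exact: c0|exact: c4].
  + move=> z h za [D1 D2]; rewrite subrr => Wz.
    have vz : v z <= M.
      by apply: le_trans (ler_norm _) (hM z _); rewrite closed_ballE // /closed_ball_ /= distrC.
    have m1 := vmin _ D1; have m2 := vmin _ D2.
    exists (z + h, z - h); last by rewrite /P /= midpointK; congr pair; apply/rowP => i; rewrite !mxE; field.
    have half (p q w m : R) : 0 < w - (p + q) / 2 -> w <= M -> m <= q -> p <= 2 * M - m.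
      by move=> *; lra.
    split; split=> //=; first exact: (half _ _ _ _ Wz vz m2).
    by apply: (half _ (v (z + h)) _ _ _ vz m1); rewrite [v (z - h) + _]addrC.
  + by move=> y' r0 r1 ya r00; exact: nt.
- exists (2^-1 *: (x + y)); first exact: mid_in.
  have mK : 2^-1 *: (x + y) + 2^-1 *: (x - y) = x by apply/rowP => i; rewrite !mxE; field.
  have mK' : 2^-1 *: (x + y) - 2^-1 *: (x - y) = y by apply/rowP => i; rewrite !mxE; field.
  by exists (2^-1 *: (x - y)); rewrite /D /W ?mK ?mK'.
Qed.

Lemma second_difference_hess f x e : smooth A f -> A x ->
  (forall t : R, A (x + t *: e) -> A (x - t *: e) -> f x + f x <= f (x + t *: e) + f (x - t *: e)) ->
  0 <= hess f x e e.
Proof.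
move=> sf Ax hf; have [r r0 hr] := line_in e oA Ax; have [r' r'0 hr'] := line_in (- e) oA Ax.
have d g E (t : R) : smooth A g -> A (x + t *: E) ->
    is_derive t 1 (fun s : R => g (x + s *: E)) (dd E g (x + t *: E)).
  by move=> sg At; exact: is_derive_line (smooth_diff sg At).
have m0 : 0 < Num.min r r' by rewrite lt_min r0.
have := @max_second_derivative R
  (fun s : R => -1 * (f (x + s *: e) + f (x + s *: - e)))
  (fun s : R => -1 * (dd e f (x + s *: e) + dd (- e) f (x + s *: - e)))
  (-1 * (hess f x e e + hess f x (- e) (- e))) _ m0 _ _ _.
have sh := symform_hess oA sf Ax.
have -> : hess f x (- e) (- e) = hess f x e e.
  have [_ hZ hC] := sh.
  by rewrite -scaleN1r hZ hC hZ mulrA mulrNN !mul1r.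
case.
- move=> t; rewrite lt_min => /andP[t1 t2].
  by apply: isd_scale; apply: isd_add; apply: d => //; [exact: hr|exact: hr'].
- apply: isd_scale; apply: isd_add.
  + apply: isd_eq (d _ e 0 (smooth_dd e sf) _) _; rewrite scale0r addr0 //.
  + apply: isd_eq (d _ (- e) 0 (smooth_dd (- e) sf) _) _; rewrite scale0r addr0 //.
    have [_ hZ hC] := sh.
    have -> : dd (- e) (dd (- e) f) x = hess f x (- e) (- e) by [].
    by rewrite -scaleN1r hZ hC hZ mulrA mulrNN !mul1r.
- move=> t; rewrite lt_min => /andP[t1 t2].
  have A1 := hr t t1; have A2 := hr' t t2.
  have := hf t A1; rewrite scalerN in A2 *; move=> /(_ A2).
  rewrite !scale0r !addr0.
  by move: (f x) (f (x + _)) (f (x - _)) => *; lra.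
by move=> _; move: (hess f x e e) => *; lra.
Qed.

Lemma hess_ge0 x e : A x -> 0 <= hess v x e e.
Proof.
move=> Ax; apply: second_difference_hess => // t A1 A2.
have := gap_le0 A1 A2; rewrite /gap midpointK.
by move: (v x) (v _) (v _) => *; lra.
Qed.

Hypothesis squares_bounded : exists B : R, forall x, A x -> dot x x <= B.

Lemma hess_sum z e : A z -> hess v z e e =
  \sum_(k < 2 + 2) e 0 k * \sum_(l < 2 + 2) e 0 l * dd (delta_mx 0 k) (dd (delta_mx 0 l) v) z.
Proof.
move=> Az; rewrite /hess (dd_sum_partial e (smooth_diff (smooth_dd e sv) Az)).
apply: eq_bigr => k _; congr (_ * _); rewrite dd_partial (dd_comm _ _ oA sv Az).
rewrite (dd_sum_partial e (smooth_diff (smooth_dd _ sv) Az)).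
by apply: eq_bigr => l _; rewrite dd_partial (dd_comm _ _ oA sv Az).
Qed.

Lemma continuous_sum4 (T : topologicalType) (F : 'I_(2 + 2) -> T -> R) t :
  (forall k, {for t, continuous (F k)}) -> {for t, continuous (fun s => \sum_(k < 2 + 2) F k s)}.
Proof.
move=> cF; suff H (r : seq 'I_(2 + 2)) : {for t, continuous (fun s => \sum_(k <- r) F k s)} by exact: H.
elim: r => [|k r IH].
  have -> : (fun s => \sum_(k <- [::]) F k s) = cst 0 by apply/funext => s; rewrite big_nil.
  exact: cst_continuous.
have -> : (fun s => \sum_(l <- k :: r) F l s) = (fun s => F k s + \sum_(l <- r) F l s).
  by apply/funext => s; rewrite big_cons.
by apply: continuousD; [exact: cF|exact: IH].
Qed.

Lemma hess_continuous (t : V * V) : A t.1 ->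
  {for t, continuous (fun s : V * V => - hess v s.1 s.2 s.2)}.
Proof.
move=> At; pose S (s : V * V) :=
  \sum_(k < 2 + 2) s.2 0 k * \sum_(l < 2 + 2) s.2 0 l * dd (delta_mx 0 k) (dd (delta_mx 0 l) v) s.1.
have c2 k : {for t, continuous (fun s : V * V => s.2 0 k)}.
  apply: (@continuous_comp _ _ _ snd (fun w : V => w 0 k)); first exact: cvg_snd.
  exact: coord_continuous.
have c1 f : smooth A f -> {for t, continuous (fun s : V * V => f s.1)}.
  move=> sf; apply: (@continuous_comp _ _ _ fst f); first exact: cvg_fst.
  exact: smooth_continuous sf At.
have cS : {for t, continuous S}.
  apply: continuous_sum4 => k; apply: continuousM; first exact: c2.
  apply: continuous_sum4 => l; apply: continuousM; first exact: c2.
  by apply: c1; do 2!apply: smooth_dd.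
have cNS : {for t, continuous (fun s => - S s)} by apply: continuousN; exact: cS.
rewrite /prop_for /filter.continuous_at (hess_sum _ At); apply: cvg_trans cNS.
apply: near_eq_cvg.
have [r r0 hr] := open_norm_ball oA At.
have /cvgrPdist_lt/(_ r r0) h : fst s @[s --> t] --> t.1 by exact: cvg_fst.
by apply: filterS h => s /= hs; rewrite hess_sum //; apply: hr; rewrite distrC.
Qed.

Lemma unit_sphere_compact : compact [set e : V | dot e e = 1].
Proof.
apply: bounded_closed_compact; last first.
  have -> : [set e : V | dot e e = 1] = (fun e : V => dot (e - 0) (e - 0)) @^-1` [set 1].
    by apply/seteqP; split=> e /=; rewrite subr0.
  by apply: closed_comp; [move=> z _; exact: dot_continuous|exact: closed_eq].
exists 1; split; first by rewrite num_real.
by move=> M hM e /norm_unit h; apply: le_trans h (ltW hM).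
Qed.

Lemma unit_normalize e : e != 0 -> exists2 s : R, 0 < s & dot (s *: e) (s *: e) = 1.
Proof.
move=> /dot_gt0 h; have q0 : 0 < Num.sqrt (dot e e) by rewrite sqrtr_gt0.
exists (Num.sqrt (dot e e))^-1; first by rewrite invr_gt0.
rewrite dotZl dotZr mulrA -invfM -expr2 (sqr_sqrtr (ltW h)) mulVf //.
by rewrite gt_eqF.
Qed.

(** The rank of the real Hessian is constant, and it is full where v minus the
    squared norm is minimal. *)
Lemma hess_gt0 x e : A x -> e != 0 -> 0 < hess v x e e.
Proof.
move=> Ax /unit_normalize[s s0 se].
suff H : 0 < hess v x (s *: e) (s *: e).
  have [_ hZ hC] := symform_hess oA sv Ax.
  by move: H; rewrite hZ hC hZ !(pmulr_rgt0 _ s0).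
have [Bd hB] := squares_bounded.
have sf : smooth A (fun z => v z + - dot (z - 0) (z - 0)).
  by apply: smooth_add => //; apply: smooth_opp => //; exact: smooth_sqdist.
have lf z : A z -> v z - Bd <= v z + - dot (z - 0) (z - 0).
  by move=> Az; rewrite subr0 lerD2l lerN2; exact: hB.
have [xm Axm fmin] := exhausting_min (d := Bd) sf lf.
have Hm E : 2 * dot E E <= hess v xm E E.
  have h : 0 <= hess (fun z => v z + - dot (z - 0) (z - 0)) xm E E.
    by apply: second_difference_hess => // t A1 A2; apply: lerD; exact: fmin.
  have sd := @smooth_sqdist R A 0 oA.
  have e1 z : A z -> dd E (fun z => v z + - dot (z - 0) (z - 0)) z = dd E v z + (-2) * dot (z - 0) E.
    move=> Az; rewrite (dd_add E (smooth_diff sv Az) (smooth_diff (smooth_opp oA sd) Az)).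
    by rewrite (dd_opp E (smooth_diff sd Az)) dd_sqdist mulNr.
  have so := @smooth_dot R A 0 E oA.
  move: h; rewrite /hess (dd_congr E oA e1 Axm).
  rewrite (dd_add E (smooth_diff (smooth_dd E sv) Axm) (smooth_diff (smooth_scale (-2) oA so) Axm)).
  rewrite (dd_scale (-2) E (smooth_diff so Axm)) dd_dot.
  by move: (dd E (dd E v) xm) (dot E E) => *; lra.
rewrite lt_def hess_ge0 // andbT; apply/eqP => h0.
have [E /= E1 hE] : exists2 E, dot E E = 1 & - hess v xm E E = 0.
  apply: (@strong_maximum_principle _ A (fun _ E => dot E E = 1) (fun z E => - hess v z E E) 0 1 oA cA _ _ _ _ xm Axm).
  - exact: ltr01.
  - by move=> z E Az _; rewrite oppr_le0 hess_ge0.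
  - move=> a Aa; have [rho rho0 [rA nt]] := no_touching_hessian oA sv L0 pde pos hess_ge0 Aa.
    exists rho => //; exists ((closed_ball a rho : set V) `*` [set E | dot E E = 1]); split=> //.
    + apply: compact_setX; [exact: closed_ball_compact|exact: unit_sphere_compact].
    + move=> t [t1 t2]; split=> //; apply: hess_continuous; apply: rA.
      by move: t1; rewrite closed_ballE // /closed_ball_ /= distrC.
    + by move=> z E za E1 _; split=> //=; rewrite closed_ballE // /closed_ball_ /= distrC.
  - by exists x => //; exists (s *: e); rewrite // h0 oppr0.
have := Hm E; rewrite E1; move: hE; move: (hess v xm E E) => *; lra.
Qed.

Theorem exhausting_strictly_convex : strictly_convex_on A v.
Proof.
move=> x y t Ax Ay xy /andP[t0 t1].
pose E := x - y; have E0 : E != 0 by rewrite subr_eq0.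
have At s : 0 <= s <= 1 -> A (y + s *: E).
  have -> : y + s *: E = s *: x + (1 - s) *: y by apply/rowP => i; rewrite !mxE; ring.
  exact: convA.
have t1' : 0 < 1 - t by rewrite subr_gt0.
have [|c1 /andP[c10 c1t] h1] := @MVT_line R _ v y E t t0.
  by move=> s /andP[s0 s1]; apply: smooth_diff sv _; apply: At; lra.
have [|c2 /andP[c20 c2t] h2] := @MVT_line R _ v (y + t *: E) E (1 - t) t1'.
  by move=> s /andP[s0 s1]; apply: smooth_diff sv _; rewrite -addrA -scalerDl; apply: At; lra.
have d0 : 0 < t + c2 - c1 by lra.
have [|c3 /andP[c30 c3t] h3] := @MVT_line R _ (dd E v) (y + c1 *: E) E (t + c2 - c1) d0.
  move=> s /andP[s0 s1]; apply: smooth_diff (smooth_dd E sv) _.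
  by rewrite -addrA -scalerDl; apply: At; lra.
have hp : 0 < dd E (dd E v) (y + c1 *: E + c3 *: E).
  by apply: hess_gt0 => //; rewrite -addrA -scalerDl; apply: At; lra.
have e1 : y + t *: E + (1 - t) *: E = x by rewrite -addrA -scalerDl subrKC scale1r subrKC.
have e2 : y + c1 *: E + (t + c2 - c1) *: E = y + t *: E + c2 *: E.
  by rewrite -!addrA -!scalerDl; congr (_ + _ *: _); ring.
have e3 : t *: x + (1 - t) *: y = y + t *: E by apply/rowP => i; rewrite !mxE; ring.
rewrite e3; rewrite e1 in h2; rewrite e2 in h3.
have hd : 0 < dd E v (y + t *: E + c2 *: E) - dd E v (y + c1 *: E) by rewrite h3 mulr_gt0.
rewrite -subr_gt0.
have -> : t * v x + (1 - t) * v y - v (y + t *: E) =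
  t * (v x - v (y + t *: E)) - (1 - t) * (v (y + t *: E) - v y) by ring.
rewrite h1 h2; move: (dd E v _) (dd E v _) hd => q p hd.
have -> : t * ((1 - t) * p) - (1 - t) * (t * q) = t * (1 - t) * (p - q) by ring.
by rewrite mulr_gt0 // mulr_gt0.
Qed.

End ExhaustingSolution.

(** * The complex Hessian in real coordinates *)

Section ComplexHessian.
Context {R : realType}.
Notation V := (C2 R).
Implicit Types (A : set V) (x y z E F : V) (u f g : V -> R).

Lemma cpartial_pair k f g z :
  cpartial k (fun w => Complex (f w) (g w)) z = Complex (partial k f z) (partial k g z).
Proof. by []. Qed.

Lemma partial_scale A f (c : R) k z : smooth A f -> A z ->
  partial k (fun w => f w * c) z = partial k f z * c.
Proof.
move=> sf Az; have -> : (fun w => f w * c) = (fun w => c * f w) by apply/funext => w; rewrite mulrC.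
by rewrite !dd_partial (dd_scale c _ (smooth_diff sf Az)) mulrC.
Qed.

Lemma complex_hessianE A u z : open A -> smooth A u -> A z -> forall i j : 'I_2,
  complex_hessian u z i j = Complex
   (qR (hess u z) (delta_mx 0 (lshift 2 i)) (delta_mx 0 (lshift 2 j)) / 4)
   (qI (hess u z) (delta_mx 0 (lshift 2 i)) (delta_mx 0 (lshift 2 j)) / 4).
Proof.
move=> oA su Az i j.
have half : (2 : R[i])^-1 = Complex (2^-1) 0.
  by have := @fmorphV _ _ (real_complex R) 2; rewrite rmorph_nat.
rewrite /complex_hessian mxE /wirtinger_bar.
have -> : (fun z0 => (cpartial (lshift 2 j) (fun w => (u w)%:C%C) z0 +
     'i%C * cpartial (rshift 2 j) (fun w => (u w)%:C%C) z0) / 2) =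
   (fun w => Complex (partial (lshift 2 j) u w / 2) (partial (rshift 2 j) u w / 2)).
  apply/funext => w; rewrite !cpartial_pair.
  have p0 k : partial k (fun=> 0 : R) w = 0 by rewrite dd_partial dd_cst.
  rewrite !p0 half; apply/eqP; rewrite eq_complex /=; apply/andP; split; apply/eqP; ring.
have sp k : smooth A (partial k u) by rewrite (_ : partial k u = dd (delta_mx 0 k) u); [exact: smooth_dd|apply/funext => w; rewrite dd_partial].
rewrite /wirtinger !cpartial_pair !(partial_scale _ _ (sp _) Az) /qR /qI !J_delta /hess.
have pp k l : partial k (partial l u) z = dd (delta_mx 0 k) (dd (delta_mx 0 l) u) z.
  by rewrite dd_partial; congr (dd _ _ z); apply/funext => w; rewrite dd_partial.
rewrite !pp half; apply/eqP; rewrite eq_complex /=.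
pose e k : V := delta_mx 0 k; rewrite -!/(e _).
move: (dd (e (lshift 2 i)) (dd (e (lshift 2 j)) u) z) (dd (e (lshift 2 i)) (dd (e (rshift 2 j)) u) z) => a b.
move: (dd (e (rshift 2 i)) (dd (e (lshift 2 j)) u) z) (dd (e (rshift 2 i)) (dd (e (rshift 2 j)) u) z) => c d.
by apply/andP; split; apply/eqP; field.
Qed.

Lemma det2 (S : comNzRingType) (M : 'M[S]_2) : \det M = M 0 0 * M 1 1 - M 0 1 * M 1 0.
Proof.
rewrite (expand_det_row _ 0) !big_ord_recl big_ord0 addr0 /cofactor !det_mx11 !mxE /=.
have l0 : lift 0 0 = 1 :> 'I_2 by apply/val_inj.
have l1 : lift 1 0 = 0 :> 'I_2 by apply/val_inj.
by rewrite !l0 l1 expr0 mul1r expr1 mulN1r mulrN.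
Qed.

Lemma det_complex_hessian A u z : open A -> smooth A u -> A z ->
  \det (complex_hessian u z) = (hdet (hess u z) re1 re2 / 16)%:C%C.
Proof.
move=> oA su Az; have [hD hZ hC] := symform_hess oA su Az.
rewrite det2 !(complex_hessianE oA su Az) -/re1 -/re2.
have n0 E F : qR (hess u z) E F = qR (hess u z) F E by rewrite /qR hC (hC (J E)).
have n1 E F : qI (hess u z) E F = - qI (hess u z) F E.
  by rewrite /qI opprB hC (hC (J E)).
have n2 E : qI (hess u z) E E = 0 by rewrite /qI hC subrr.
rewrite !n2 (n0 re2 re1) (n1 re2 re1) /hdet.
move: (qR _ _ _) (qR _ _ _) (qR _ _ _) (qI _ _ _) => a b c d.
by apply/eqP; rewrite eq_complex /=; apply/andP; split; apply/eqP; field.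
Qed.

End ComplexHessian.

(** * The logarithm of an eigenfunction *)

Section Eigenfunction.
Context {R : realType}.
Notation V := (C2 R).
Implicit Types (E F x y z a b p : V).
Context (A : set V) (u : V -> R) (lam : R).
Hypothesis oA : open A.
Hypothesis cA : connected A.
Hypothesis A0 : A !=set0.
Hypothesis bA : bounded_set A.
Hypothesis su : smooth A u.
Hypothesis cu : {within closure A, continuous u}.
Hypothesis u_lt0 : forall z, A z -> u z < 0.
Hypothesis u_boundary : forall z, boundary A z -> u z = 0.
Hypothesis lam0 : 0 < lam.
Hypothesis hdet_u : forall z, A z -> hdet (hess u z) re1 re2 = 16 * lam * u z ^+ 2.

Lemma boundaryE z : boundary A z <-> closure A z /\ ~ A z.
Proof. by rewrite /boundary (interior_id A).1. Qed.

Lemma closure_cases z : closure A z -> A z \/ boundary A z.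
Proof. by move=> cz; have [Az|nAz] := pselect (A z); [left|right; rewrite boundaryE]. Qed.

Lemma u_le0 z : closure A z -> u z <= 0.
Proof. by move=> /closure_cases[/u_lt0/ltW|/u_boundary ->]. Qed.

Lemma closure_bound : exists2 M : R, 0 < M & forall z, closure A z -> `|z| <= M.
Proof.
have [M [Mr hM]] := bA; exists (`|M| + 1); first by rewrite ltr_wpDl.
have hA z : A z -> `|z| <= `|M| + 1.
  by apply: hM; apply: le_lt_trans (ler_norm M) _; rewrite ltrDl.
have clB : closed [set z : V | `|z| <= `|M| + 1].
  have -> : [set z : V | `|z| <= `|M| + 1] = (@Num.norm R V) @^-1` [set t | t <= `|M| + 1] by [].
  by apply: closed_comp; [move=> z _; exact: norm_continuous|exact: closed_le].
by move=> z /(closure_subset hA); rewrite -(closure_id _).1.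
Qed.

Lemma closure_compact : compact (closure A).
Proof.
apply: bounded_closed_compact; last exact: closed_closure.
have [M M0 hM] := closure_bound; exists M; split; first by rewrite num_real.
by move=> M' MM' z /hM h; apply: le_trans h (ltW MM').
Qed.

Lemma within_gt p (c : R) : closure A p -> c < u p -> \forall z \near p, closure A z -> c < u z.
Proof.
move=> clp cup; have /subspace_continuousP/(_ p clp) h := cu.
exact: (cvgr_gt _ h _ cup).
Qed.

Lemma hdet_hess_gt0 z : A z -> 0 < hdet (hess u z) re1 re2.
Proof.
move=> Az; have l16 : 0 < 16 * lam by rewrite mulr_gt0 // ltr0n.
by rewrite hdet_u // (pmulr_rgt0 _ l16) exprn_even_gt0 //= lt_eqF // u_lt0.
Qed.

Lemma qR_hess_neq0 z : A z -> qR (hess u z) re1 re1 != 0.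
Proof.
move=> Az; apply/eqP => h0.
by move: (lt_le_trans (hdet_hess_gt0 Az) (hdet_le _ _ _)); rewrite h0 mul0r ltxx.
Qed.

Lemma interior_minimum : exists2 x, A x & forall z, closure A z -> u x <= u z.
Proof.
have [x0 Ax0] := A0; have c0 : closure A !=set0 by exists x0; apply: subset_closure.
have [x /set_mem clx hx] := EVT_min_rV c0 closure_compact cu.
have [Ax|/u_boundary ux] := closure_cases clx; first by exists x => // z cz; apply: hx; apply/mem_set.
have := hx x0 (mem_set (subset_closure Ax0)); rewrite ux leNgt u_lt0 //.
Qed.

(** The Hermitian Hessian is nondegenerate, positive at the minimum of u, and
    the domain is connected. *)
Lemma qR_hess_gt0 z : A z -> 0 < qR (hess u z) re1 re1.
Proof.
have [x Ax xmin] := interior_minimum.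
have pm (t : R) E : A (x + t *: E) -> A (x - t *: E) -> u x + u x <= u (x + t *: E) + u (x - t *: E).
  by move=> A1 A2; apply: lerD; apply: xmin; apply: subset_closure.
have px : 0 < qR (hess u x) re1 re1.
  rewrite lt_def qR_hess_neq0 //; apply: addr_ge0;
    by apply: (second_difference_hess oA su Ax) => t A1 A2; exact: pm.
pose f w := dd re1 (dd re1 u) w + dd (J re1) (dd (J re1) u) w.
have sf : smooth A f by apply: smooth_add => //; do 2!apply: smooth_dd.
have cf : {within A, continuous f}.
  by apply: continuous_in_subspaceT => w /set_mem Aw; exact: smooth_continuous sf Aw.
move=> Az; rewrite ltNge le_eqVlt (negbTE (qR_hess_neq0 Az)) /=; apply/negP => fz.
have /connected_intervalP I := connected_continuous_connected cA cf.
have [w Aw fw] : (f @` A) 0.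
  apply: (I (f z) (f x)); [by exists z|by exists x|].
  by apply/andP; split; exact: ltW.
by have /eqP := qR_hess_neq0 Aw.
Qed.

Definition logu z := - ln (- u z / 4).

Lemma logu_arg_gt0 z : A z -> 0 < - u z / 4.
Proof. by move=> Az; rewrite divr_gt0 // oppr_gt0 u_lt0. Qed.

Lemma smooth_logu : smooth A logu.
Proof.
apply: smooth_opp => //; apply: smooth_ln => //; last exact: logu_arg_gt0.
by apply: smooth_mul => //; [exact: smooth_opp|exact: smooth_cst].
Qed.

Lemma dd_logu E z : A z -> - u z * dd E logu z = dd E u z.
Proof.
move=> Az; have sw : smooth A (fun z => - u z / 4).
  by apply: smooth_mul => //; [exact: smooth_opp|exact: smooth_cst].
have sl := smooth_ln oA sw logu_arg_gt0.
rewrite /logu (dd_opp E (smooth_diff sl Az)) (dd_ln E oA sw logu_arg_gt0 Az).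
rewrite (dd_congr (g := fun z => (- 4^-1) * u z) E oA) //; last by move=> w _; rewrite mulNr mulNr mulrC.
rewrite (dd_scale _ E (smooth_diff su Az)).
have := u_lt0 Az; move: (u z) (dd E u z) => t d t0.
by field; rewrite lt_eqF.
Qed.

(** This differentiates (- u) w_F = u_F once more, for w = - ln (- u / 4). *)
Lemma logform_logu E F z : A z -> - u z * logform logu z E F = hess u z E F.
Proof.
move=> Az; have sv := smooth_logu.
have : dd E (fun w => - u w * dd F logu w) z = hess u z E F.
  by apply: (dd_congr E oA) => // w Aw; exact: dd_logu.
rewrite (dd_mul E (smooth_diff (smooth_opp oA su) Az) (smooth_diff (smooth_dd F sv) Az)).
rewrite (dd_opp E (smooth_diff su Az)) -(dd_logu E Az) /logform /grad -/(hess logu z E F) => <-.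
by move: (u z) (hess logu z E F) (dd E logu z) (dd F logu z) => *; ring.
Qed.

Lemma logform_loguE z : A z -> logform logu z = (fun E F => (- u z)^-1 * hess u z E F).
Proof.
move=> Az; apply/funext => E; apply/funext => F; rewrite -(logform_logu E F Az) mulKf //.
by rewrite oppr_eq0 lt_eqF // u_lt0.
Qed.

Lemma qR_logform_logu E F z : A z -> qR (logform logu z) E F = (- u z)^-1 * qR (hess u z) E F.
Proof. by move=> Az; rewrite logform_loguE // /qR mulrDr. Qed.

Lemma logu_pos z : A z -> 0 < qR (logform logu z) re1 re1.
Proof. by move=> Az; rewrite qR_logform_logu // mulr_gt0 ?qR_hess_gt0 // invr_gt0 oppr_gt0 u_lt0. Qed.

Lemma logu_pde z : A z -> hdet (logform logu z) re1 re2 = 16 * lam.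
Proof.
move=> Az; have u0 : u z != 0 by rewrite lt_eqF // u_lt0.
have : hdet (logform logu z) re1 re2 = (- u z)^-1 ^+ 2 * hdet (hess u z) re1 re2.
  rewrite logform_loguE // /hdet /qR /qI; move: ((- u z)^-1) (hess u z) => c Q.
  by move: (Q _ _) (Q _ _) (Q _ _) (Q _ _) (Q _ _) (Q _ _) (Q _ _) (Q _ _) => *; ring.
move=> ->; rewrite hdet_u //; by move: (u z) u0 => t t0; field.
Qed.

(** On a sublevel set u is bounded away from its boundary value 0. *)
Lemma logu_exhaust (c : R) : compact (A `&` [set x | logu x <= c]).
Proof.
have vc z : A z -> logu z <= c -> u z <= - (4 * expR (- c)).
  move=> Az; rewrite /logu lerNl => h; rewrite -ler_expR lnK ?posrE ?logu_arg_gt0 // in h.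
  by move: (expR _) (u z) h => *; lra.
have cv z : A z -> u z <= - (4 * expR (- c)) -> logu z <= c.
  move=> Az h; rewrite /logu lerNl -ler_expR lnK ?posrE ?logu_arg_gt0 //.
  by move: (expR _) (u z) h => *; lra.
have e0 : 0 < 4 * expR (- c) by rewrite mulr_gt0 ?expR_gt0.
move=> F FF FK.
have [p [clp cp]] : closure A `&` cluster F !=set0.
  by apply: closure_compact; apply: filterS FK => t [/subset_closure].
have up : u p <= - (4 * expR (- c)).
  rewrite leNgt; apply/negP => h; have n1 := within_gt clp h.
  have [t [[At vt] h2]] := cp _ _ FK n1.
  by have := h2 (subset_closure At); rewrite ltNge vc.
have Ap : A p.
  by have [//|/u_boundary u0] := closure_cases clp; move: up; rewrite u0; move: (expR _) e0 => *; lra.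
by exists p; split=> //; split=> //=; exact: cv.
Qed.

Lemma A_squares_bounded : exists B : R, forall x, A x -> dot x x <= B.
Proof.
have [M M0 hM] := closure_bound; exists (4 * (M * M)) => x Ax.
have h := hM x (subset_closure Ax).
by apply: le_trans (ler_norm _) (le_trans (dot_le_norm _ _) _); rewrite ler_wpM2l // ler_pM.
Qed.

(** * Estimates up to the boundary *)

Lemma lipschitz_dd (f : V -> R) (C : R) z E : 0 <= C -> A z -> differentiable f z ->
  (forall x y, A x -> A y -> `|f x - f y| <= C * `|x - y|) -> `|dd E f z| <= C * `|E|.
Proof.
move=> C0 Az df lip; rewrite ddE leNgt; apply/negP => h.
have [r r0 hr] := line_in E oA Az.
have der := diff_derivable (v := E) df.
have cq : `|h^-1 *: (f (h *: E + z) - f z)| @[h --> (0 : R)^'] --> `|'D_E f z|.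
  exact: (cvg_norm der).
have n1 : \forall s \near (0 : R)^', C * `|E| < `|s^-1 *: (f (s *: E + z) - f z)|.
  exact: cvgr_gt _ cq _ h.
have n2 : \forall h \near (0 : R)^', `|h| < r /\ h != 0.
  near=> s; split; last by near: s; exact: nbhs_dnbhs_neq.
  by near: s; apply: dnbhs0_lt.
have [s [/= h1 [h2 h3]]] := filter_ex (filterI n1 n2).
move: h1; apply/negP; rewrite -leNgt.
have As := hr s h2.
rewrite normrM normfV ler_pdivrMl ?normr_gt0 // [s *: E + z]addrC.
apply: le_trans (lip _ _ As Az) _.
by rewrite [z + _]addrC addrK normrZ mulrCA.
Unshelve. all: by end_near. Qed.

Hypothesis partial_lipschitz : exists2 C : R, 0 <= C & forall k x y, A x -> A y ->
  `|partial k u x - partial k u y| <= C * `|x - y|.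

Lemma hess_bounded : exists2 B : R, 0 <= B &
  forall z E F, A z -> `|hess u z E F| <= B * `|E| * `|F|.
Proof.
have [C C0 hC] := partial_lipschitz.
exists (\sum_(k < 2 + 2) \sum_(l < 2 + 2) C).
  by apply: sumr_ge0 => k _; apply: sumr_ge0.
move=> z E F Az; apply: le_trans (symform_bound E F (symform_hess oA su Az)) _.
apply: ler_wpM2r => //; apply: ler_wpM2r => //.
apply: ler_sum => k _; apply: ler_sum => l _.
apply: (@le_trans _ _ (C * `|delta_mx 0 k : V|)); last by rewrite -[leRHS]mulr1 ler_wpM2l ?norm_delta.
apply: lipschitz_dd => //; first exact: smooth_diff (smooth_dd _ su) Az.
by move=> x y Ax Ay; rewrite -!dd_partial; exact: hC.
Qed.

Lemma grad_bounded : exists2 G : R, 0 < G & forall z E, A z -> `|dd E u z| <= G * `|E|.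
Proof.
have [C C0 hC] := partial_lipschitz; have [M M0 hM] := closure_bound; have [x0 Ax0] := A0.
have hM' z : A z -> `|z| <= M by move=> Az; apply: hM; exact: subset_closure.
exists (1 + \sum_(k < 2 + 2) (`|partial k u x0| + C * (M + M))).
  by rewrite ltr_pwDl //; apply: sumr_ge0 => k _; rewrite addr_ge0 // mulr_ge0 ?addr_ge0 // ltW.
move=> z E Az; apply: le_trans (linform_bound E (linform_grad su Az)) _.
rewrite ler_wpM2r //; apply: ler_wpDl; first exact: ler01.
apply: ler_sum => k _; rewrite /grad -dd_partial.
rewrite -[partial k u z](subrK (partial k u x0)) addrC; apply: le_trans (ler_normD _ _) _.
rewrite lerD2l; apply: le_trans (hC _ _ _ Az Ax0) _; apply: ler_wpM2l => //.
by apply: le_trans (ler_normB _ _) _; apply: lerD; exact: hM'.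
Qed.

Hypothesis seg : forall x y (t : R), A x -> closure A y -> 0 < t <= 1 -> A (t *: x + (1 - t) *: y).

Lemma segA x E (t : R) : A x -> A (x + E) -> 0 <= t <= 1 -> A (x + t *: E).
Proof.
move=> Ax AE /andP[t0 t1]; have [->|tn0] := eqVneq t 0; first by rewrite scale0r addr0.
have -> : x + t *: E = t *: (x + E) + (1 - t) *: x by apply/rowP => i; rewrite !mxE; ring.
by apply: seg => //; [exact: subset_closure|rewrite lt_def tn0 t0].
Qed.

Section Bounds.
Context (G B : R).
Hypothesis G0 : 0 < G.
Hypothesis hG : forall z E, A z -> `|dd E u z| <= G * `|E|.
Hypothesis B0 : 0 <= B.
Hypothesis hB : forall z E F, A z -> `|hess u z E F| <= B * `|E| * `|F|.

Lemma u_taylor x z : A x -> A z -> `|u z - u x - dd (z - x) u x| <= B * `|z - x| ^+ 2.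
Proof.
move=> Ax Az; have e : x + (z - x) = z by rewrite addrC subrK.
rewrite -{1}e; apply: (taylor_le su) => // [t|w F Aw]; last exact: hB.
by apply: segA => //; rewrite e.
Qed.

Lemma u_lipschitz x z : A x -> A z -> u z - u x <= G * `|z - x|.
Proof.
move=> Ax Az; have e : x + (z - x) = z by rewrite addrC subrK.
have Aw t : 0 <= t <= 1 -> A (x + t *: (z - x)) by move=> ht; apply: segA => //; rewrite e.
have [|c /andP[c0 c1] hc] := @MVT_line R _ u x (z - x) 1 ltr01.
  by move=> t ht; exact: smooth_diff su (Aw t ht).
rewrite scale1r e mul1r in hc; rewrite hc; apply: le_trans (ler_norm _) _; apply: hG.
by apply: Aw; rewrite !ltW.
Qed.

(** The segment from x to b stays in the domain up to b, where u vanishes. *)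
Lemma boundary_distance x b : A x -> boundary A b -> - u x <= G * `|b - x|.
Proof.
move=> Ax bb; have /boundaryE[clb nAb] := bb; apply/ler_addgt0Pl => e e0.
have ub : - e < u b by rewrite u_boundary // oppr_lt0.
have /nbhs_ballP[r /= r0 hr] := within_gt clb ub.
have N0 : 0 < `|b - x| + 1 by rewrite ltr_wpDl.
pose t := Num.min 1 (r / 2 / (`|b - x| + 1)).
have t0 : 0 < t by rewrite lt_min ltr01 divr_gt0 // divr_gt0.
have t1 : t <= 1 by rewrite ge_min lexx.
have tr : t * `|b - x| < r.
  apply: (@le_lt_trans _ _ (r / 2)); last by rewrite ltr_pdivrMr // ltr_pMr // ltr1n.
  apply: (@le_trans _ _ (t * (`|b - x| + 1))); first by rewrite ler_wpM2l ?lerDl // ltW.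
  by rewrite -ler_pdivlMr // ge_min lexx orbT.
pose z := t *: x + (1 - t) *: b.
have Az : A z by apply: seg => //; rewrite t0.
have zb : b - z = t *: (b - x) by apply/rowP => i; rewrite !mxE; ring.
have uz : - e < u z.
  apply: hr; last exact: subset_closure.
  by rewrite -ball_normE /= zb normrZ (gtr0_norm t0).
have := u_lipschitz Ax Az; have -> : z - x = (1 - t) *: (b - x) by apply/rowP => i; rewrite !mxE; ring.
rewrite normrZ ger0_norm ?subr_ge0 // => h.
have h2 : G * ((1 - t) * `|b - x|) <= G * `|b - x|.
  by rewrite (ler_pM2l G0) -[leRHS]mul1r ler_wpM2r // lerBlDl lerDr ltW.
by move: h2 h uz; move: (G * _) (G * _) (u z) (u x) => *; lra.
Qed.

(** A boundary point on the segment from x to z would be too close to x for the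
    value of u there. *)
Lemma ball_sub x z : A x -> G * `|z - x| < - u x -> A z.
Proof.
move=> Ax hz; pose f (t : R) : V := x + t *: (z - x).
have cf : {within `[0, 1], continuous f}.
  apply: continuous_subspaceT => t; apply: cvgD; first exact: cvg_cst.
  by apply: cvgZ; [exact: cvg_id|exact: cvg_cst].
have cI : connected (`[0, 1] : set R) by apply/connected_intervalP; exact: interval_is_interval.
have cT : connected (f @` `[0, 1]) by exact: connected_continuous_connected cI cf.
have key : (f @` `[0, 1]) `&` A = f @` `[0, 1].
  apply: cT.
  - by exists x; split=> //; exists 0; rewrite /f ?scale0r ?addr0 //= in_itv /= lexx ler01.
  - by exists A.
  - exists (closure A); first exact: closed_closure.
    apply/seteqP; split=> p [Tp Ap]; split=> //; first exact: subset_closure.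
    have [//|bp] := closure_cases Ap.
    have := boundary_distance Ax bp; rewrite leNgt; case/negP.
    case: Tp => t /=; rewrite in_itv /= => /andP[t0 t1] <-.
    rewrite /f addrAC subrr add0r normrZ ger0_norm //; apply: le_lt_trans hz.
    by rewrite (ler_pM2l G0) -[leRHS]mul1r ler_wpM2r.
have : (f @` `[0, 1]) z.
  by exists 1; rewrite /f ?scale1r ?(addrC x) ?subrK //= in_itv /= lexx ler01.
by rewrite -key => -[].
Qed.

End Bounds.

(** * The boundary point lemma *)

Hypothesis sb : smooth_boundary A.

(** Interior ball condition: a defining function is at most its linear part
    plus a quadratic term, which is negative in a small enough ball. *)
Lemma interior_disc b : boundary A b -> exists2 y, 0 < dot (b - y) (b - y) &
  forall z, dot (z - y) (z - y) <= dot (b - y) (b - y) -> z != b -> A z.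
Proof.
move=> bb; have /boundaryE[clb nAb] := bb.
have [U [rho [oU Ub srho hrho [k rk]]]] := sb bb.
have sr := smooth_on_smooth oU srho.
pose w : V := \row_k partial k rho b.
have dw E : dd E rho b = dot E w.
  rewrite (dd_sum_partial E (smooth_diff sr Ub)); apply: eq_bigr => l _; by rewrite mxE.
have wk : w 0 k = partial k rho b by rewrite mxE.
have w0 : w != 0 by apply: contra rk => /eqP w0; rewrite -wk w0 mxE.
have rb : rho b <= 0.
  rewrite leNgt; apply/negP => rb.
  have n1 : \forall z \near b, 0 < rho z by exact: cvgr_gt _ (smooth_continuous sr Ub) _ rb.
  have n2 : \forall z \near b, U z by apply: open_nbhs_nbhs.
  have [z [Az [rz Uz]]] := clb _ (filterI n1 n2).
  by move/hrho: Az => /(_ Uz); rewrite ltNge ltW.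
have [r r0 hr] := open_norm_ball oU Ub.
have r20 : 0 < r / 2 by rewrite divr_gt0.
pose K : set V := closed_ball b (r / 2).
have KE z : K z <-> `|z - b| <= r / 2 by rewrite /K closed_ballE // /closed_ball_ /= distrC.
have KU : K `<=` U by move=> z /KE h; apply: hr; apply: le_lt_trans h _; rewrite ltr_pdivrMr // ltr_pMr // ltr1n.
have cK : compact K by exact: closed_ball_compact.
have [C C0 hC] := dd2_bound oU sr cK KU.
have W0 := dot_gt0 w0.
have N1 : 0 < `|w| + 1 by rewrite ltr_wpDl.
pose s := Num.min (1 / (4 * (C + 1))) (r / (16 * (`|w| + 1))).
have C4 : 0 < 4 * (C + 1) by rewrite mulr_gt0 // ltr_wpDl.
have w16 : 0 < 16 * (`|w| + 1) by rewrite mulr_gt0 // ltr0n.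
have s0 : 0 < s by rewrite lt_min !divr_gt0.
have s1 : s * (4 * (C + 1)) <= 1 by rewrite -ler_pdivlMr // ge_min lexx.
have s2 : s * (16 * (`|w| + 1)) <= r by rewrite -ler_pdivlMr // ge_min lexx orbT.
clearbody s.
exists (b - s *: w); first by rewrite subKr dotZl dotZr mulrA mulr_gt0 // mulr_gt0.
move=> z; rewrite subKr => hz zb.
have N0 : 0 < `|z - b| by rewrite normr_gt0 subr_eq0.
pose p := dot (z - b) w.
have hD : dot (z - b) (z - b) + 2 * s * p <= 0.
  move: hz; have -> : z - (b - s *: w) = (z - b) + s *: w by rewrite opprB addrA addrAC.
  rewrite /p; move: (z - b) => q; rewrite !dotDl !dotDr !dotZl !dotZr (dotC w q).
  by move: (dot q q) (dot q w) (s * (s * dot w w)) => q1 q2 q3; rewrite -[2 * s * q2]mulrA; move: (s * q2) => *; lra.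
have hN := norm_le_dot (z - b).
have hp : - p <= 4 * (`|z - b| * `|w|) by apply: le_trans (ler_norm _) _; rewrite normrN; exact: dot_le_norm.
have hK : `|z - b| <= 8 * s * `|w|.
  have : `|z - b| * `|z - b| <= `|z - b| * (8 * s * `|w|).
    rewrite -expr2; apply: le_trans hN _.
    have : 2 * s * - p <= 2 * s * (4 * (`|z - b| * `|w|)) by rewrite ler_wpM2l // mulr_ge0 // ltW.
    by have := hD; move: (dot (z - b) (z - b)) `|z - b| `|w| (p) => *; lra.
  by rewrite ler_pM2l.
have Kz : K z.
  apply/KE; apply: le_trans hK _; have : s * `|w| <= s * (`|w| + 1) by rewrite ler_pM2l // lerDl.
  by move: s2; move: (`|w|) => q; lra.
apply/(hrho z (KU _ Kz)).
have e : b + (z - b) = z by rewrite addrC subrK.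
have Kseg t : 0 <= t <= 1 -> K (b + t *: (z - b)).
  move=> /andP[t0 t1]; apply/KE; rewrite addrAC subrr add0r normrZ ger0_norm //.
  by move/KE: Kz; apply: le_trans; rewrite -[leRHS]mul1r ler_wpM2r.
have := taylor_le (smooth_sub KU sr) C0 Kseg (fun z F Kz => hC z Kz F F).
rewrite e dw -/p => /(le_trans (ler_norm _)) ht.
have hs : C * `|z - b| ^+ 2 * (2 * s) < `|z - b| ^+ 2.
  rewrite mulrAC -[ltRHS]mul1r ltr_pM2r ?exprn_gt0 //.
  by move: s1 s0; lra.
have : p * (2 * s) + C * `|z - b| ^+ 2 * (2 * s) < 0.
  have := hs; have := hN; have := hD.
  by move: (`|z - b| ^+ 2) (dot (z - b) (z - b)) (p) => q1 q2 q3; move: (C * q1 * _) => *; lra.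
rewrite -mulrDl pmulr_llt0; last by rewrite mulr_gt0.
by move: (C * _) (rho z) (rho b) ht rb => *; lra.
Qed.

Lemma laplacian_gt0 z : A z -> 0 < \sum_(k < 2 + 2) hess u z (delta_mx 0 k) (delta_mx 0 k).
Proof.
move=> Az; rewrite laplacianE addr_gt0 ?qR_hess_gt0 //.
have : 0 < qR (hess u z) re1 re1 * qR (hess u z) re2 re2.
  exact: lt_le_trans (hdet_hess_gt0 Az) (hdet_le _ _ _).
by rewrite pmulr_rgt0 // qR_hess_gt0.
Qed.

(** Hopf's lemma, by comparison with a Gaussian barrier in an annulus: u cannot
    vanish to second order at the boundary. *)
Lemma hopf b (C : R) : boundary A b -> exists2 z, A z & C * `|z - b| ^+ 2 < - u z.
Proof.
move=> bb; have /boundaryE[clb nAb] := bb.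
have [y] := interior_disc bb; set r1 := dot _ _ => r10 disk.
pose d z := dot (z - y) (z - y); pose r0 := r1 / 4.
have r00 : 0 < r0 by rewrite divr_gt0.
have cd : continuous d by exact: dot_continuous.
have clge (r : R) : closed [set z | r <= d z].
  by apply: (@closed_comp _ _ d [set t | r <= t]); [move=> z _; exact: cd|exact: closed_ge].
have clle (r : R) : closed [set z | d z <= r].
  by apply: (@closed_comp _ _ d [set t | t <= r]); [move=> z _; exact: cd|exact: closed_le].
pose K := [set z | r0 <= d z] `&` [set z | d z <= r1].
have Kcl : K `<=` closure A.
  move=> z [_ dz]; have [->//|zb] := eqVneq z b.
  by apply: subset_closure; exact: disk.
have cK : compact K by apply: subclosed_compact closure_compact Kcl; exact: closedI.
pose S := [set z | r0 <= d z] `&` [set z | d z <= r0].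
have r01 : r0 < r1 by rewrite ltr_pdivrMr // ltr_pMr // ltr1n.
have SK : S `<=` K by move=> z [h1 h2]; split=> //=; exact: le_trans h2 (ltW r01).
have cS : compact S by apply: subclosed_compact cK SK; exact: closedI.
pose w := b - y.
have S0 : S !=set0.
  exists (y + 2^-1 *: w); have -> : S = [set z | r0 <= d z <= r0].
    by apply/seteqP; split=> z /=; [move=> [-> ->]|move=> /andP[]].
  rewrite /= /d addrAC subrr add0r dotZl dotZr -/r1 /r0.
  have -> : 2^-1 * (2^-1 * r1) = r1 / 4 by field.
  by rewrite lexx.
have SA z : S z -> A z.
  move=> [_ /= dz]; apply: disk; first exact: le_trans dz (ltW r01).
  by apply/eqP => zb; move: dz; rewrite zb /d -/r1 leNgt r01.
have [z0 /set_mem Sz0 hz0] := EVT_max_rV S0 cS (continuous_subspaceW (subset_trans SK Kcl) cu).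
pose dl := - u z0; have dl0 : 0 < dl by rewrite oppr_gt0; apply: u_lt0; exact: SA.
pose k := 4 / r0; have k0 : 0 < k by rewrite divr_gt0.
pose F z := u z + dl * gauss k y z.
have cF : {within K, continuous F}.
  have cg : {within K, continuous (gauss k y)}.
    by apply: continuous_subspaceT => t; exact: gauss_continuous.
  have cuK := continuous_subspaceW Kcl cu.
  apply/subspace_continuousP => z Kz; apply: cvgD.
    by move/subspace_continuousP: cuK; exact.
  by apply: cvgM; [exact: cvg_cst|move/subspace_continuousP: cg; exact].
have K0 : K !=set0 by exists b; split=> //=; rewrite /d -/r1 ltW.
have [p /set_mem[/= p0 p1] hp] := EVT_max_rV K0 cK cF.
pose g1 := expR (- k * r1); have g10 : 0 < g1 := expR_gt0 _.
have Fp : F p <= dl * g1.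
  have [dp|dp] := eqVneq (d p) r1.
    rewrite /F /gauss -/(d p) dp -/g1 gerDr; apply: u_le0; apply: Kcl; split=> //=.
  have [dp0|dp0] := eqVneq (d p) r0.
    have := hz0 p (mem_set (conj p0 _)); rewrite /= dp0 lexx => /(_ isT) h.
    have := gauss_le1 y p (ltW k0); rewrite -(ler_pM2l dl0) mulr1 => h2.
    apply: le_trans (_ : 0 <= _); last by rewrite ltW // mulr_gt0.
    have h3 : u p <= - dl by rewrite opprK.
    by apply: le_trans (lerD h3 h2) _; rewrite addNr.
  have pr0 : r0 < d p by rewrite lt_def dp0.
  have pr1 : d p < r1 by rewrite lt_neqAle dp.
  pose A' := [set z | r0 < d z] `&` [set z | d z < r1].
  have oA' : open A'.
    have -> : A' = ~` [set z | d z <= r0] `&` ~` [set z | r1 <= d z].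
      by apply/seteqP; split=> z [/= h1 h2]; split=> /=; move: h1 h2; rewrite ?ltNge; [move=> /negP|move=> _ /negP|move=> /negP|move=> _ /negP].
    by apply: openI; exact: closed_openC.
  have A'A : A' `<=` A.
    move=> z [_ /= dz]; apply: disk; first exact: ltW.
    by apply/eqP => zb; move: dz; rewrite zb /d -/r1 ltxx.
  have A'p : A' p by [].
  have su' := smooth_sub A'A su.
  have sg := smooth_gauss k y oA'.
  have sF : smooth A' F by apply: smooth_add => //; exact: smooth_scale.
  have hE E : hess F p E E = hess u p E E + dl * hess (gauss k y) p E E.
    have e1 z : A' z -> dd E F z = dd E u z + dl * dd E (gauss k y) z.
      move=> Az; rewrite (dd_add E (smooth_diff su' Az) (smooth_diff (smooth_scale dl oA' sg) Az)).
      by rewrite (dd_scale dl E (smooth_diff sg Az)).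
    rewrite /hess (dd_congr E oA' e1 A'p).
    have sgE := smooth_dd E sg.
    rewrite (dd_add E (smooth_diff (smooth_dd E su') A'p) (smooth_diff (smooth_scale dl oA' sgE) A'p)).
    by rewrite (dd_scale dl E (smooth_diff sgE A'p)).
  have neg E : hess F p E E <= 0.
    have : 0 <= hess (fun z => - F z) p E E.
      apply: (second_difference_hess oA' (smooth_opp oA' sF) A'p) => t A1 A2.
      have inK z : A' z -> z \in K by move=> [h1 h2]; apply/mem_set; split; exact: ltW.
      by rewrite -!opprD lerN2; apply: lerD; apply: hp; exact: inK.
    rewrite /hess (dd_congr (g := fun z => - dd E F z) E oA') //; last first.
      by move=> z Az; rewrite (dd_opp E (smooth_diff sF Az)).
    by rewrite (dd_opp E (smooth_diff (smooth_dd E sF) A'p)) oppr_ge0.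
  have : \sum_(l < 2 + 2) hess F p (delta_mx 0 l) (delta_mx 0 l) <= 0.
    by apply: sumr_le0 => l _; exact: neg.
  under eq_bigr => l _ do rewrite hE.
  rewrite big_split /= -mulr_sumr laplacian_gauss leNgt; case/negP.
  apply: ltr_wpDr; last exact: laplacian_gt0 (A'A _ A'p).
  rewrite mulr_ge0 ?(ltW dl0) // mulr_ge0 ?(ltW (gauss_gt0 _ _ _)) // -/(d p).
  have -> : 4 * k ^+ 2 * d p - 8 * k = 4 * k * (k * d p - 2) by ring.
  have k4 : 0 < 4 * k by rewrite mulr_gt0.
  rewrite (pmulr_rge0 _ k4) subr_ge0.
  apply: (@le_trans _ _ (k * r0)); last by rewrite ler_pM2l // ltW.
  by rewrite /k divfK ?gt_eqF // ler_nat.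
have uK z : K z -> dl * (gauss k y z - g1) <= - u z.
  move=> Kz; have := le_trans (hp z (mem_set Kz)) Fp; rewrite /F mulrBr.
  by move: (dl * _) (dl * _) (u z) => *; lra.
pose c := dl * g1 * k * r1.
have c0 : 0 < c by exact: mulr_gt0 (mulr_gt0 (mulr_gt0 dl0 g10) k0) r10.
have kr : 0 < k * r1 by exact: mulr_gt0 k0 r10.
have C1 : 0 < (`|C| + 1) * r1 by rewrite mulr_gt0 // ltr_wpDl.
pose t := Num.min (1 / 2) (c / ((`|C| + 1) * r1) / 2).
have t0 : 0 < t by rewrite lt_min !divr_gt0.
have t1 : t <= 1 / 2 by rewrite ge_min lexx.
have t2 : t * ((`|C| + 1) * r1) < c.
  rewrite -ltr_pdivlMr //; apply: (@le_lt_trans _ _ (c / ((`|C| + 1) * r1) / 2)).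
    by rewrite ge_min lexx orbT.
  by rewrite ltr_pdivrMr // ltr_pMr ?divr_gt0 // ltr1n.
clearbody t.
pose z := b - t *: w.
have zy : z - y = (1 - t) *: w by rewrite /z /w; apply/rowP => i; rewrite !mxE; ring.
have dz : d z = (1 - t) ^+ 2 * r1 by rewrite /d zy dotZl dotZr mulrA -expr2.
have zb : z - b = - (t *: w) by rewrite /z addrAC subrr add0r.
have w0 : w != 0 by apply/eqP => w0; move: r10; rewrite /r1 -/w w0 -(scale0r (0 : V)) dotZl mul0r ltxx.
have t12 : (1 - t) ^+ 2 <= 1 by rewrite expr_le1 //; lra.
have Kz : K z.
  split; rewrite /= dz.
    rewrite /r0 mulrC ler_wpM2r ?(ltW r10) //.
    have : (1 / 2) ^+ 2 <= (1 - t) ^+ 2 by rewrite ler_sqr ?nnegrE; lra.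
    by apply: le_trans; rewrite expr2; lra.
  by rewrite -[leRHS]mul1r ler_wpM2r // ltW.
have Az : A z.
  apply: disk; first by case: Kz.
  by rewrite -subr_eq0 zb oppr_eq0 scaler_eq0 negb_or (gt_eqF t0).
exists z => //; apply: lt_le_trans (uK z Kz).
have gz : g1 * (1 + k * r1 * t) <= gauss k y z.
  rewrite /gauss -/(d z) dz.
  have -> : - k * ((1 - t) ^+ 2 * r1) = - k * r1 + k * r1 * (t * (2 - t)) by ring.
  rewrite expRD -/g1 ler_pM2l //; apply: le_trans (expR_ge1Dx _).
  rewrite lerD2l (ler_pM2l kr) ler_peMr; lra.
have hw : `|z - b| ^+ 2 <= t ^+ 2 * r1.
  by rewrite zb normrN normrZ exprMn (gtr0_norm t0) ler_pM2l ?exprn_gt0 //; exact: norm_le_dot.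
apply: (@lt_le_trans _ _ (c * t)); last first.
  apply: (@le_trans _ _ (dl * (g1 * (1 + k * r1 * t) - g1))); last by rewrite ler_pM2l // lerD2r.
  by rewrite /c le_eqVlt; apply/orP; left; apply/eqP; ring.
apply: (@le_lt_trans _ _ ((`|C| + 1) * (t ^+ 2 * r1))).
  apply: (@le_trans _ _ ((`|C| + 1) * `|z - b| ^+ 2)); last by rewrite ler_wpM2l // addr_ge0.
  rewrite ler_wpM2r ?exprn_ge0 //; apply: le_trans (ler_norm C) _; rewrite lerDl //.
have -> : (`|C| + 1) * (t ^+ 2 * r1) = t * ((`|C| + 1) * r1) * t by ring.
by rewrite ltr_pM2r.
Qed.

(** * The boundary layer *)

Section BoundaryLayer.
Context (G B : R).
Hypothesis G0 : 0 < G.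
Hypothesis hG : forall z E, A z -> `|dd E u z| <= G * `|E|.
Hypothesis B0 : 0 <= B.
Hypothesis hB : forall z E F, A z -> `|hess u z E F| <= B * `|E| * `|F|.

Lemma grad_le_partial z E (m : R) : A z -> 0 <= m -> (forall k, `|partial k u z| <= m) ->
  `|dd E u z| <= 4 * m * `|E|.
Proof.
move=> Az m0 h; apply: le_trans (linform_bound E (linform_grad su Az)) _.
rewrite ler_wpM2r //; apply: (@le_trans _ _ (\sum_(k < 2 + 2) m)).
  by apply: ler_sum => k _; rewrite /grad -dd_partial.
by rewrite sumr_const card_ord mulr_natl.
Qed.

(** If the gradient were small at points tending to b, Taylor's formula would
    bound -u by a multiple of the squared distance to b, against Hopf's lemma. *)
Lemma gradient_near b : boundary A b -> exists2 eta : R, 0 < eta &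
  \forall x \near b, A x -> - u x < eta -> exists k, eta <= `|partial k u x|.
Proof.
move=> bb; have [z Az hz] := hopf B bb.
pose D := `|z - b|; pose e := - u z - B * D ^+ 2.
have e0 : 0 < e by rewrite subr_gt0.
have D0 : 0 <= D := normr_ge0 _.
have p1 : 0 < 4 * (D + 1) + 1 by rewrite ltr_wpDl // mulr_ge0 // addr_ge0.
have p2 : 0 < B * (2 * D + 1) + 1 by rewrite ltr_wpDl // mulr_ge0 // addr_ge0 // mulr_ge0.
pose eta := e / 2 / (4 * (D + 1) + 1).
pose r := Num.min 1 (e / 2 / (B * (2 * D + 1) + 1)).
have eta0 : 0 < eta by rewrite !divr_gt0.
have r0 : 0 < r by rewrite lt_min ltr01 !divr_gt0.
have r1 : r <= 1 by rewrite ge_min lexx.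
have re : r * (B * (2 * D + 1) + 1) <= e / 2 by rewrite -ler_pdivlMr // ge_min lexx orbT.
have ee : eta * (4 * (D + 1) + 1) = e / 2 by rewrite /eta divfK // gt_eqF.
clearbody r eta.
exists eta => //; apply/nbhs_ballP; exists r => //= x; rewrite -ball_normE /= => hx Ax ux.
apply: contrapT => nk.
have nk' k : `|partial k u x| <= eta by rewrite leNgt; apply/negP => h; apply: nk; exists k; exact: ltW.
have zx : `|z - x| <= D + r.
  by rewrite -(subrK b z) -addrA; apply: le_trans (ler_normD _ _) _; rewrite lerD2l ltW.
have := u_taylor B0 hB Ax Az.
have := grad_le_partial (z - x) Ax (ltW eta0) nk'.
rewrite ler_norml => /andP[g1 _]; rewrite ler_norml => /andP[t1 _].
have s1 : 4 * eta * `|z - x| <= 4 * eta * (D + 1).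
  rewrite ler_wpM2l ?mulr_ge0 ?(ltW eta0) //; apply: le_trans zx _; by rewrite lerD2l.
have s2 : B * `|z - x| ^+ 2 <= B * (D ^+ 2 + r * (2 * D + 1)).
  apply: ler_wpM2l => //; apply: (@le_trans _ _ ((D + r) ^+ 2)).
    by rewrite ler_sqr ?nnegrE // addr_ge0 // ltW.
  have -> : (D + r) ^+ 2 = D ^+ 2 + r * (2 * D + r) by ring.
  by rewrite lerD2l ler_wpM2l ?(ltW r0) // lerD2l.
have s3 : e = - u z - B * D ^+ 2 by [].
have s2' : B * `|z - x| ^+ 2 <= B * D ^+ 2 + r * (B * (2 * D + 1)).
  by apply: le_trans s2 _; rewrite le_eqVlt; apply/orP; left; apply/eqP; ring.
have re' : r * (B * (2 * D + 1)) + r <= e / 2.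
  by apply: le_trans re; rewrite le_eqVlt; apply/orP; left; apply/eqP; ring.
have ee' : 4 * eta * (D + 1) + eta = e / 2 by rewrite -ee; ring.
move: s3 s2' re' t1 g1 s1 ee'; clear -ux r0.
move: (B * D ^+ 2) (r * _) (B * `|z - x| ^+ 2) => q1 q2 q3.
move: (4 * eta * `|z - x|) (4 * eta * _) (dd (z - x) u x) => q4 q5 q6.
by move: (u z) (u x) ux => *; lra.
Qed.

(** The local lower bounds hold near every point of the compact closure, being
    void near interior points. *)
Lemma gradient_strip : exists2 eta : R, 0 < eta &
  forall x, A x -> - u x < eta -> exists k, eta <= `|partial k u x|.
Proof.
pose P (eta : R) x := A x -> - u x < eta -> exists k, eta <= `|partial k u x|.
have mono e e' x : e' <= e -> P e x -> P e' x.
  move=> le he Ax ux; have [k hk] := he Ax (lt_le_trans ux le).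
  by exists k; exact: le_trans le hk.
have loc x : closure A x -> exists2 eta : R, 0 < eta & \forall x' \near x, P eta x'.
  move=> clx; have [Ax|bx] := closure_cases clx; last exact: gradient_near.
  exists (- u x / 2); first by rewrite divr_gt0 // oppr_gt0 u_lt0.
  have ux := u_lt0 Ax.
  have n1 : \forall x' \near x, u x' < u x / 2.
    by apply: cvgr_lt (smooth_continuous su Ax) _ _; lra.
  by apply: filterS n1 => x' h _ h'; exfalso; lra.
have /compact_near_coveringP h := closure_compact.
have n : \forall eta \near (0 : R)^'+, closure A `<=` P eta.
  apply: h => x clx; have [eta eta0 n1] := loc x clx.
  exists ([set x' | P eta x'], [set e | e < eta]) => /=.
    by split=> //; exact: nbhs_right_lt.
  by move=> [x' e] [/= h1 h2]; apply: mono h1; exact: ltW.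
have [eta [h1 h2]] : exists e : R, closure A `<=` P e /\ 0 < e.
  by apply: (@filter_ex _ (0 : R)^'+); apply: filterI n _; exact: nbhs_right_gt.
by exists eta => // x Ax; apply: (h1 _ (subset_closure Ax)).
Qed.

(** Where - u is small its gradient is not: moving along the gradient inside the
    ball of radius r makes - u drop by a multiple of r, and - u stays positive. *)
Lemma depth_le : exists2 c : R, 0 < c & forall m (r : R), 0 < r ->
  (forall z, `|z - m| < r -> A z) -> c * r <= - u m.
Proof.
have [eta eta0 heta] := gradient_strip; have [M M0 hM] := closure_bound.
have D0 : 0 < 2 * M by rewrite mulr_gt0.
have B1 : 0 < 2 * (B + 1) * (2 * M) by rewrite mulr_gt0 // mulr_gt0 // ltr_wpDl.
pose t := Num.min (1 / 2) (eta / (2 * (B + 1) * (2 * M))).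
have t0 : 0 < t by rewrite lt_min !divr_gt0.
have t1 : t <= 1 / 2 by rewrite ge_min lexx.
have t2 : t * (2 * (B + 1) * (2 * M)) <= eta by rewrite -ler_pdivlMr // ge_min lexx orbT.
clearbody t.
exists (Num.min (eta / (2 * M)) (t * eta / 2)).
  by rewrite lt_min !divr_gt0 // mulr_gt0.
move=> m r r0 hr; have Am : A m by apply: hr; rewrite subrr normr0.
have nd := @norm_delta; pose e0 : V := delta_mx 0 (lshift 2 0).
have rM : r <= 2 * M.
  rewrite leNgt; apply/negP => h.
  have n1 : `|e0| = 1.
    by apply/eqP; rewrite eq_le nd /= -[leLHS](normr1 R); have := coord_le_norm e0 (lshift 2 0); rewrite mxE !eqxx.
  have Az : A (m + (2 * M) *: e0).
    by apply: hr; rewrite addrAC subrr add0r normrZ n1 mulr1 gtr0_norm.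
  have Az' : A (m - (2 * M) *: e0).
    by apply: hr; rewrite addrAC subrr add0r normrN normrZ n1 mulr1 gtr0_norm.
  have h1 := hM _ (subset_closure Az); have h2 := hM _ (subset_closure Az').
  have := le_trans (ler_normB _ _) (lerD h1 h2).
  have -> : m + 2 * M *: e0 - (m - 2 * M *: e0) = (4 * M) *: e0 by apply/rowP => i; rewrite !mxE; ring.
  by rewrite normrZ n1 mulr1 gtr0_norm ?mulr_gt0 //; lra.
have [um|um] := leP eta (- u m).
  apply: (@le_trans _ _ (eta / (2 * M) * r)); first by rewrite ler_wpM2r ?(ltW r0) // ge_min lexx.
  by apply: le_trans um; rewrite mulrAC ler_pdivrMr // ler_pM2l.
have [k hk] := heta m Am um.
have [E [E1 hE]] : exists E, `|E| <= 1 /\ eta <= dd E u m.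
  have [hp|hp] := leP 0 (partial k u m).
    by exists (delta_mx 0 k); split=> //; rewrite -dd_partial -(ger0_norm hp).
  exists (- delta_mx 0 k); split; first by rewrite normrN.
  by rewrite (ddN _ (smooth_diff su Am)) -dd_partial -(ltr0_norm hp).
pose s := t * r; have s0 : 0 < s by rewrite mulr_gt0.
have Az : A (m + s *: E).
  apply: hr; rewrite addrAC subrr add0r normrZ (gtr0_norm s0).
  apply: (@le_lt_trans _ _ (s * 1)); first by rewrite ler_pM2l.
  by rewrite mulr1 /s gtr_pMl //; lra.
have := u_taylor B0 hB Am Az; rewrite [m + _]addrC addrK ler_norml => /andP[h1 _].
rewrite (ddZ _ _ (smooth_diff su Am)) normrZ (gtr0_norm s0) in h1.
have h2 : s * eta <= s * dd E u m by rewrite ler_pM2l.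
have h3 : B * (s * `|E|) ^+ 2 <= s * (eta / 2).
  have -> : B * (s * `|E|) ^+ 2 = s * (B * s * `|E| ^+ 2) by ring.
  rewrite ler_pM2l //; apply: (@le_trans _ _ (B * s * 1)).
    by apply: ler_wpM2l; [exact: mulr_ge0 B0 (ltW s0)|rewrite expr_le1].
  rewrite mulr1 /s; apply: (@le_trans _ _ ((B + 1) * (t * (2 * M)))).
    by apply: ler_pM => //; [rewrite mulr_ge0 // ltW|rewrite lerDl|rewrite ler_pM2l].
  by move: t2; rewrite (_ : t * (2 * (B + 1) * (2 * M)) = 2 * ((B + 1) * (t * (2 * M)))); [move: ((B + 1) * _) => *; lra|ring].
have uz := u_lt0 Az.
apply: (@le_trans _ _ (t * eta / 2 * r)); first by rewrite ler_wpM2r ?(ltW r0) // ge_min lexx orbT.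
have -> : t * eta / 2 * r = s * eta - s * (eta / 2) by rewrite /s; field.
rewrite [m + _]addrC in uz.
by move: (s * eta) (s * (eta / 2)) (s * dd E u m) (B * _) (u _) (u m) h1 h2 h3 uz => *; lra.
Qed.

(** Balls around x and y of radii comparable with - u x and - u y lie in the
    domain; by convexity so does the ball around the midpoint whose radius is the
    mean of the two, and - u at the midpoint is at least a multiple of that mean. *)
Lemma gap_bounded : exists W : R, forall x y, A x -> A y ->
  logu (2^-1 *: (x + y)) - (logu x + logu y) / 2 <= W.
Proof.
have [c c0 hc] := depth_le; pose kp := c / (2 * G).
have G2 : 0 < 2 * G by rewrite mulr_gt0.
have kp0 : 0 < kp by rewrite divr_gt0.
exists (- ln kp) => x y Ax Ay.
have ux : 0 < - u x by rewrite oppr_gt0 u_lt0.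
have uy : 0 < - u y by rewrite oppr_gt0 u_lt0.
pose m := 2^-1 *: (x + y); pose r := (- u x - u y) / (2 * G).
have uxy : 0 < - u x - u y by rewrite addr_gt0.
have r0 : 0 < r by rewrite divr_gt0.
have Gn : G != 0 by rewrite gt_eqF.
have sub z : `|z - m| < r -> A z.
  move=> hz; pose w := z - m.
  have near p : A p -> A (p + (- u p / G / r) *: w).
    move=> Ap; have up : 0 < - u p by rewrite oppr_gt0 u_lt0.
    apply: (ball_sub G0 hG Ap); rewrite addrAC subrr add0r normrZ gtr0_norm ?divr_gt0 //.
    have -> : G * (- u p / G / r * `|w|) = - u p * (`|w| / r) by field; rewrite Gn gt_eqF.
    by rewrite gtr_pMr // ltr_pdivrMr // mul1r.
  have -> : z = 2^-1 *: (x + (- u x / G / r) *: w + (y + (- u y / G / r) *: w)).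
    have -> : x + (- u x / G / r) *: w + (y + (- u y / G / r) *: w) =
        (x + y) + (- u x / G / r + - u y / G / r) *: w by rewrite addrACA scalerDl.
    have -> : - u x / G / r + - u y / G / r = 2.
      rewrite /r; field; rewrite Gn /=.
      by rewrite (gt_eqF uxy).
    by rewrite scalerDr scalerA mulVf // scale1r -/m /w addrC subrK.
  have mid p q : A p -> A q -> A (2^-1 *: (p + q)).
    move=> Ap Aq; have -> : 2^-1 *: (p + q) = 2^-1 *: p + (1 - 2^-1) *: q.
      by apply/rowP => i; rewrite !mxE; field.
    by apply: seg => //; [exact: subset_closure|lra].
  by apply: mid; exact: near.
have Am : A m by apply: sub; rewrite subrr normr0.
have hm := hc m r r0 sub.
rewrite /logu -/m.
have h1 : ln (kp * ((- u x - u y) / 4)) <= ln (- u m / 4).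
  rewrite ler_ln ?posrE ?logu_arg_gt0 //; last by rewrite mulr_gt0 // divr_gt0.
  by rewrite mulrA ler_pM2r // /kp mulrAC -mulrA.
rewrite lnM ?posrE // in h1; last by rewrite divr_gt0.
have hp p : A p -> - u p <= - u x - u y -> ln (- u p / 4) <= ln ((- u x - u y) / 4).
  by move=> Ap h; rewrite ler_ln ?posrE ?logu_arg_gt0 ?divr_gt0 // ler_pM2r.
have h2 := hp x Ax (ler_wpDr (ltW uy) (lexx _)).
have h3 := hp y Ay (ler_wpDl (ltW ux) (lexx _)).
move: (ln kp) (ln _) (ln _) (ln _) (ln _) h1 h2 h3 => *; lra.
Qed.

(** For w = - ln (- u / 4), the form of (1 - e) w is 1 - e times the sum of the form
    of w and of e times the square of the gradient of w. Near the boundary this square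
    is of order (- u)^-2, against at most (- u)^-1 for the form, so that the
    determinant gains more than the factor 1 - e loses. *)
Lemma strict_strip : exists c0 : R, forall e : R, 0 < e < 1 / 4 -> forall x, A x -> c0 < logu x ->
  (forall E, E != 0 -> 0 < qR (logform (fun z => (1 - e) * logu z) x) E E) /\
  16 * lam < hdet (logform (fun z => (1 - e) * logu z) x) re1 re2.
Proof.
have [eta eta0 heta] := gradient_strip.
have L0 : 0 < 16 * lam by rewrite mulr_gt0 // ltr0n.
pose T := 4 * B + 1; have T0 : 0 < T by rewrite ltr_wpDl // mulr_ge0.
pose dl := Num.min eta (eta ^+ 2 / (4 * T)).
have T4 : 0 < 4 * T by rewrite mulr_gt0.
have dl0 : 0 < dl by rewrite lt_min eta0 divr_gt0 // exprn_gt0.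
exists (- ln (dl / 4)) => e /andP[e0 e4] x Ax vx.
have ux : 0 < - u x by rewrite oppr_gt0 u_lt0.
have udl : - u x < dl.
  move: vx; rewrite /logu ltrN2 ltr_ln ?posrE ?logu_arg_gt0 ?divr_gt0 //.
  by rewrite ltr_pM2r.
have dle : dl <= eta by rewrite ge_min lexx.
have [k hk] := heta x Ax (lt_le_trans udl dle).
have uT : - u x * (4 * T) <= eta ^+ 2.
  by rewrite -ler_pdivlMr //; apply: le_trans (ltW udl) _; rewrite ge_min lexx orbT.
have sv := smooth_logu.
pose w : V := \row_k dd (delta_mx 0 k) logu x.
have gw E : grad logu x E = dot w E.
  rewrite /grad (dd_sum_partial E (smooth_diff sv Ax)) dotC; apply: eq_bigr => l _.
  by rewrite mxE dd_partial.
have ww : eta ^+ 2 <= (- u x) ^+ 2 * dot w w.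
  apply: (@le_trans _ _ ((- u x) ^+ 2 * (w 0 k) ^+ 2)).
    rewrite -exprMn mxE dd_logu // -dd_partial -[leRHS]real_normK ?num_real //.
    by rewrite ler_sqr ?nnegrE ?normr_ge0 // ltW.
  rewrite ler_wpM2l ?sqr_ge0 // /dot (bigD1 k) //= -expr2 lerDl.
  by apply: sumr_ge0 => l _; rewrite -expr2 sqr_ge0.
pose Q := logform logu x; pose K := fun E F : V => dot w E * dot w F.
have sQ : symform Q := symform_logform oA sv Ax.
have tr : qR Q re1 re1 + qR Q re2 re2 <= (- u x)^-1 * T.
  rewrite /Q !qR_logform_logu // -mulrDr ler_pM2l ?invr_gt0 //.
  have bd E : `|E| <= 1 -> hess u x E E <= B.
    move=> hE; apply: le_trans (ler_norm _) (le_trans (hB _ _ Ax) _).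
    rewrite -[leRHS]mulr1 ler_pM ?mulr_ge0 //.
    by rewrite -[leRHS]mulr1 ler_pM.
  have n1 := @norm_re1 R; have n2 := @norm_re2 R.
  have := bd _ (le_trans (norm_J_le re1) n1); have := bd _ (le_trans (norm_J_le re2) n2).
  rewrite /qR /T; move: (bd _ n1) (bd _ n2).
  move: (hess u x re1 re1) (hess u x re2 re2) => w1 w2.
  by move: (hess u x (J re1) (J re1)) (hess u x (J re2) (J re2)) => w3 w4 *; lra.
have tr0 := logform_trace L0 logu_pde logu_pos Ax.
have hpolK : 4 * (16 * lam) <= hpol Q K re1 re2.
  have D0 : 0 < hdet Q re1 re2 by rewrite logu_pde.
  apply: le_trans (hpol_sqr_coercive w sQ (logu_pos Ax) D0); rewrite logu_pde // mulrAC ler_pdivlMr //.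
  apply: (@le_trans _ _ (4 * (16 * lam) * ((- u x)^-1 * T))).
    by rewrite ler_wpM2l // mulr_ge0 // ltW.
  rewrite [4 * _]mulrC -!mulrA !ler_pM2l // mulrCA ler_pdivrMl //.
  rewrite -(ler_pM2l ux); apply: le_trans uT (le_trans ww _).
  by rewrite [leRHS]mulrA -expr2.
have LE : logform (fun z => (1 - e) * logu z) x = (fun E F => (1 - e) * (1 * Q E F + e * K E F)).
  apply/funext => E; apply/funext => F.
  have dE E' z : A z -> dd E' (fun z => (1 - e) * logu z) z = (1 - e) * dd E' logu z.
    by move=> Az; rewrite (dd_scale _ E' (smooth_diff sv Az)).
  rewrite /logform /hess /grad (dd_congr E oA (dE F) Ax) !dE //.
  rewrite (dd_scale _ E (smooth_diff (smooth_dd F sv) Ax)) /Q /K /logform -!gw /grad /hess.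
  by move: (dd E (dd F logu) x) (dd E logu x) (dd F logu x) => *; ring.
have e1 : 0 < 1 - e by lra.
rewrite LE; split=> [E E0|].
  have -> : qR (fun E F => (1 - e) * (1 * Q E F + e * K E F)) E E =
     (1 - e) * (qR Q E E + e * (dot w E ^+ 2 + dot w (J E) ^+ 2)) by rewrite /qR /K; ring.
  rewrite mulr_gt0 //; apply: ltr_pwDl; first exact: (logform_pos oA smooth_logu L0 logu_pde logu_pos Ax E0).
  by rewrite mulr_ge0 ?(ltW e0) // addr_ge0 // sqr_ge0.
rewrite hdet_scale hdet_lin.
have -> : hdet K re1 re2 = 0 by rewrite /hdet /qR /qI /K; ring.
rewrite logu_pde // mulr0 addr0.
have h1 : e * (4 * (16 * lam)) <= e * hpol Q K re1 re2 by rewrite ler_pM2l.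
apply: (@lt_le_trans _ _ ((1 - e) ^+ 2 * (16 * lam + e * (4 * (16 * lam))))); last first.
  by rewrite ler_wpM2l ?sqr_ge0 // lerD2l.
rewrite -subr_gt0.
have -> : (1 - e) ^+ 2 * (16 * lam + e * (4 * (16 * lam))) - 16 * lam =
  16 * lam * (e * (2 - 7 * e + 4 * e ^+ 2)) by ring.
rewrite mulr_gt0 // mulr_gt0 //.
by have := sqr_ge0 e; lra.
Qed.

End BoundaryLayer.

Lemma eigenfunction_strictly_convex : strictly_convex_on A logu.
Proof.
have [G G0 hG] := grad_bounded; have [B B0 hB] := hess_bounded.
have L0 : 0 < 16 * lam by rewrite mulr_gt0 // ltr0n.
apply: (exhausting_strictly_convex oA smooth_logu L0 logu_pde logu_pos cA _ A0 logu_exhaust _ _ A_squares_bounded).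
- move=> x y t Ax Ay /andP[t0 t1]; have [->|tn0] := eqVneq t 0.
    by rewrite scale0r add0r subr0 scale1r.
  by apply: seg => //; [exact: subset_closure|rewrite lt_def tn0 t0].
- exact: (gap_bounded G0 hG B0 hB).
- exact: (strict_strip B0 hB).
Qed.

End Eigenfunction.

Theorem theorem1p1 (R : realType) (Omega : set (C2 R)) (lam : R) (u : C2 R -> R)
    (Omega_domain : domain Omega)
    (Omega_bounded : bounded_set Omega)
    (Omega_smooth : smooth_boundary Omega)
    (Omega_convex : strictly_convex_domain Omega)
    (lam_eigenvalue : MA_first_eigenvalue Omega lam)
    (u_eigenfunction : MA_eigenfunction Omega lam u) :
  strictly_convex_on Omega (fun z => - ln (- u z / 4)).
Proof.
have [oA A0 cA] := Omega_domain; have [lam0 _] := lam_eigenvalue.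
have [[_ /(smooth_on_smooth oA) su [cu _ lip]] [det_u u_lt0 u_bd]] := u_eigenfunction.
apply: (@eigenfunction_strictly_convex R Omega u lam) => //.
- move=> z Az; have := det_u z Az; rewrite (det_complex_hessian oA su Az) => -[h].
  by rewrite -[16 * lam * _]mulrA -(sqrrN (u z)) -h; field.
- have lip4 : \forall M \near +oo, forall k : 'I_(2 + 2), forall t : C2 R * C2 R, (Omega `*` Omega) t ->
      `|partial k u t.1 - partial k u t.2| <= M * `|t.1 - t.2|.
    by apply: filter_forall => k; exact: lip.
  have [M [M0 hM]] := filter_ex (filterI (nbhs_pinfty_ge (num_real 0)) lip4).
  by exists M => // k x y Ax Ay; apply: (hM k (x, y)).
- move=> x y t Ax cly /andP[t0 t1]; have [xy|xy] := eqVneq x y.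
    by rewrite -xy -scalerDl subrKC scale1r.
  have [->|tn1] := eqVneq t 1; first by rewrite scale1r subrr scale0r addr0.
  by apply: Omega_convex => //; [exact: subset_closure|rewrite t0 lt_neqAle tn1 t1].
Qed.
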